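(* Let $\mathcal{X}$ be a nonsingular plane curve over the finite field $\mathbb{F}_q$ with homogeneous equation $XY^{n}+YZ^{n}+ZX^{n}+XYZ\cdot G(X,Y,Z)=0$, and let $P_1=(1:0:0)$, $P_2=(0:1:0)$, $P_3=(0:0:1)$. Let $i,j,k\ge 0$ be integers, let $d=i+j+k\le n-3$, and set $$(n_1,n_2,n_3)=(kn+j+1,\ in+k+1,\ jn+i+1),$$ $$(p_1,p_2,p_3)=\big((k+1)n-k-i-2,\ (i+1)n-i-j-2,\ (j+1)n-j-k-2\big).$$ Let $Q_1,\ldots,Q_m$ be $m$ distinct points of $\mathcal{X}(\mathbb{F}_q)\setminus\{P_1,P_2,P_3\}$, and let $D=Q_1+\cdots+Q_m$ and $F_2=\sum_{s=1}^{3}(n_s+p_s-1)P_s$. If $\frac{(n-2)^2}{2n-1}<d\le n-3$ and $m\ge 2n^2-4n-2$, then the Goppa code $C_{\Omega}(D,F_2)$ has length $m$, dimension $$\dim C_{\Omega}(D,F_2)=m+\tfrac{1}{2}n^2-\left(2d+\tfrac{7}{2}\right)n+d+5,$$ and minimum distance $$\mathrm{d}(C_{\Omega}(D,F_2))\ge (2d+7)n-n^2-4d-10.$$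
   Context: Here $n\ge 3$ and $G(X,Y,Z)\in\mathbb{F}_q[X,Y,Z]$ is either zero or homogeneous of degree $n-2$; nonsingular means nonsingular over the algebraic closure of $\mathbb{F}_q$. For a divisor $F$ on $\mathcal{X}$ defined over $\mathbb{F}_q$ and $D=Q_1+\cdots+Q_m$ with $Q_1,\ldots,Q_m$ distinct $\mathbb{F}_q$-rational points not in the support of $F$, the Goppa (algebraic geometry) code $C_{\Omega}(D,F)$ is the image of the $\mathbb{F}_q$-linear map $\Omega(F-D)\to\mathbb{F}_q^m$, $\eta\mapsto(\operatorname{res}_{Q_1}(\eta),\ldots,\operatorname{res}_{Q_m}(\eta))$, where $\Omega(F-D)$ is the $\mathbb{F}_q$-space of differentials $\eta$ on $\mathcal{X}$ (over $\mathbb{F}_q$) such that $\eta=0$ or $\operatorname{div}(\eta)\ge F-D$. Minimum distance is with respect to the Hamming metric. *)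

(* Defs.v *)
From HB Require Import structures.
From mathcomp Require Import all_boot all_order all_algebra.
From mathcomp Require Import boolp.
From mathcomp Require Import mpoly.

Set Implicit Arguments.
Unset Strict Implicit.
Unset Printing Implicit Defensive.

Import Order.TTheory GRing.Theory Num.Theory.
Local Open Scope ring_scope.

(* A point of P^2(L) is given by homogeneous coordinates, i.e. by a nonzero row
   vector [P : 'rV[L]_3] up to a nonzero scalar; the argument of a trivariate
   polynomial is then the function [P 0]. *)
Definition same_point (L : fieldType) (P Q : 'rV[L]_3) : Prop :=
  exists2 c : L, c != 0 & P = c *: Q.

Definition on_curve (L : fieldType) (f : {mpoly L[3]}) (P : 'rV[L]_3) : Prop :=
  P != 0 /\ f.@[P 0] = 0.

(* [L], with [iota], is an algebraic closure of [F]. *)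
Definition nonsingular (F : fieldType) (f : {mpoly F[3]}) : Prop :=
  forall (L : closedFieldType) (iota : {rmorphism F -> L}),
    integralRange iota ->
    forall P : 'rV[L]_3, on_curve (map_mpoly iota f) P ->
    exists s : 'I_3, (map_mpoly iota f)^`M(s).@[P 0] != 0.

(* The coordinates X, Y, Z are the variables of index 0, 1, 2. *)
Definition curve_poly (F : fieldType) (n : nat) (G : {mpoly F[3]}) :
    {mpoly F[3]} :=
  let X : {mpoly F[3]} := 'X_(0 : 'I_3) in
  let Y : {mpoly F[3]} := 'X_(1 : 'I_3) in
  let Z : {mpoly F[3]} := 'X_(2 : 'I_3) in
  X * Y ^+ n + Y * Z ^+ n + Z * X ^+ n + X * Y * Z * G.

(** The field F(X) of an integral curve f = 0 consists of the fractions A / B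
    of forms of the same degree with f not dividing B, where two fractions
    A / B and A' / B' are identified iff f divides A B' - A' B.  This is
    expressed by means of the generic point [ff_gen] of the curve, a point of
    P^2 with coordinates in F(X): the class of A / B is
    A(ff_gen) / B(ff_gen), which does not depend on the choice of the
    homogeneous coordinates of the generic point.  The conditions below
    determine the extension F(X) / F and the classes A / B up to a unique
    isomorphism; they can be met only if f is irreducible over F. *)

Record function_field (F : fieldType) (f : {mpoly F[3]}) := FunctionField {
  ff_sort :> fieldType;
  ff_const : {rmorphism F -> ff_sort};
  ff_gen : 'rV[ff_sort]_3;
  ff_gen_neq0 : ff_gen != 0;
  ff_vanish : forall (e : nat) (A : {mpoly F[3]}), A \is e.-homog ->
    (map_mpoly ff_const A).@[ff_gen 0] = 0 <-> (exists B, A = f * B);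
  ff_fraction : forall z : ff_sort,
    exists (e : nat) (A B : {mpoly F[3]}),
      [/\ A \is e.-homog, B \is e.-homog,
          (map_mpoly ff_const B).@[ff_gen 0] != 0 &
          z = (map_mpoly ff_const A).@[ff_gen 0]
              / (map_mpoly ff_const B).@[ff_gen 0]] }.

Section FunctionField.

Variables (F : fieldType) (f : {mpoly F[3]}) (K : function_field f).

Definition form_at_gen (A : {mpoly F[3]}) : K :=
  (map_mpoly (ff_const K) A).@[ff_gen K 0].

(** For a nonsingular curve the closed points over F are the places of F(X),
    i.e. the normalized discrete valuations of F(X) that are trivial on F.
    The value at 0, which should be +oo, is set to 0 by convention so that
    each place is counted only once. *)

Record place := Place {
  place_val :> K -> int;
  place0 : place_val 0 = 0;
  placeM : forall x y, x != 0 -> y != 0 ->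
    place_val (x * y) = place_val x + place_val y;
  placeD : forall x y, x != 0 -> y != 0 -> x + y != 0 ->
    Num.min (place_val x) (place_val y) <= place_val (x + y);
  place_const : forall a : F, a != 0 -> place_val (ff_const K a) = 0;
  place_normalized : exists t, place_val t = 1 }.

Definition val_ge (v : place) (x : K) (c : int) : Prop := x = 0 \/ c <= v x.

(* The place [v] is the rational point [P]: its valuation ring dominates the
   local ring of the curve at [P]. *)
Definition place_at (v : place) (P : 'rV[F]_3) : Prop :=
  forall (e : nat) (A B : {mpoly F[3]}), A \is e.-homog -> B \is e.-homog ->
    B.@[P 0] != 0 ->
    val_ge v (form_at_gen A / form_at_gen B) 0 /\
    (A.@[P 0] = 0 -> val_ge v (form_at_gen A / form_at_gen B) 1).

(* A divisor is given by its coefficients at all places. *)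
Definition divisor := place -> int.

Definition point_div (P : 'rV[F]_3) : divisor :=
  fun v => if `[< place_at v P >] then 1 else 0.

Definition sum_points (r : nat) (c : 'I_r -> int) (P : 'I_r -> 'rV[F]_3) :
    divisor :=
  fun v => \sum_(s < r) c s * point_div (P s) v.

Definition derivation (M : lmodType K) (D : K -> M) : Prop :=
  [/\ forall x y, D (x + y) = D x + D y,
      forall x y, D (x * y) = x *: D y + y *: D x &
      forall a : F, D (ff_const K a) = 0].

(* The module of Kaehler differentials of F(X) / F, determined up to a unique
   isomorphism by its universal property. *)
Record differentials := Differentials {
  diff_sort :> lmodType K;
  diff_d : K -> diff_sort;
  diff_derivation : derivation diff_d;
  diff_factor : forall (M : lmodType K) (D : K -> M), derivation D ->
    exists phi : {linear diff_sort -> M}, forall x, D x = phi (diff_d x);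
  diff_factor_uniq : forall (M : lmodType K)
      (phi psi : {linear diff_sort -> M}),
    (forall x, phi (diff_d x) = psi (diff_d x)) -> phi =1 psi }.

Variable Om : differentials.

(* [k] is the coefficient at [v] of the divisor of [eta != 0]: the order of
   [g] where [eta = g dt] for a local parameter [t] at [v]. *)
Definition diff_order (v : place) (eta : Om) (k : int) : Prop :=
  exists t g : K, [/\ v t = 1, eta = g *: diff_d Om t, g != 0 & v g = k].

Definition in_Omega (E : divisor) (eta : Om) : Prop :=
  eta = 0 \/ forall v : place, exists2 k, diff_order v eta k & E v <= k.

(* [c] is the residue of [eta] at the rational point [P]: for a local
   parameter [t], [eta = g dt] where g has the principal part
   a_0 t^-1 + a_1 t^-2 + ... at [P], and [c = a_0]. *)
Definition residue_at (P : 'rV[F]_3) (eta : Om) (c : F) : Prop :=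
  exists (v : place) (t g : K) (a : seq F),
    [/\ place_at v P, v t = 1, eta = g *: diff_d Om t,
        val_ge v (g - \sum_(l < size a) ff_const K a`_l * t ^- l.+1) 0
      & c = a`_0].

(* [goppa_code Q E] is the set of codewords of C_Omega(D, E), where D is the
   sum of the rational points [Q s]. *)
Definition goppa_code (m : nat) (Q : 'I_m -> 'rV[F]_3) (E : divisor)
    (c : 'rV[F]_m) : Prop :=
  exists2 eta : Om, in_Omega (fun v => E v - sum_points (fun=> 1) Q v) eta &
    forall s : 'I_m, residue_at (Q s) eta (c 0 s).

End FunctionField.

Definition hamming_dist (F : finFieldType) (m : nat) (u v : 'rV[F]_m) : nat :=
  #|[set s : 'I_m | u 0 s != v 0 s]|.

(* The neutral value [m] bounds all the distances, hence it has no effect as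
   soon as the code has at least two words. *)
Definition min_dist (F : finFieldType) (m : nat) (C : {vspace 'rV[F]_m}) : nat :=
  \big[minn/m]_(p : 'rV[F]_m * 'rV[F]_m
                | [&& p.1 \in C, p.2 \in C & p.1 != p.2])
     hamming_dist p.1 p.2.

(* Main.v *)
(* Over a finite field every coordinate is a root of a polynomial X^(q^r) - X,
   which has derivative -1 and hence is a local parameter at all the points with
   that coordinate where the other partial derivative does not vanish.  This
   makes the points over the algebraic closure correspond to places, and shows
   that a function z with z >= - d H at all places (H a line section) is a form
   of degree d.  The differential om with X_l dX_(l+1) - X_(l+1) dX_l =
   f_(l+2) om has divisor (n - 2) H, so Omega(E) = L((n - 2) H - E) om.

   Neither the Riemann-Roch theorem nor the residue theorem is needed: spaces of
   functions are compared with spaces of forms of large degree, whose dimension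
   is known, through the conditions imposed at rational points.  The residue
   theorem is replaced by functions h_s of L((n - 2) H + Q_s + P_1), obtained by
   writing f = l g + X_i M N with l the line joining Q_s to P_1: subtracting
   multiples of the h_s from a function with simple poles at the Q_s leaves one
   with at most one simple pole, which has none.  This gives one relation
   \sum_s rho_s res_s = 0 with nonzero weights, hence the dimension of the code
   by pairing it with L(F_2).

   For the minimum distance write F_2 = A + B with A the divisor of
   X^i Y^j Z^k, e = n - 2 - d and B = A + e (P_1 + P_2 + P_3); then
   L(A) = L(B).  If z om had few nonzero residues, a dimension count would give
   z u = X^i Y^j Z^k T <> 0 with u in L(B) and T a combination of monomials of
   degree e not divisible by XYZ.  As u is in L(A), T would vanish to order e at
   P_1, P_2 and P_3, which the distinct orders of monomials there forbid. *)

Require Import Defs.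
From HB Require Import structures.
From mathcomp Require Import all_boot all_order all_algebra.
From mathcomp Require Import boolp.
From mathcomp Require Import mpoly.
From mathcomp Require Import all_field polyXY ring lra zify.

Set Implicit Arguments.
Unset Strict Implicit.
Unset Printing Implicit Defensive.

Import Order.TTheory GRing.Theory Num.Theory.
Local Open Scope ring_scope.

(** F is not closed, so a place is matched with a point P over an algebraic closure L, and P stands
    for its conjugacy class. Local arguments take place in F[X, Y], with polynomials not vanishing
    at P as denominators. Homogeneous coordinates are elements of the function field K: with [mu v]
    the least value of the three coordinates at v, the bound e * [mu v] at all places says that z is
    a section of O(e). The curve has degree n + 1, genus g = 'C(n, 2) and canonical degree 2g - 2 =
    (n + 1)(n - 2). The form XYZ has order n + 1 at each P_l and no other zero; multiplying by its
    powers clears poles at the P_l and turns functions into forms. Since deg F_2 = (2n - 1) d + 3 (n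
    - 2), the lower bound on d says exactly that deg F_2 > 2g - 2, and d <= n - 3 with m >= 2n^2 -
    4n - 2 gives deg F_2 < m. The dimension is then m - deg F_2 + g - 1, and the distance bound is
    deg F_2 - (2g - 2) + 3e: the usual designed distance improved by 3e = deg (B - A). *)

(* Locking keeps conversion from unfolding these evaluations. *)
Fact ev_key : unit. Proof. exact: tt. Qed.

(** * Polynomials in two variables evaluated at a point *)

Section Bivariate.

Variables (F T : fieldType) (io : {rmorphism F -> T}) (x y : T).

Definition ev1 : {poly F} -> T :=
  locked_with ev_key (horner_eval x \o map_poly io).

(** Only the inner variable X is specialised, to x; the outer variable Y survives. For x algebraic
    over F this is reduction modulo the minimal polynomial of x. *)
Definition reduce : {poly {poly F}} -> {poly T} :=
  locked_with ev_key (map_poly ev1).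

Definition ev2 : {poly {poly F}} -> T :=
  locked_with ev_key (horner_eval y \o reduce).

Lemma ev1E c : ev1 c = (map_poly io c).[x].
Proof. by rewrite /ev1 unlock. Qed.

Fact ev1_is_additive : zmod_morphism ev1.
Proof. by rewrite /ev1 unlock => a b; rewrite raddfB. Qed.
HB.instance Definition _ := GRing.isZmodMorphism.Build _ _ ev1 ev1_is_additive.

Fact ev1_is_multiplicative : monoid_morphism ev1.
Proof. by rewrite /ev1 unlock; split=> [|a b]; rewrite ?rmorph1 ?rmorphM. Qed.
HB.instance Definition _ := GRing.isMonoidMorphism.Build _ _ ev1 ev1_is_multiplicative.

Fact reduce_is_additive : zmod_morphism reduce.
Proof. by rewrite /reduce unlock => a b; rewrite raddfB. Qed.
HB.instance Definition _ := GRing.isZmodMorphism.Build _ _ reduce reduce_is_additive.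

Fact reduce_is_multiplicative : monoid_morphism reduce.
Proof. by rewrite /reduce unlock; split=> [|a b]; rewrite ?rmorph1 ?rmorphM. Qed.
HB.instance Definition _ := GRing.isMonoidMorphism.Build _ _ reduce reduce_is_multiplicative.

Fact ev2_is_additive : zmod_morphism ev2.
Proof. by rewrite /ev2 unlock => a b; rewrite raddfB. Qed.
HB.instance Definition _ := GRing.isZmodMorphism.Build _ _ ev2 ev2_is_additive.

Fact ev2_is_multiplicative : monoid_morphism ev2.
Proof. by rewrite /ev2 unlock; split=> [|a b]; rewrite ?rmorph1 ?rmorphM. Qed.
HB.instance Definition _ := GRing.isMonoidMorphism.Build _ _ ev2 ev2_is_multiplicative.

Lemma ev1C c : ev1 c%:P = io c.
Proof. by rewrite ev1E map_polyC /= hornerC. Qed.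

Lemma ev1X : ev1 'X = x.
Proof. by rewrite ev1E map_polyX hornerX. Qed.

Lemma reduceC c : reduce c%:P = (ev1 c)%:P.
Proof. by rewrite /reduce unlock map_polyC. Qed.

Lemma reduceX : reduce 'X = 'X.
Proof. by rewrite /reduce unlock map_polyX. Qed.

Lemma ev2E g : ev2 g = (reduce g).[y].
Proof. by rewrite /ev2 unlock. Qed.

Lemma ev2C c : ev2 c%:P = ev1 c.
Proof. by rewrite ev2E reduceC hornerC. Qed.

Lemma ev2X : ev2 'X = y.
Proof. by rewrite ev2E reduceX hornerX. Qed.

Lemma ev2B (g h : {poly {poly F}}) : ev2 (g - h) = ev2 g - ev2 h.
Proof. exact: raddfB. Qed.

Lemma coef_reduce g i : (reduce g)`_i = ev1 g`_i.
Proof. by rewrite /reduce unlock coef_map. Qed.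

(** Modulo the kernel of [ev1] the coefficients lie in a domain, so the image of [I] becomes
    principal once denominators are allowed. For q in [I] with [reduce q] nonzero of least degree,
    pseudo-division by q replaces division over a field: s collects powers of the leading
    coefficient of [reduce q], which is nonzero. *)
Lemma ideal_quasi_generator (I : {poly {poly F}} -> Prop) : I 0 ->
  (forall a b g h, I g -> I h -> I (a * g + b * h)) ->
  exists2 q, I q & forall g, I g ->
    exists s r w, [/\ ev1 s != 0, s%:P * g = q * r + w & reduce w = 0].
Proof.
move=> I0 hI.
case: (pselect (exists2 g, I g & reduce g != 0)) => [[g0 Ig0 rg0]|no]; last first.
  exists 0 => // g Ig; exists 1, 0, g; split.
  - by rewrite rmorph1 oner_neq0.
  - by rewrite mul0r add0r mul1r.
  - by apply/eqP/negPn/negP => rg; apply: no; exists g.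
pose P m := `[< exists g, [/\ I g, reduce g != 0 & size (reduce g) = m] >].
have exP : exists m, P m by exists (size (reduce g0)); apply/asboolP; exists g0.
case: (ex_minnP exP) => m /asboolP [q [Iq rq sq]] minm.
exists q => // g; have [k] := ubnP (size (reduce g)); elim: k g => // k IH g sg Ig.
have [/eqP rg|rg] := boolP (reduce g == 0).
  exists 1, 0, g; split=> //; first by rewrite rmorph1 oner_neq0.
  by rewrite mulr0 add0r mul1r.
have le : (m <= size (reduce g))%N.
  by apply: minm; apply/asboolP; exists g.
pose lq := q`_m.-1; pose lg := g`_(size (reduce g)).-1.
pose e := (size (reduce g) - m)%N.
(* One pseudo-division step: the leading terms of the two reductions cancel. *)
pose g' := lq%:P * g - (lg%:P * 'X^e) * q.
have m0 : (0 < m)%N by rewrite -sq size_poly_gt0.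
have elq : ev1 lq = lead_coef (reduce q) by rewrite lead_coefE sq coef_reduce.
have elg : ev1 lg = lead_coef (reduce g) by rewrite lead_coefE coef_reduce.
have Ig' : I g'.
  by rewrite /g' -mulNr; apply: hI.
have rg' : reduce g' = (ev1 lq)%:P * reduce g - (ev1 lg)%:P * 'X^e * reduce q.
  by rewrite /g' rmorphB !rmorphM /= !reduceC rmorphXn /= reduceX.
have sg' : (size (reduce g') < size (reduce g))%N.
  have s0 : (0 < size (reduce g))%N by rewrite size_poly_gt0.
  rewrite -[X in (_ < X)%N](prednK s0) ltnS; apply/leq_sizeP => j hj.
  rewrite rg' coefB -mulrA !coefCM mulrC coefXnM.
  have -> : (j < e)%N = false by apply/negbTE; rewrite -leqNgt /e; lia.
  have [->|ne] := eqVneq j (size (reduce g)).-1.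
    have -> : ((size (reduce g)).-1 - e = (size (reduce q)).-1)%N by rewrite /e; lia.
    by rewrite elq elg -!lead_coefE mulrC subrr.
  rewrite !nth_default ?mulr0 ?mul0r ?subr0 //; rewrite ?sq /e; move: hj ne le s0;
    set S := size _; lia.
have [s [r [w [es eg rw]]]] := IH g' (leq_trans sg' (ltnSE sg)) Ig'.
exists (s * lq), (r + s%:P * (lg%:P * 'X^e)), w; split=> //.
  by rewrite rmorphM /= mulf_neq0 // elq lead_coef_eq0.
have -> : (s * lq)%:P * g = s%:P * g' + s%:P * (lg%:P * 'X^e) * q.
  by rewrite /g' polyCM; move: (lg%:P * 'X^e) (lq) => Z c; ring.
by rewrite eg; move: (lg%:P * 'X^e) => Z; ring.
Qed.

End Bivariate.

(** * A Nullstellensatz in the affine plane *)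

Section Nullstellensatz.

Variables (F : fieldType) (L : closedFieldType) (io : {rmorphism F -> L}).

Lemma irreducible_dvd_root (p c : {poly F}) (x0 : L) : irreducible_poly p ->
  ev1 io x0 p = 0 -> ev1 io x0 c = 0 -> p %| c.
Proof.
move=> ip p0 c0; apply/negPn; rewrite -irreducible_poly_coprime //.
apply/negP => /Bezout_eq1_coprimepP [[u v] /= e].
have /eqP : ev1 io x0 (u * p + v * c) = 0.
  by rewrite rmorphD !rmorphM /= p0 c0 !mulr0 addr0.
by rewrite e rmorph1 oner_eq0.
Qed.

Lemma closed_root (p : {poly L}) : size p != 1%N -> exists x, p.[x] = 0.
Proof. by move=> /closed_rootP [x /rootP]; exists x. Qed.

(** Let x0 be a root of p: every polynomial in X vanishing at x0 is a multiple of p, hence in [I].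
    If the quasi-generator q reduced to a nonzero constant, [I] would contain a polynomial in X that
    is coprime to p, hence 1. So q has a root y0 above x0, and the other elements of [I] vanish with
    it. *)
Lemma proper_ideal_zero (I : {poly {poly F}} -> Prop) (p : {poly F}) :
  (forall a b g h, I g -> I h -> I (a * g + b * h)) ->
  irreducible_poly p -> I p%:P -> ~ I 1 ->
  exists x0 y0 : L, forall g, I g -> ev2 io x0 y0 g = 0.
Proof.
move=> hI ip Ip I1.
have I0 : I 0 by have := hI 0 0 _ _ Ip Ip; rewrite !mul0r addr0.
have IM a g : I g -> I (a * g).
  by move=> Ig; have := hI a 0 _ _ Ig Ig; rewrite mul0r addr0.
have [x0 hx0] : exists x0, ev1 io x0 p = 0.
  have [|x0 hx0] := @closed_root (map_poly io p); last by exists x0; rewrite ev1E.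
  by  rewrite size_map_poly; case: ip => h _; rewrite neq_ltn h orbT.
have cI c : ev1 io x0 c = 0 -> I c%:P.
  by move=> /(irreducible_dvd_root ip hx0) /dvdpP [d ->]; rewrite polyCM; apply: IM.
have Ic c : I c%:P -> ev1 io x0 c = 0.
  move=> Ic; apply/eqP/negPn/negP => c0.
  have [/Bezout_eq1_coprimepP [[u v] /= e]|] := boolP (coprimep p c).
    apply: I1; have -> : (1 : {poly {poly F}}) = u%:P * p%:P + v%:P * c%:P.
      by rewrite -!polyCM -polyCD e.
    exact: hI.
  rewrite irreducible_poly_coprime // negbK => /dvdpP [d ed].
  by case/negP: c0; rewrite ed rmorphM /= hx0 mulr0.
have wI w : reduce io x0 w = 0 -> I w.
  move=> rw; rewrite -[w]coefK poly_def; elim/big_rec: _ => // i z _ Iz.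
  rewrite -[z]mul1r -mul_polyC mulrC; apply: hI => //.
  by apply: cI; rewrite -coef_reduce rw coef0.
have [q Iq hq] := ideal_quasi_generator io x0 I0 hI.
have [sq|sq] := eqVneq (size (reduce io x0 q)) 1%N.
  have /size_poly1P [c c0 ec] : size (reduce io x0 q) == 1%N by apply/eqP.
  case/eqP: c0; have -> : c = ev1 io x0 q`_0 by rewrite -coef_reduce ec coefC.
  apply: Ic; pose w := q - (q`_0)%:P.
  have Iw : I w.
    apply: wI; apply/polyP => i; rewrite coef_reduce coefB coefC coef0.
    case: i => [|i] /=; first by rewrite subrr rmorph0.
    by rewrite subr0 -coef_reduce ec coefC.
  have -> : (q`_0)%:P = 1 * q + (-1) * w by rewrite /w; ring.
  exact: hI.
have [y0 hy0] := closed_root sq.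
exists x0, y0 => g /hq [s [r [w [s0 e w0]]]].
have /eqP : ev2 io x0 y0 (s%:P * g) = 0.
  by rewrite e rmorphD rmorphM /= !ev2E hy0 w0 mul0r horner0 addr0.
by rewrite rmorphM /= ev2C mulf_eq0 (negbTE s0) => /eqP.
Qed.

End Nullstellensatz.


(** * Powers of Frobenius and algebraic elements *)

Section FrobeniusPower.

Variables (F : finFieldType) (T : fieldType) (io : {rmorphism F -> T}).

Lemma card_pnat : exists p r, [/\ prime p, p \in [pchar T] & #|F| = (p ^ r.+1)%N].
Proof.
have [p pp pF] := finPcharP F.
exists p, (logn p #|F|).-1; split=> //; first by rewrite (fmorph_pchar io).
have e := card_pprimeChar pF; rewrite prednK // lt0n; apply/negP => /eqP l0.
have := finNzRing_gt1 F; have -> : #|F| = 1%N by rewrite -[LHS]/(#|pPrimeCharType pF|) e l0.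
by [].
Qed.

Lemma card_natr0 r : (#|F| ^ r.+1)%:R = 0 :> T.
Proof.
have [p [e [_ pT ->]]] := card_pnat.
by rewrite expnS expnS -mulnA natrM (pcharf0 pT) mul0r.
Qed.

Lemma exprD_card r (a b : T) :
  (a + b) ^+ (#|F| ^ r) = a ^+ (#|F| ^ r) + b ^+ (#|F| ^ r).
Proof.
have [p [e [pp pT ->]]] := card_pnat.
by rewrite exprDn_pchar // -expnM pnatX pnatE ?pT.
Qed.

Lemma expf_cardX r (c : F) : c ^+ (#|F| ^ r) = c.
Proof. by elim: r => [|r IH]; rewrite ?expr1 // expnS exprM expf_card. Qed.

Lemma ev1_card r (x : T) (p : {poly F}) :
  ev1 io (x ^+ (#|F| ^ r)) p = (ev1 io x p) ^+ (#|F| ^ r).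
Proof.
have q0 : (0 < #|F| ^ r)%N by rewrite expn_gt0 (ltn_trans _ (finNzRing_gt1 F)).
elim/poly_ind: p => [|p c IH]; first by rewrite !rmorph0 expr0n gtn_eqF.
rewrite !rmorphD !rmorphM /= !ev1X !ev1C exprD_card exprMn IH.
by rewrite -rmorphXn /= expf_cardX.
Qed.

(** The elements x^(q^i) are all roots of the same polynomial, so two of them agree; additivity of
    Frobenius makes it injective and cancels the smaller exponent. *)
Lemma integral_frobenius_fixed (x : T) : integralOver io x ->
  exists r, x ^+ (#|F| ^ r.+1) = x.
Proof.
case=> p mp /rootP p0.
(* These are [size p] roots of p, one more than its degree allows if they were distinct. *)
pose s := [seq x ^+ (#|F| ^ i) | i <- iota 0 (size p)].
have : ~~ uniq s.
  apply/negP => us; have := @max_poly_roots _ (map_poly io p) s _ _ us.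
  rewrite size_map_poly size_map size_iota ltnn => h; apply/notF/h.
    by rewrite map_poly_eq0 monic_neq0.
  apply/allP => _ /mapP [i _ ->]; apply/rootP.
  have := ev1_card i x p; rewrite !ev1E p0 => ->.
  by rewrite expr0n expn_eq0 gtn_eqF // (ltn_trans _ (finNzRing_gt1 F)).
move/(uniqPn 0) => [i [j [ij]]]; rewrite size_map size_iota => js.
rewrite !(nth_map 0%N) ?size_iota ?nth_iota ?(ltn_trans ij) // !add0n => e.
exists (j - i).-1; rewrite prednK ?subn_gt0 //.
have := exprD_card i (x ^+ (#|F| ^ (j - i))) (- x).
have ep y : (- y) ^+ (#|F| ^ i) = - (y ^+ (#|F| ^ i)) :> T.
  apply/eqP; rewrite -addr_eq0 -exprD_card addNr expr0n expn_eq0.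
  by rewrite gtn_eqF // (ltn_trans _ (finNzRing_gt1 F)).
rewrite ep -exprM -expnD subnK ?(ltnW ij) // e subrr => /eqP.
by rewrite expf_eq0 subr_eq0 => /andP[_ /eqP].
Qed.

(* The derivative of [X^(q^r) - X] is [-1]: its roots are simple. *)
Lemma integral_simple_root (x : T) : integralOver io x ->
  exists t : {poly F}, (map_poly io t).[x] = 0 /\ t^`() = -1.
Proof.
case/integral_frobenius_fixed => r xr; exists ('X^(#|F| ^ r.+1) - 'X); split.
  by rewrite -ev1E raddfB /= rmorphXn /= ev1X xr subrr.
rewrite derivB derivXn derivX -mulr_natl -polyC1 -polyCMn.
suff -> : (#|F| ^ r.+1)%:R = 0 :> F by rewrite polyC0 mul0r sub0r.
by apply: (fmorph_inj io); rewrite rmorph_nat rmorph0 card_natr0.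
Qed.

End FrobeniusPower.

(** * The local ring at a smooth point of an affine plane curve *)

Section LocalRing.

Variables (F K : fieldType) (io : {rmorphism F -> K}) (x y : K).
Variables (L : fieldType) (iL : {rmorphism F -> L}) (phi : {poly {poly F}}).
Hypothesis phi0 : ev2 io x y phi = 0.
Hypothesis phi_ker : forall g : {poly {poly F}},
  ev2 io x y g = 0 -> exists b : {poly {poly F}}, g = phi * b.
Hypothesis phi_size : (1 < size phi)%N.

Local Notation ev := (ev2 io x y).

(** This is the transcendence of x over F: [phi] has positive degree in Y and so divides no nonzero
    polynomial in X alone. *)
Lemma ev1_gen_eq0 (c : {poly F}) : ev1 io x c = 0 -> c = 0.
Proof.
rewrite -(ev2C _ _ y) => /phi_ker [b e]; apply/eqP; rewrite -polyC_eq0.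
apply/negPn/negP => c0; have := size_polyC c; rewrite e.
have [b0|b0] := eqVneq b 0; first by rewrite e b0 mulr0 eqxx in c0.
rewrite size_mul // -?size_poly_gt0 ?(ltn_trans _ phi_size) //.
have : (0 < size b)%N by rewrite size_poly_gt0.
move: phi_size; case: (c != 0) => /=; set A := size phi; set B := size b; clearbody A B; lia.
Qed.

(** N is the resultant of [phi] and g in Y, or g itself when g is constant in Y. If the resultant
    were 0, there would be a common factor of positive degree in Y; since [phi] generates the kernel
    of evaluation at the generic point, g would vanish there. *)
Lemma dvd_gen_poly (g : {poly {poly F}}) : ev g != 0 ->
  exists N g', N != 0 /\ ev g * ev g' = ev1 io x N.
Proof.
move=> g0; have [sg|sg] := leqP (size g) 1.
  have e := size1_polyC sg; exists g`_0, 1; rewrite rmorph1 mulr1; split.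
    by apply: contraNneq g0 => g00; rewrite e g00 rmorph0.
  by rewrite {1}e ev2C.
have [[u v] /= _ e] := resultant_in_ideal phi_size sg.
exists (resultant phi g), v; split; last first.
  by rewrite -(ev2C _ _ y) e rmorphD !rmorphM /= phi0 mulr0 add0r mulrC.
rewrite resultant_eq0 -leqNgt; set d := Pdiv.Idomain.gcdp _ _; rewrite leqNgt.
apply/negP => sd.
have /Pdiv.Idomain.dvdpP [[c1 q1] /= c10 e1] := Pdiv.Idomain.dvdp_gcdl phi g.
have /Pdiv.Idomain.dvdpP [[c2 q2] /= c20 e2] := Pdiv.Idomain.dvdp_gcdr phi g.
rewrite -/d -!mul_polyC in e1 e2.
have : ev q1 * ev d == 0 by rewrite -rmorphM /= -e1 rmorphM /= phi0 mulr0.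
(* Either [phi] divides the cofactor [q1], which makes d constant in Y, or d vanishes at the generic
   point and g with it. *)
rewrite mulf_eq0 => /orP[/eqP /phi_ker [b eb]|/eqP d0].
  have : c1%:P = b * d.
    apply: (@mulfI _ phi); first by rewrite -size_poly_gt0 (ltn_trans _ phi_size).
    by rewrite mulrC e1 eb mulrA.
  move/(congr1 (fun p : {poly {poly F}} => size p)); rewrite size_polyC c10.
  have [->|b0] := eqVneq b 0; first by rewrite mul0r size_poly0.
  rewrite size_mul // -?size_poly_gt0 ?(ltn_trans _ sd) //.
  have : (0 < size b)%N by rewrite size_poly_gt0.
  move: sd; set A := size d; set B := size b; clearbody A B; rewrite /=; lia.
have : ev c2%:P * ev g == 0 by rewrite -rmorphM /= e2 rmorphM /= d0 mulr0.
rewrite mulf_eq0 (negbTE g0) orbF ev2C => /eqP /ev1_gen_eq0 c0.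
by rewrite c0 eqxx in c20.
Qed.

Variables x0 y0 : L.
Hypothesis phiP : ev2 iL x0 y0 phi = 0.
Hypothesis phi_simple : ((reduce iL x0 phi)^`()).[y0] != 0.
Variable t : {poly F}.
Hypothesis t_root : ev1 iL x0 t = 0.
Hypothesis t_deriv : t^`() = -1.

Local Notation evP := (ev2 iL x0 y0).

Local Notation tK := (ev1 io x t).

Lemma uniformizer_neq0 : tK != 0.
Proof.
apply/eqP => /ev1_gen_eq0 t0; have := t_deriv.
by rewrite t0 deriv0 => /eqP; rewrite eq_sym oppr_eq0 oner_eq0.
Qed.

Lemma evP_ext (g h : {poly {poly F}}) : ev g = ev h -> evP g = evP h.
Proof.
move=> e; have [|b eb] := @phi_ker (g - h); first by rewrite ev2B e subrr.
by apply/eqP; rewrite -subr_eq0 -ev2B eb rmorphM /= phiP mul0r.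
Qed.

Lemma evP_neq0 (g : {poly {poly F}}) : evP g != 0 -> ev g != 0.
Proof. by apply: contraNneq; rewrite -[0](rmorph0 ev) => /evP_ext ->; rewrite rmorph0. Qed.

(** The witnesses are the quotients of t and c by their gcd. The gcd vanishes at x0, and t' = -1
    makes x0 a simple root of t, so t / gcd does not vanish there. The gcd stands in for the minimal
    polynomial of x0. *)
Lemma univariate_step (c : {poly F}) : ev1 iL x0 c = 0 ->
  exists s c', [/\ ev1 iL x0 s != 0, s * c = t * c' & c != 0 -> (size c' < size c)%N].
Proof.
move=> c0; pose d := gcdp t c.
have d0 : ev1 iL x0 d = 0.
  have [[u v] /eqpP [[a b] /= /andP[a0 b0] e]] := Bezoutp t c.
  have : ev1 iL x0 (a%:P * (u * t + v * c)) = 0.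
    by rewrite rmorphM rmorphD !rmorphM /= c0 t_root !mulr0 addr0 mulr0.
  rewrite mul_polyC e -mul_polyC rmorphM /= ev1C => /eqP.
  by rewrite mulf_eq0 fmorph_eq0 (negbTE b0) => /eqP.
have et : t = t %/ d * d by rewrite divpK // dvdp_gcdl.
have ec : c = c %/ d * d by rewrite divpK // dvdp_gcdr.
exists (t %/ d), (c %/ d); split.
- have := congr1 (fun p => ev1 iL x0 p^`()) et; rewrite t_deriv derivM.
  rewrite rmorphD !rmorphM /= d0 mulr0 add0r rmorphN rmorph1 => e.
  by apply: contraPneq e => ->; rewrite mul0r => /eqP; rewrite oppr_eq0 oner_eq0.
- by rewrite {1}ec {2}et; ring.
- move=> cn0; have dn0 : d != 0 by rewrite gcdp_eq0 (negbTE cn0) andbF.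
  rewrite size_divp // ltn_subrL size_poly_gt0 cn0 andbT -ltnS prednK ?size_poly_gt0 //.
  rewrite ltn_neqAle eq_sym size_poly_gt0 dn0 andbT.
  apply/negP => /size_poly1P [a a0 ea]; move/eqP: d0.
  by rewrite ea ev1C fmorph_eq0 (negbTE a0).
Qed.

Lemma univariate_unit_decomposition (N : {poly F}) : N != 0 -> exists j s N1,
  [/\ ev1 iL x0 s != 0, ev1 iL x0 N1 != 0 & s * N = t ^+ j * N1].
Proof.
have [m] := ubnP (size N); elim: m N => // m IH N sN N0.
have [/eqP e0|n0] := boolP (ev1 iL x0 N == 0); last first.
  by exists 0%N, 1, N; split=> //; rewrite ?rmorph1 ?oner_neq0 ?expr0.
have [s [c [s0 e sc]]] := univariate_step e0.
have c0 : c != 0.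
  apply: contraNneq N0 => c0; move/eqP: e; rewrite c0 mulr0 mulf_eq0 => /orP[/eqP s00|//].
  by rewrite s00 rmorph0 eqxx in s0.
have [j [s' [N1 [s'0 N10 e']]]] := IH c (leq_trans (sc N0) (ltnSE sN)) c0.
exists j.+1, (s' * s), N1; split=> //; first by rewrite rmorphM mulf_neq0.
by rewrite -mulrA e mulrCA e' exprS mulrA.
Qed.

Lemma reduce_eq0_step (w : {poly {poly F}}) : reduce iL x0 w = 0 ->
  exists s w', ev1 iL x0 s != 0 /\ s%:P * w = t%:P * w'.
Proof.
elim/poly_ind: w => [|w c IH] h; first by exists 1, 0; rewrite rmorph1 oner_neq0 !mulr0.
have hw : reduce iL x0 w = 0.
  apply/polyP => i; have := congr1 (fun p : {poly L} => p`_i.+1) h.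
  by rewrite !coef0 !coef_reduce coefD coefMX coefC /= addr0.
have hc : ev1 iL x0 c = 0.
  have := congr1 (fun p : {poly L} => p`_0) h.
  by rewrite !coef0 !coef_reduce coefD coefMX coefC /= add0r.
have [s [w' [s0 e]]] := IH hw; have [s' [c' [s'0 e' _]]] := univariate_step hc.
exists (s * s'), (s'%:P * w' * 'X + s%:P * c'%:P); split; first by rewrite rmorphM mulf_neq0.
have -> : (s * s')%:P * (w * 'X + c%:P) = s'%:P * (s%:P * w) * 'X + s%:P * (s' * c)%:P.
  by rewrite !polyCM; ring.
by rewrite e e' polyCM; ring.
Qed.

(** The maximal ideal of the local ring at P is generated by t. Up to units and multiples of t, the
    ideal of P in F[X, Y] is generated by one q, and [phi] is q times [rf]. Smoothness makes [rf] a
    unit, so q itself is a multiple of t modulo [phi]. *)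
Lemma local_step (g : {poly {poly F}}) : evP g = 0 ->
  exists s a, evP s != 0 /\ ev s * ev g = tK * ev a.
Proof.
move=> g0; pose I g := evP g = 0.
have I0 : I 0 by rewrite /I rmorph0.
have hI a b g1 h : I g1 -> I h -> I (a * g1 + b * h).
  by rewrite /I rmorphD !rmorphM /= => -> ->; rewrite !mulr0 addr0.
have [q Iq hq] := ideal_quasi_generator iL x0 I0 hI.
have [sf [rf [wf [sf0 ef wf0]]]] := hq _ phiP.
have [s [rr [w [s0 e w0]]]] := hq _ g0.
(* Differentiate [ef] in Y at P: the derivative of [phi] is nonzero there, q vanishes and [wf]
   reduces to 0, so only the product of q' and [rf] is left on the right. *)
have rf0 : evP rf != 0.
  have := congr1 (fun p => ((reduce iL x0 p)^`()).[y0]) ef.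
  rewrite !rmorphD !rmorphM /= wf0 addr0 reduceC !derivM derivC mul0r add0r.
  rewrite !hornerE -!ev2E Iq mul0r addr0 => /eqP; apply: contraTneq => ->.
  by rewrite mulr0 mulf_neq0.
have [s1 [w1 [s10 e1]]] := reduce_eq0_step w0.
have [s2 [w2 [s20 e2]]] := reduce_eq0_step wf0.
exists ((s1 * s2)%:P * (s%:P * rf)), (s2%:P * w1 * rf - s1%:P * w2 * rr); split.
  by rewrite !rmorphM /= !ev2C !mulf_neq0.
have -> : tK = ev t%:P by rewrite ev2C.
rewrite -!rmorphM /=.
have -> : (s1 * s2)%:P * (s%:P * rf) * g =
    t%:P * (s2%:P * w1 * rf - s1%:P * w2 * rr) + phi * ((s1 * s2)%:P * sf%:P * rr).
  transitivity ((s1 * s2)%:P * rf * (s%:P * g)); first by rewrite polyCM; ring.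
  transitivity ((s1 * s2)%:P * rr * (q * rf + wf) + s2%:P * rf * (s1%:P * w) - s1%:P * rr * (s2%:P
    * wf)).
    by rewrite e polyCM; ring.
  by rewrite -ef e1 e2 polyCM; ring.
by rewrite rmorphD [X in _ + X]rmorphM /= phi0 mul0r addr0.
Qed.

(** The power of t dividing g is bounded, because g divides a polynomial N in x alone whose exponent
    j is known. At the largest power the cofactor is a unit, since otherwise [local_step] extracts
    one more factor t. *)
Lemma local_unit_decomposition (g : {poly {poly F}}) : ev g != 0 -> exists k s a,
  [/\ evP s != 0, evP a != 0 & ev s * ev g = tK ^+ k * ev a].
Proof.
move=> g0; have [N [g' [N0 eN]]] := dvd_gen_poly g0.
have [j [s' [N1 [s'0 N10 e']]]] := univariate_unit_decomposition N0.
pose P m := `[< exists s a, evP s != 0 /\ ev s * ev g = tK ^+ m * ev a >].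
have P0 : exists m, P m.
  by exists 0%N; apply/asboolP; exists 1, g; split; rewrite ?rmorph1 ?oner_neq0 ?expr0.
have bound m : P m -> (m <= j)%N.
  move=> /asboolP [s [a [s0 e]]]; rewrite leqNgt; apply/negP => jm.
  have : ev (s * N1%:P) = ev (s'%:P * a * g' * (t%:P) ^+ (m - j)).
    apply: (@mulfI _ (tK ^+ j)); first by rewrite expf_neq0 // uniformizer_neq0.
    rewrite !rmorphM /= !ev2C rmorphXn /= ev2C.
    transitivity (ev s * ev1 io x (t ^+ j * N1)); first by rewrite rmorphM rmorphXn /=; ring.
    rewrite -e' rmorphM /= -eN.
    transitivity (ev1 io x s' * ev g' * (ev s * ev g)); first by ring.
    by rewrite e -[in tK ^+ m](subnKC (ltnW jm)) exprD; ring.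
  move/evP_ext/eqP; rewrite !rmorphM /= !ev2C rmorphXn /= ev2C t_root.
  by rewrite expr0n subn_eq0 leqNgt jm mulr0 mulf_eq0 (negbTE s0) (negbTE N10).
have [m /asboolP [s [a [s0 e]]] maxm] := ex_maxnP P0 bound.
exists m, s, a; split=> //; apply/negP => /eqP a0.
have [s1 [a1 [s10 e1]]] := local_step a0.
suff /maxm : P m.+1 by rewrite ltnn.
apply/asboolP; exists (s1 * s), a1; split; first by rewrite rmorphM mulf_neq0.
by rewrite rmorphM /= -mulrA e mulrCA e1 exprSr mulrA.
Qed.

End LocalRing.

(** * Elementary properties of places *)

Section PlaceTheory.

Variables (F : fieldType) (f : {mpoly F[3]}) (K : function_field f).
Local Notation k := (ff_const K).
Implicit Types (v : place K) (x y : K).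

Lemma place1 v : v 1 = 0.
Proof. by have := place_const v (oner_neq0 F); rewrite rmorph1. Qed.

Lemma placeV v x : v x^-1 = - v x.
Proof.
have [->|x0] := eqVneq x 0; first by rewrite invr0 place0 oppr0.
apply/eqP; rewrite -addr_eq0 -placeM ?invr_eq0 // mulVf //.
by rewrite place1.
Qed.

Lemma placeN v x : v (- x) = v x.
Proof.
have [->|x0] := eqVneq x 0; first by rewrite oppr0.
have n1 : (-1 : F) != 0 by rewrite oppr_eq0 oner_neq0.
rewrite -mulN1r placeM ?oppr_eq0 ?oner_neq0 //.
by have := place_const v n1; rewrite rmorphN rmorph1 => ->; rewrite add0r.
Qed.

Lemma placeX v x n : v (x ^+ n) = n%:Z * v x.
Proof.
have [->|x0] := eqVneq x 0.
  by rewrite place0 mulr0 expr0n; case: eqP => _; rewrite ?place0 ?place1.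
elim: n => [|n IH]; first by rewrite expr0 place1 mul0r.
by rewrite exprS placeM ?expf_neq0 // IH intS mulrDl mul1r.
Qed.

Lemma place_exprz v x (n : int) : v (x ^ n) = n * v x.
Proof.
case: n => n; first by rewrite placeX.
by rewrite NegzE -invr_expz placeV placeX mulNr.
Qed.

Lemma place_prod v (I : finType) (G : I -> K) : (forall i, G i != 0) ->
  v (\prod_i G i) = \sum_i v (G i).
Proof.
move=> G0; suff [] : v (\prod_i G i) = \sum_i v (G i) /\ \prod_i G i != 0 by [].
elim/big_rec2: _ => [|i s z _ [e z0]]; first by rewrite place1 oner_neq0.
by rewrite placeM // e mulf_neq0.
Qed.

Lemma val_ge_neq0 v x c : x != 0 -> val_ge v x c = (c <= v x).
Proof. by move=> x0; apply/propext; split=> [[e|//]|]; [rewrite e eqxx in x0|right]. Qed.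

Lemma val_ge0 v c : val_ge v 0 c. Proof. by left. Qed.

Lemma val_ge_refl v x : val_ge v x (v x). Proof. by right. Qed.

Lemma val_ge1 v : val_ge v 1 0. Proof. by right; rewrite place1. Qed.

Lemma val_ge_le v x c d : d <= c -> val_ge v x c -> val_ge v x d.
Proof. by move=> dc [->|h]; [left|right; apply: le_trans h]. Qed.

Lemma val_geD v x y c : val_ge v x c -> val_ge v y c -> val_ge v (x + y) c.
Proof.
have [->|x0] := eqVneq x 0; first by rewrite add0r.
have [->|y0] := eqVneq y 0; first by rewrite addr0.
have [->|s0] := eqVneq (x + y) 0; first by left.
rewrite !val_ge_neq0 // => h1 h2; apply: le_trans (placeD _ x0 y0 s0).
by rewrite le_min h1 h2.
Qed.

Lemma val_geN v x c : val_ge v (- x) c = val_ge v x c.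
Proof.
have [->|x0] := eqVneq x 0; first by rewrite oppr0.
by rewrite !val_ge_neq0 ?oppr_eq0 // placeN.
Qed.

Lemma val_geB v x y c : val_ge v x c -> val_ge v y c -> val_ge v (x - y) c.
Proof. by move=> h1 h2; apply: val_geD => //; rewrite val_geN. Qed.

Lemma val_geM v x y c d : val_ge v x c -> val_ge v y d -> val_ge v (x * y) (c + d).
Proof.
have [->|x0] := eqVneq x 0; first by rewrite mul0r; left.
have [->|y0] := eqVneq y 0; first by rewrite mulr0; left.
by rewrite !val_ge_neq0 ?mulf_neq0 // placeM // => h1 h2; apply: lerD.
Qed.

Lemma val_geX v x c n : val_ge v x c -> val_ge v (x ^+ n) (n%:Z * c).
Proof.
move=> h; elim: n => [|n IH]; first by rewrite expr0 mul0r; apply: val_ge1.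
by rewrite exprS intS mulrDl mul1r; apply: val_geM.
Qed.

Lemma val_geMr v x y c : y != 0 -> val_ge v (x * y) c = val_ge v x (c - v y).
Proof.
move=> y0; have [->|x0] := eqVneq x 0.
  by rewrite mul0r; apply/propext; split=> _; left.
by rewrite !val_ge_neq0 ?mulf_neq0 // placeM // lerBlDr.
Qed.

Lemma val_ge_sum v (I : Type) (r : seq I) (P : pred I) (G : I -> K) c :
  (forall i, P i -> val_ge v (G i) c) -> val_ge v (\sum_(i <- r | P i) G i) c.
Proof.
move=> h; elim/big_rec: _ => [|i z Pi hz]; first by left.
by apply: val_geD => //; apply: h.
Qed.

Lemma val_ge_const v a : val_ge v (k a) 0.
Proof.
have [->|a0] := eqVneq a 0; first by rewrite rmorph0; left.
by right; rewrite place_const.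
Qed.

Lemma val_geZ v a x c : val_ge v x c -> val_ge v (k a * x) c.
Proof. by move=> h; rewrite -[c]add0r; apply: val_geM => //; apply: val_ge_const. Qed.

Lemma place_addl v x y : x != 0 -> val_ge v y (v x + 1) -> x + y != 0 /\ v (x + y) = v x.
Proof.
move=> x0 hy.
have nx c : v x < c -> ~ val_ge v x c.
  by move=> h; rewrite val_ge_neq0 // leNgt h.
have s0 : x + y != 0.
  apply/eqP => /(canRL (addrK _)) e; rewrite sub0r in e.
  by apply: (nx (v x + 1)); rewrite ?ltrDl // {1}e val_geN.
split=> //; apply/eqP; rewrite eq_le; apply/andP; split; last first.
  by rewrite -val_ge_neq0 //; apply: val_geD; [apply: val_ge_refl|apply: val_ge_le hy;
    rewrite lerDl].
rewrite leNgt; apply/negP => lt; apply: (nx (v x + 1)); rewrite ?ltrDl //.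
suff: val_ge v (x + y - y) (v x + 1) by rewrite addrK.
by apply: val_geB => //; right; rewrite lezD1.
Qed.

End PlaceTheory.

(** * Places of an affine chart *)

Section ChartPlaces.

Variables (F : fieldType) (f : {mpoly F[3]}) (K : function_field f) (x y : K).
Variables (L : closedFieldType) (iL : {rmorphism F -> L}) (phi : {poly {poly F}}).
Local Notation k := (ff_const K).
Hypothesis phi0 : ev2 k x y phi = 0.
Hypothesis phi_ker : forall g : {poly {poly F}},
  ev2 k x y g = 0 -> exists b : {poly {poly F}}, g = phi * b.
Hypothesis phi_size : (1 < size phi)%N.
Hypothesis frac : forall z : K, exists a b : {poly {poly F}},
  ev2 k x y b != 0 /\ z = ev2 k x y a / ev2 k x y b.

Local Notation ev := (ev2 k x y).

Section AtPoint.

Variables x0 y0 : L.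
Local Notation evP := (ev2 iL x0 y0).
Hypothesis phiP : evP phi = 0.
Hypothesis phi_simple : ((reduce iL x0 phi)^`()).[y0] != 0.
Variable t : {poly F}.
Hypothesis t_root : ev1 iL x0 t = 0.
Hypothesis t_deriv : t^`() = -1.

Local Notation tK := (ev1 k x t).

Let evPn := @evP_neq0 F K k x y L iL phi phi_ker x0 y0 phiP.

Let t0 : tK != 0 := uniformizer_neq0 phi_ker phi_size t_deriv.

Let is_unit (u : K) := exists a b, [/\ evP a != 0, evP b != 0 & u = ev a / ev b].
Let integral (z : K) := exists a b, evP b != 0 /\ z = ev a / ev b.

Let unit_neq0 u : is_unit u -> u != 0.
Proof. by case=> a [b [a0 b0 ->]]; rewrite mulf_neq0 ?invr_eq0 ?evPn. Qed.

Let unitM u w : is_unit u -> is_unit w -> is_unit (u * w).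
Proof.
move=> [a [b [a0 b0 ->]]] [c [d [c0 d0 ->]]]; exists (a * c), (b * d).
by rewrite !rmorphM /= !mulf_neq0 // -mulf_div.
Qed.

Let unit_dec z : z != 0 -> exists (n : int) u, is_unit u /\ z = tK ^ n * u.
Proof.
move=> z0; have [a [b [b0 ez]]] := frac z.
have a0 : ev a != 0 by apply: contraNneq z0 => a0; rewrite ez a0 mul0r.
have dec := local_unit_decomposition phi0 phi_ker phi_size phiP phi_simple t_root t_deriv.
have [n [s [u [s0 u0 e]]]] := dec _ a0.
have [m [s' [u' [s'0 u'0 e']]]] := dec _ b0.
exists (n%:Z - m%:Z), (ev (u * s') / ev (s * u')); split.
  by exists (u * s'), (s * u'); rewrite !rmorphM /= !mulf_neq0.
rewrite expfzDr // -invr_expz -!exprnP !rmorphM /= ez.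
have -> : ev a = tK ^+ n * ev u / ev s by rewrite -e mulrC mulKf ?evPn.
have -> : ev b = tK ^+ m * ev u' / ev s' by rewrite -e' mulrC mulKf ?evPn.
by field; rewrite !evPn // expf_neq0.
Qed.

Let int_unit_nat (n : nat) u w : is_unit u -> integral w -> u = tK ^+ n.+1 * w -> False.
Proof.
move=> [a [b [a0 b0 ->]]] [c [d [d0 ->]]] e.
have : ev (a * d) = ev (b * c * t%:P ^+ n.+1).
  rewrite !rmorphM rmorphXn /= ev2C; apply: (@mulfI _ (ev b)^-1); first by rewrite invr_eq0 evPn.
  rewrite mulrA [_^-1 * ev a]mulrC e; field.
  by rewrite !evPn.
move=> /(evP_ext phi_ker phiP)/eqP; rewrite !rmorphM rmorphXn /= ev2C t_root.
by rewrite expr0n mulr0 mulf_eq0 (negbTE a0) (negbTE d0).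
Qed.

Let unit_int u : is_unit u -> integral u.
Proof. by case=> a [b [a0 b0 e]]; exists a, b. Qed.

Let integralM u w : integral u -> integral w -> integral (u * w).
Proof.
move=> [a [b [b0 ->]]] [c [d [d0 ->]]]; exists (a * c), (b * d).
by rewrite !rmorphM /= !mulf_neq0 // -mulf_div.
Qed.

Let integralD u w : integral u -> integral w -> integral (u + w).
Proof.
move=> [a [b [b0 ->]]] [c [d [d0 ->]]]; exists (a * d + c * b), (b * d).
by rewrite rmorphD !rmorphM /= mulf_neq0 // addf_div ?evPn.
Qed.

Let integral_t n : integral (tK ^+ n).
Proof.
exists (t%:P ^+ n), 1.
by rewrite !rmorph1 oner_neq0 divr1 rmorphXn /= ev2C.
Qed.

Let integral_dec n u : is_unit u -> integral (tK ^ n * u) -> 0 <= n.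
Proof.
move=> hu hi; rewrite leNgt; apply/negP => n0.
case: n n0 hi => // n _ [a [b [b0 e]]]; rewrite NegzE -invr_expz in e.
apply: (int_unit_nat (n := n) hu _ (w := ev a / ev b)); first by exists a, b.
by rewrite -e exprnP mulrA divff ?mul1r // -exprnP expf_neq0.
Qed.

Let dec_uniq (n m : int) u w : is_unit u -> is_unit w -> tK ^ n * u = tK ^ m * w -> n = m.
Proof.
have aux n' m' u' w' : is_unit u' -> is_unit w' -> tK ^ n' * u' = tK ^ m' * w' -> n' <= m'.
  move=> hu hw e; rewrite -subr_ge0; apply: (integral_dec hw).
  have -> : tK ^ (m' - n') * w' = u'.
    apply: (@mulfI _ (tK ^ n')); first by rewrite expfz_neq0.
    by rewrite mulrA -expfzDr // addrC subrK -e.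
  exact: unit_int.
by move=> hu hw e; apply: le_anti; rewrite (aux _ _ _ _ hu hw) ?(aux _ _ _ _ hw hu).
Qed.

(** The exponent of t in [unit_dec], well defined by [dec_uniq]; the value 0 at 0 is the convention
    of [place]. *)
Let vfun (z : K) : int :=
  if pselect (z != 0) is left z0 then projT1 (cid (unit_dec z0)) else 0.

Let vfunE n u : is_unit u -> vfun (tK ^ n * u) = n.
Proof.
move=> hu; rewrite /vfun; case: pselect => [z0|].
  by case: (cid _) => m /= [w [hw e]]; apply: (dec_uniq hw hu).
by case; apply: mulf_neq0; [apply: expfz_neq0|apply: unit_neq0].
Qed.

Let vfun_integral z : z != 0 -> integral z <-> 0 <= vfun z.
Proof.
move=> /unit_dec [n [u [hu ->]]]; rewrite vfunE //; split; first exact: integral_dec.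
by case: n => // n _; apply: integralM; [apply: integral_t|apply: unit_int].
Qed.

Lemma chart_place_exists : exists v : place K,
  forall g, evP g != 0 -> v (ev g) = 0.
Proof.
have vM a b : a != 0 -> b != 0 -> vfun (a * b) = vfun a + vfun b.
  move=> /unit_dec [n [u [hu ->]]] /unit_dec [m [w [hw ->]]].
  by rewrite mulrACA -expfzDr // !vfunE //; apply: unitM.
have unit1 : is_unit 1 by exists 1, 1; rewrite !rmorph1 oner_neq0 divr1.
have v0 : vfun 0 = 0 by rewrite /vfun; case: pselect => // h; exfalso; move: h; rewrite eqxx.
have vD a b : a != 0 -> b != 0 -> a + b != 0 -> Num.min (vfun a) (vfun b) <= vfun (a + b).
  wlog le : a b / vfun a <= vfun b.
    move=> H a0 b0 s0; case/orP: (le_total (vfun a) (vfun b)) => le; first exact: H.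
    by rewrite minC addrC; apply: H; rewrite // addrC.
  move=> a0 b0 s0; rewrite min_l //; have [n [u [hu ea]]] := unit_dec a0.
  have ev0 : is_unit (tK ^ 0) by rewrite expr0z.
  have tn0 m : tK ^ m != 0 by rewrite expfz_neq0.
  have vt m : vfun (tK ^ m) = m by rewrite -[tK ^ m]mulr1 vfunE.
  have va : vfun a = n by rewrite ea vfunE.
  (* Divided by t^n, the power of t in the summand of least value, both summands become integral,
     and then so does their sum. *)
  have ia : integral (a * tK ^ (- n)).
    by apply/vfun_integral; rewrite ?mulf_neq0 // vM // vt va subrr.
  have ib : integral (b * tK ^ (- n)).
    by apply/vfun_integral; rewrite ?mulf_neq0 // vM // vt subr_ge0 -va.
  have := integralD ia ib; rewrite -mulrDl vfun_integral ?mulf_neq0 //.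
  by rewrite vM // vt subr_ge0 va.
have vu u : is_unit u -> vfun u = 0.
  by move=> hu; rewrite -[u]mul1r -(expr0z tK) vfunE.
have vc a : a != 0 -> vfun (k a) = 0.
  move=> a0; apply: vu; exists a%:P%:P, 1.
  by rewrite !rmorph1 !ev2C !ev1C fmorph_eq0 a0 oner_neq0 divr1.
have vt : vfun tK = 1 by rewrite -[tK]mulr1 -[tK]expr1z vfunE.
exists (Place v0 vM vD vc (ex_intro _ _ vt)) => /= g g0.
by apply: vu; exists g, 1; rewrite !rmorph1 oner_neq0 divr1.
Qed.

Variable v : place K.
Hypothesis v_unit : forall g, evP g != 0 -> v (ev g) = 0.

Let v_is_unit u : is_unit u -> v u = 0.
Proof.
case=> a [b [a0 b0 ->]].
by rewrite placeM ?invr_eq0 ?evPn // placeV !v_unit // subrr.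
Qed.

Lemma chart_place_ge0 g : val_ge v (ev g) 0.
Proof.
have [g0|g0] := eqVneq (evP g) 0; last by right; rewrite v_unit.
(* If g vanishes at P then g + 1 does not, and its value is 0 by hypothesis. *)
have -> : ev g = ev (g + 1) - 1 by rewrite rmorphD rmorph1 addrK.
apply: val_geB; last exact: val_ge1.
by right; rewrite v_unit // rmorphD rmorph1 /= g0 add0r oner_neq0.
Qed.

(** An element of value 1 is t^n times a unit, so n * v(t) = 1; as v(t) >= 0, both factors are 1. *)
Lemma chart_place_uniformizer : v tK = 1.
Proof.
have [z vz] := place_normalized v.
have z0 : z != 0 by apply: contraPneq vz => ->; rewrite place0.
have [n [u [hu ez]]] := unit_dec z0; move: vz.
rewrite ez placeM ?expfz_neq0 ?(unit_neq0 hu) // (v_is_unit hu) addr0 place_exprz.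
have := chart_place_ge0 t%:P; rewrite ev2C (val_ge_neq0 _ _ t0).
move: (v tK) => m m0 e; have n0 : 0 < n by nia.
by apply: le_anti; apply/andP; split; nia.
Qed.

Lemma chart_place_integral z : val_ge v z 0 -> exists a b, evP b != 0 /\ z = ev a / ev b.
Proof.
have [->|z0] := eqVneq z 0.
  by exists 0, 1; rewrite rmorph0 rmorph1 oner_neq0 mul0r.
have [n [u [hu ez]]] := unit_dec z0; rewrite val_ge_neq0 // ez.
rewrite placeM ?expfz_neq0 ?(unit_neq0 hu) // (v_is_unit hu) addr0 place_exprz.
rewrite chart_place_uniformizer mulr1; case: n {ez} => // n _.
by apply: integralM; [apply: integral_t|apply: unit_int].
Qed.

Lemma chart_place_dominates g : evP g = 0 -> val_ge v (ev g) 1.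
Proof.
move=> g0; have [s [a [s0 e]]] := local_step phi0 phiP phi_simple t_root t_deriv g0.
have -> : ev g = tK * (ev a / ev s).
  by rewrite mulrA -e mulrC mulKf // evPn.
rewrite -[1]addr0; apply: val_geM; first by right; rewrite chart_place_uniformizer.
by rewrite val_geMr ?invr_eq0 ?evPn // placeV (v_unit s0) subrr; apply: chart_place_ge0.
Qed.

End AtPoint.

Lemma val_ge_ev1 (v : place K) c : val_ge v x 0 -> val_ge v (ev1 k x c) 0.
Proof.
move=> hx; elim/poly_ind: c => [|p c IH]; first by rewrite rmorph0; left.
rewrite rmorphD rmorphM /= ev1C ev1X; apply: val_geD; last exact: val_ge_const.
by rewrite -[0]addr0; apply: val_geM.
Qed.

Lemma val_ge_ev2 (v : place K) g : val_ge v x 0 -> val_ge v y 0 -> val_ge v (ev g) 0.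
Proof.
move=> hx hy; elim/poly_ind: g => [|p c IH]; first by rewrite rmorph0; left.
rewrite rmorphD rmorphM /= ev2C ev2X; apply: val_geD; last exact: val_ge_ev1.
by rewrite -[0]addr0; apply: val_geM.
Qed.

(** [P] behaves like a nonzero prime ideal of F[X], in which an element of least size is
    irreducible. *)
Lemma min_irreducible (P : {poly F} -> Prop) (N0 : {poly F}) : N0 != 0 -> P N0 ->
  (forall c, c != 0 -> ~ P c%:P) ->
  (forall s q, P (s * q) -> P s \/ P q) ->
  exists2 p, irreducible_poly p & P p.
Proof.
move=> N00 PN0 Pc PM.
pose S m := `[< exists N, [/\ N != 0, P N & size N = m] >].
have exS : exists m, S m by exists (size N0); apply/asboolP; exists N0.
case: (ex_minnP exS) => m /asboolP [p [p0 Pp sp]] minm.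
exists p => //; split.
  rewrite ltnNge; apply/negP => /size1_polyC e.
  by apply: (Pc p`_0); rewrite -?e //; apply: contraNneq p0 => c0; rewrite e c0 polyC0.
move=> q sq1 /dvdpP [s es]; have sq : size q != 1%N := sq1.
have [s0 q0] : s != 0 /\ q != 0 by apply/andP; move: p0; rewrite es mulf_eq0 negb_or.
have sz : size p = (size s + size q).-1 by rewrite es size_mul.
have := size_poly_gt0 s; have := size_poly_gt0 q; rewrite s0 q0 => sq0 ss0.
have min s' : s' != 0 -> P s' -> (size p <= size s')%N.
  by move=> h1 h2; rewrite sp; apply: minm; apply/asboolP; exists s'.
have [/(min _ s0)|/(min _ q0)] : P s \/ P q by apply: PM; rewrite -es.
  move: sz sq sq0 ss0; set A := size p; set B := size s; set C := size q.
  by clearbody A B C; lia.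
rewrite -dvdp_size_eqp; last by rewrite es dvdp_mulIr.
move: sz sq sq0 ss0; set A := size p; set B := size s; set C := size q.
by clearbody A B C; lia.
Qed.

(** The polynomials of positive value at v form a proper prime ideal. By [dvd_gen_poly] it contains
    a nonzero polynomial in X alone, hence an irreducible one, and [proper_ideal_zero] yields a
    common zero. A polynomial not vanishing at that zero has value 0. *)
Lemma chart_place_center (v : place K) : val_ge v x 0 -> val_ge v y 0 ->
  exists x0 y0 : L, ev2 iL x0 y0 phi = 0 /\
    forall g, ev2 iL x0 y0 g != 0 -> v (ev g) = 0.
Proof.
move=> hx hy; pose I g := val_ge v (ev g) 1.
have hI a b g h : I g -> I h -> I (a * g + b * h).
  rewrite /I rmorphD !rmorphM /= => Ig Ih.
  by apply: val_geD; rewrite -[1]add0r; apply: val_geM => //; apply: val_ge_ev2.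
have I1 : ~ I 1 by rewrite /I rmorph1 val_ge_neq0 ?oner_neq0 // place1.
have [N [N0 IN]] : exists N, N != 0 /\ I N%:P.
  have [z vz] := place_normalized v.
  have [a [b [b0 ez]]] := frac z.
  have a0 : ev a != 0 by apply: contraPneq vz => a0; rewrite ez a0 mul0r place0.
  have Ia : I a.
    right; move: vz; rewrite ez placeM ?invr_eq0 // placeV.
    by have := val_ge_ev2 b hx hy; rewrite val_ge_neq0 //; lia.
  have [N [g' [N0 e]]] := dvd_gen_poly phi0 phi_ker phi_size a0.
  exists N; split=> //; rewrite /I ev2C -e -[1]addr0.
  by apply: val_geM => //; apply: val_ge_ev2.
have [p ip Ip] : exists2 p, irreducible_poly p & I p%:P.
  have [|c c0|s q|p ip Ip] := @min_irreducible (fun N => val_ge v (ev1 k x N) 1) N N0.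
  - by move: IN; rewrite /I ev2C.
  - by rewrite ev1C val_ge_neq0 ?fmorph_eq0 // place_const.
  - rewrite rmorphM /=; have := val_ge_ev1 s hx; have := val_ge_ev1 q hx.
    have [->|s0] := eqVneq (ev1 k x s) 0; first by left; left.
    have [->|q0] := eqVneq (ev1 k x q) 0; first by right; left.
    rewrite !val_ge_neq0 ?mulf_neq0 // placeM //; lia.
  - by exists p; [exact: ip|rewrite /I ev2C].
have [x0 [y0 hP]] := proper_ideal_zero iL hI ip Ip I1.
exists x0, y0; split.
  by apply: hP; rewrite /I phi0; left.
move=> g g0; have := val_ge_ev2 g hx hy.
have [->|eg0] := eqVneq (ev g) 0; first by rewrite place0.
rewrite (val_ge_neq0 _ _ eg0) => h; apply/eqP; rewrite eq_le h andbT.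
by rewrite -ltzD1 add0r ltNge; apply/negP => h1; move/eqP: g0; apply; apply: hP; right.
Qed.

(** The denominators of h, that is the b with b h polynomial, form an ideal. If it were proper it
    would have a zero P, but integrality of h at the place above P provides a denominator not
    vanishing at P. *)
Lemma chart_integral_closed :
  (forall x0 y0 : L, ev2 iL x0 y0 phi = 0 -> exists v : place K,
    [/\ val_ge v x 0, val_ge v y 0 & forall z, val_ge v z 0 ->
      exists a b, ev2 iL x0 y0 b != 0 /\ z = ev a / ev b]) ->
  forall h : K, (forall v : place K, val_ge v x 0 -> val_ge v y 0 -> val_ge v h 0) ->
  exists g, h = ev g.
Proof.
move=> hpl h0 inth0; apply: contrapT => nh0.
pose int (h : K) := forall v : place K, val_ge v x 0 -> val_ge v y 0 -> val_ge v h 0.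
pose pol (h : K) := exists g, h = ev g.
have intM a h : int h -> int (ev a * h).
  by move=> hi v hx hy; rewrite -[0]addr0; apply: val_geM; [apply: val_ge_ev2|apply: hi].
pose P N := exists h, [/\ int h, ~ pol h & pol (ev1 k x N * h)].
have [N [N0 PN]] : exists N, N != 0 /\ P N.
  have [a [b [b0 e]]] := frac h0.
  have [N [g' [N0 eN]]] := dvd_gen_poly phi0 phi_ker phi_size b0.
  exists N; split=> //; exists h0; split=> //; exists (g' * a).
  by rewrite -eN e rmorphM /=; field.
(* [proper_ideal_zero] requires an irreducible polynomial in X in the ideal: factors of N are moved
   into h until a single irreducible denominator is left. *)
have [p ip [h [hi hn hp]]] : exists2 p, irreducible_poly p & P p.
  apply: (min_irreducible N0 PN) => [c c0 [h [_ hn [g eg]]]|s q [h [hi hn hp]]].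
    apply: hn; exists ((c^-1)%:P%:P * g); rewrite rmorphM /= ev2C ev1C -eg ev1C mulrA -rmorphM /=.
    by rewrite mulVf // rmorph1 mul1r.
  have [hq|hq] := pselect (pol (ev1 k x q * h)); first by right; exists h.
  left; exists (ev1 k x q * h); split=> //; last by rewrite mulrA -rmorphM.
  by rewrite -(ev2C _ _ y); apply: intM.
pose I b := pol (ev b * h).
have hI a b g g' : I g -> I g' -> I (a * g + b * g').
  move=> [c ec] [c' ec']; exists (a * c + b * c').
  by rewrite !rmorphD !rmorphM /= mulrDl -ec -ec'; ring.
have Ip : I p%:P by rewrite /I ev2C.
have I1 : ~ I 1 by rewrite /I rmorph1 mul1r.
have [x0 [y0 hP]] := proper_ideal_zero iL hI ip Ip I1.
have [|v [hx hy hv]] := hpl x0 y0.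
  by apply: hP; exists 0; rewrite phi0 mul0r rmorph0.
have [a [b [b0 e]]] := hv h (hi v hx hy).
have : ev b != 0.
  apply: contraNneq b0 => /phi_ker [c ->]; rewrite rmorphM /= [ev2 _ _ _ phi]hP ?mul0r //.
  by exists 0; rewrite phi0 mul0r rmorph0.
move=> eb0; move/eqP: b0; apply; apply: hP; exists a.
by rewrite e mulrC mulfVK.
Qed.

End ChartPlaces.

(** * Evaluation and differentiation of ternary forms *)

Fact mev_key : unit. Proof. exact: tt. Qed.

Lemma dhomog_mdeg (R : nzRingType) n d (A : {mpoly R[n]}) m :
  A \is d.-homog -> m \in msupp A -> mdeg m = d.
Proof. by move/dhomogP => h /h. Qed.

Section EvaluateForms.

Variables (F : fieldType) (T : comNzRingType) (io : {rmorphism F -> T}).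

Definition mev (u : 'I_3 -> T) : {mpoly F[3]} -> T := locked_with mev_key (mmap io u).

Lemma mevE u A : mev u A = mmap io u A.
Proof. by rewrite /mev unlock. Qed.

Fact mev_is_additive u : zmod_morphism (mev u).
Proof. by rewrite /mev unlock => A B; rewrite raddfB. Qed.
HB.instance Definition _ u := GRing.isZmodMorphism.Build _ _ (mev u) (mev_is_additive u).

Fact mev_is_multiplicative u : monoid_morphism (mev u).
Proof. by rewrite /mev unlock; split=> [|A B]; rewrite ?rmorph1 ?rmorphM. Qed.
HB.instance Definition _ u := GRing.isMonoidMorphism.Build _ _ (mev u) (mev_is_multiplicative u).

Lemma mevC u c : mev u c%:MP = io c.
Proof. by rewrite mevE mmapC. Qed.

Lemma mevZ u c A : mev u (c *: A) = io c * mev u A.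
Proof. by rewrite !mevE mmapZ. Qed.

Lemma mevX u i : mev u 'X_i = u i.
Proof. by rewrite mevE mmapX mmap1U. Qed.

Lemma mev_sum u A : mev u A = \sum_(m <- msupp A) io A@_m * \prod_i u i ^+ m i.
Proof. by rewrite mevE. Qed.

Lemma eq_mev u w A : u =1 w -> mev u A = mev w A.
Proof.
move=> e; rewrite !mev_sum; apply: eq_bigr => m _; congr (_ * _).
by apply: eq_bigr => i _; rewrite e.
Qed.

Lemma mev_homog u c d A : A \is d.-homog -> mev (fun i => c * u i) A = c ^+ d * mev u A.
Proof.
move=> hA; rewrite !mev_sum mulr_sumr.
rewrite [LHS]big_seq [RHS]big_seq; apply: eq_bigr => m /(dhomog_mdeg hA) <-.
rewrite mulrCA; congr (_ * _); rewrite mdegE -prodrXr -big_split /=.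
by apply: eq_bigr => i _; rewrite exprMn.
Qed.

End EvaluateForms.

Lemma mpoly_ring_ind (F : nzRingType) n (P : {mpoly F[n]} -> Prop) :
  (forall c, P c%:MP) -> (forall i, P 'X_i) ->
  (forall A B, P A -> P B -> P (A + B)) ->
  (forall A B, P A -> P B -> P (A * B)) -> forall A, P A.
Proof.
move=> PC PX PD PM A; rewrite [A]mpolyE.
have P0 : P 0 by rewrite -mpolyC0.
apply: big_ind => [|B C|m _]; [exact: P0|exact: PD|].
rewrite -mul_mpolyC; apply: (PM) => //; rewrite mpolyXE_id.
apply: big_ind => [|B C|i _]; [by rewrite -mpolyC1|exact: PM|].
by elim: (m i) => [|k IH]; [rewrite expr0 -mpolyC1|rewrite exprS; apply: (PM)].
Qed.

Lemma mev_comp (F : fieldType) (S T : comNzRingType) (io : {rmorphism F -> S})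
    (h : {rmorphism S -> T}) (jo : {rmorphism F -> T}) (u : 'I_3 -> S) w A :
  (forall c, h (io c) = jo c) -> (forall i, h (u i) = w i) -> h (mev io u A) = mev jo w A.
Proof.
move=> hc hu; elim/mpoly_ring_ind: A => [c|i|A B hA hB|A B hA hB].
- by rewrite !mevC hc.
- by rewrite !mevX hu.
- by rewrite !rmorphD /= hA hB.
- by rewrite !rmorphM /= hA hB.
Qed.

Lemma mpoly_chain_rule (F : fieldType) (T : comNzRingType) (io : {rmorphism F -> T})
    (M : lmodType T) (D : T -> M) (u : 'I_3 -> T) A :
  (forall a b, D (a + b) = D a + D b) ->
  (forall a b, D (a * b) = a *: D b + b *: D a) ->
  (forall c, D (io c) = 0) ->
  D (mev io u A) = \sum_i mev io u A^`M(i) *: D (u i).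
Proof.
move=> hD hM hC; elim/mpoly_ring_ind: A => [c|j|A B hA hB|A B hA hB].
- by rewrite mevC hC big1 // => i _; rewrite mderivC rmorph0 scale0r.
- rewrite mevX (bigD1 j) //= mderivX mnm1E eqxx scale1r -{1}[U_(j)%MM]addm0 addmC addmK mpolyX0
  rmorph1 scale1r.
  rewrite big1 ?addr0 // => i ij; rewrite mderivX mnm1E eq_sym (negbTE ij).
  by rewrite scale0r rmorph0 scale0r.
- rewrite rmorphD hD /= hA hB -big_split; apply: eq_bigr => i _ /=.
  by rewrite mderivD rmorphD scalerDl.
- rewrite rmorphM hM /= hA hB !scaler_sumr addrC -big_split; apply: eq_bigr => i _ /=.
  by rewrite mderivM rmorphD !rmorphM /= scalerDl !scalerA [mev io u B * _]mulrC.
Qed.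

Lemma mpoly_euler (F : fieldType) d (A : {mpoly F[3]}) : A \is d.-homog ->
  \sum_i 'X_i * A^`M(i) = d%:R *: A.
Proof.
move=> hA; rewrite {2}[A]mpolyE.
under eq_bigr => i _ do rewrite [A in A^`M(i)]mpolyE raddf_sum mulr_sumr.
rewrite exchange_big /= scaler_sumr.
rewrite [LHS]big_seq [RHS]big_seq; apply: eq_bigr => m /(dhomog_mdeg hA) <-.
transitivity (A@_m *: \sum_i (m i)%:R *: 'X_[m]).
  rewrite scaler_sumr; apply: eq_bigr => i _.
  rewrite mderivZ mderivX -!scalerAr; congr (_ *: _).
  have [->|mi] := eqVneq (m i) 0%N; first by rewrite !scale0r.
  by rewrite -mpolyXD addmC submK // lep1mP.
by rewrite -scaler_suml -natr_sum -mdegE !scalerA mulrC.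
Qed.

Lemma mderiv_homog (F : fieldType) d (A : {mpoly F[3]}) i :
  A \is d.+1.-homog -> A^`M(i) \is d.-homog.
Proof.
move=> hA; rewrite [A]mpolyE raddf_sum big_seq /=.
apply: rpred_sum => m /(dhomog_mdeg hA) e; rewrite mderivZ mderivX; apply/rpredZ.
have [->|mi] := eqVneq (m i) 0%N; first by rewrite scale0r rpred0.
have : mdeg (m - U_(i) + U_(i)) = d.+1 by rewrite submK ?lep1mP.
by rewrite mdegD mdeg1 addn1 => -[e1]; apply/rpredZ; rewrite dhomogX /= e1.
Qed.

(** Used to replace a cofactor by its homogeneous component whenever a form is divided by a form. *)
Lemma pihomogM (F : fieldType) d e (A B : {mpoly F[3]}) : A \is d.-homog ->
  pihomog mdeg (d + e) (A * B) = A * pihomog mdeg e B.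
Proof.
move=> hA; rewrite {1}(pihomog_partitionE (mf := mdeg) (leqnn (msize B))).
rewrite mulr_sumr raddf_sum /=.
have hk k : pihomog mdeg (d + e) (A * pihomog mdeg k B) =
    if k == e then A * pihomog mdeg e B else 0.
  have hAB : A * pihomog mdeg k B \is (d + k).-homog by apply: dhomogM => //; apply: pihomogP.
  case: eqP => [<-|ne]; first by rewrite pihomog_dE.
  by apply: pihomog_ne0 hAB; apply/eqP => /addnI.
under eq_bigr => k _ do rewrite hk.
rewrite -big_mkcond /=; have [le|gt] := ltnP e (msize B).
  by rewrite (big_pred1 (Ordinal le)).
rewrite big_pred0 => [|i]; last by apply/negbTE; rewrite neq_ltn (leq_trans (ltn_ord i)).
suff -> : pihomog mdeg e B = 0 by rewrite mulr0.
rewrite pihomogE big_seq_cond big1 // => m /andP[mB /eqP /= e1].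
by have := msize_mdeg_lt mB; rewrite e1 ltnNge gt.
Qed.

Lemma mderiv_map (F L : fieldType) (io : {rmorphism F -> L}) (A : {mpoly F[3]}) i :
  (map_mpoly io A)^`M(i) = map_mpoly io A^`M(i).
Proof. by apply/mpolyP => m; rewrite mcoeff_mderiv !mcoeff_map_mpoly mcoeff_mderiv raddfMn. Qed.

Lemma meval_map (F L : fieldType) (io : {rmorphism F -> L}) (A : {mpoly F[3]}) u :
  (map_mpoly io A).@[u] = mev io u A.
Proof.
elim/mpoly_ring_ind: A => [c|j|A B hA hB|A B hA hB].
- by rewrite map_mpolyC mevalC mevC.
- by rewrite map_mpolyX mevalXU mevX.
- by rewrite !rmorphD /= hA hB.
- by rewrite !rmorphM /= hA hB.
Qed.

Lemma meval_mev (F : fieldType) (A : {mpoly F[3]}) u : A.@[u] = mev idfun u A.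
Proof. by rewrite mevE. Qed.

Lemma I3_cases (l : 'I_3) : [\/ l = 0, l = 1 | l = 2].
Proof.
by case: l => [[|[|[|//]]] h]; [apply: Or31|apply: Or32|apply: Or33]; apply: val_inj.
Qed.

Lemma ordS_0 : ordS (0 : 'I_3) = 1. Proof. exact: val_inj. Qed.
Lemma ordS_1 : ordS (1 : 'I_3) = 2. Proof. exact: val_inj. Qed.
Lemma ordS_2 : ordS (2 : 'I_3) = 0. Proof. exact: val_inj. Qed.
Definition ordSE := (ordS_0, ordS_1, ordS_2).

Lemma ordS3 (l : 'I_3) : ordS (ordS (ordS l)) = l.
Proof. by case: (I3_cases l) => ->; rewrite !ordSE. Qed.

Lemma ordS_neq (l : 'I_3) : ordS l != l.
Proof. by case: (I3_cases l) => ->; rewrite !ordSE. Qed.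

Lemma ordSS_neq (l : 'I_3) : ordS (ordS l) != l.
Proof. by case: (I3_cases l) => ->; rewrite !ordSE. Qed.

Lemma I3_distinct (a b c : 'I_3) : a != b -> b != c -> a != c ->
  forall i, [\/ i = a, i = b | i = c].
Proof.
move=> + + + i.
case: (I3_cases a) => ->; case: (I3_cases b) => -> //; case: (I3_cases c) => -> // _ _ _;
case: (I3_cases i) => ->; solve [by apply: Or31|by apply: Or32|by apply: Or33].
Qed.

Lemma big_I3 (V : nmodType) (E : 'I_3 -> V) : \sum_i E i = E 0 + E 1 + E 2.
Proof.
rewrite !big_ord_recl big_ord0 addr0 addrA.
by congr (_ + E _ + E _); apply: val_inj.
Qed.

Lemma big_I3_distinct (V : nmodType) (E : 'I_3 -> V) (a b c : 'I_3) :
  a != b -> b != c -> a != c -> \sum_i E i = E a + E b + E c.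
Proof.
move=> ab bc ac; rewrite (bigD1 a) // (bigD1 b) 1?eq_sym //= (bigD1 c) /=; last first.
  by rewrite eq_sym ac eq_sym bc.
rewrite big1 ?addr0 ?addrA // => i /andP[/andP[ia ib] ic].
by have [e|e|e] := I3_distinct ab bc ac i; rewrite e eqxx in ia ib ic.
Qed.

Lemma varX_homog (F : fieldType) i : ('X_i : {mpoly F[3]}) \is 1.-homog.
Proof. by rewrite dhomogX /= mdeg1. Qed.

Lemma varXn_homog (F : fieldType) i m : ('X_i ^+ m : {mpoly F[3]}) \is m.-homog.
Proof. by have := dhomogMn m (varX_homog F i); rewrite mul1n. Qed.

Definition polyC2 (F : fieldType) (d : F) : {poly {poly F}} := d%:P%:P.

Fact polyC2_is_additive (F : fieldType) : zmod_morphism (@polyC2 F).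
Proof. by move=> a b; rewrite /polyC2 !raddfB. Qed.
HB.instance Definition _ (F : fieldType) :=
  GRing.isZmodMorphism.Build F {poly {poly F}} (@polyC2 F) (@polyC2_is_additive F).

Fact polyC2_is_multiplicative (F : fieldType) : monoid_morphism (@polyC2 F).
Proof. by split=> [|a b]; rewrite /polyC2 // !rmorphM. Qed.
HB.instance Definition _ (F : fieldType) :=
  GRing.isMonoidMorphism.Build F {poly {poly F}} (@polyC2 F) (@polyC2_is_multiplicative F).

Section PolyCOf.

Variables (F L : fieldType) (io : {rmorphism F -> L}).

Definition polyC_of (d : F) : {poly L} := (io d)%:P.

Fact polyC_of_is_additive : zmod_morphism polyC_of.
Proof. by move=> a b; rewrite /polyC_of !raddfB. Qed.
HB.instance Definition _ :=
  GRing.isZmodMorphism.Build F {poly L} polyC_of polyC_of_is_additive.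

Fact polyC_of_is_multiplicative : monoid_morphism polyC_of.
Proof. by split=> [|a b]; rewrite /polyC_of ?rmorph1 ?rmorphM. Qed.
HB.instance Definition _ :=
  GRing.isMonoidMorphism.Build F {poly L} polyC_of polyC_of_is_multiplicative.

End PolyCOf.

(** * Affine charts of the projective plane *)

Section Chart.

Variables (F : fieldType) (a b c : 'I_3).
Hypotheses (ab : a != b) (bc : b != c) (ac : a != c).

(** For distinct a, b, c this is the point with c-th coordinate 1. All three indices stay free, so
    that at a smooth point one may choose c with a nonzero coordinate and b with a nonzero partial
    derivative. *)
Definition chart_point (T : nzRingType) (x y : T) (i : 'I_3) : T :=
  if i == a then x else if i == b then y else 1.

Definition chart_vars : 'I_3 -> {poly {poly F}} :=
  chart_point ('X%:P : {poly {poly F}}) 'X.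

Definition dehomogenize : {mpoly F[3]} -> {poly {poly F}} :=
  @mev F {poly {poly F}} (@polyC2 F) chart_vars.
HB.instance Definition _ := GRing.RMorphism.on dehomogenize.

Lemma chart_point_c (T : nzRingType) (x y : T) : chart_point x y c = 1.
Proof. by rewrite /chart_point eq_sym (negbTE ac) eq_sym (negbTE bc). Qed.

Lemma chart_point_b (T : nzRingType) (x y : T) : chart_point x y b = y.
Proof. by rewrite /chart_point eq_sym (negbTE ab) eqxx. Qed.

Lemma chart_point_a (T : nzRingType) (x y : T) : chart_point x y a = x.
Proof. by rewrite /chart_point eqxx. Qed.

Lemma chart_point_scale (T : fieldType) (u : 'I_3 -> T) : u c != 0 ->
  u =1 (fun i => u c * chart_point (u a / u c) (u b / u c) i).
Proof.
move=> uc i; have [->|->|->] := I3_distinct ab bc ac i.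
- by rewrite chart_point_a mulrC mulfVK.
- by rewrite chart_point_b mulrC mulfVK.
- by rewrite chart_point_c mulr1.
Qed.

Lemma ev2_dehomogenize (T : fieldType) (io : {rmorphism F -> T}) x y A :
  ev2 io x y (dehomogenize A) = mev io (chart_point x y) A.
Proof.
apply: (@mev_comp F _ T (@polyC2 F) (ev2 io x y) io) => [d|i].
  by rewrite /= /polyC2 ev2C ev1C.
rewrite /= /chart_vars /chart_point; case: ifP => _; first by rewrite ev2C ev1X.
by case: ifP => _; rewrite ?ev2X ?rmorph1.
Qed.

Lemma mev_chart (T : fieldType) (io : {rmorphism F -> T}) (u : 'I_3 -> T) d A :
  u c != 0 -> A \is d.-homog ->
  mev io u A = u c ^+ d * ev2 io (u a / u c) (u b / u c) (dehomogenize A).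
Proof.
by move=> uc hA; rewrite ev2_dehomogenize -mev_homog //; apply/eq_mev/chart_point_scale.
Qed.

Lemma dehomogenizeX i : dehomogenize 'X_i = chart_vars i.
Proof. by rewrite /dehomogenize mevX. Qed.

Lemma homogenize_exists (g : {poly {poly F}}) :
  exists d A, A \is d.-homog /\ dehomogenize A = g.
Proof.
pose H (g : {poly {poly F}}) := exists d A, A \is d.-homog /\ dehomogenize A = g.
have HD g1 g2 : H g1 -> H g2 -> H (g1 + g2).
  move=> [d [A [hA <-]]] [e [B [hB <-]]].
  exists (d + e)%N, (A * 'X_c ^+ e + 'X_c ^+ d * B); split.
    apply: rpredD; apply: dhomogM => //; first exact: varXn_homog.
    exact: varXn_homog.
  by rewrite rmorphD !rmorphM !rmorphXn /= !dehomogenizeX /chart_vars chart_point_c !expr1n mulr1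
    mul1r.
have HM g1 g2 : H g1 -> H g2 -> H (g1 * g2).
  move=> [d [A [hA <-]]] [e [B [hB <-]]].
  by exists (d + e)%N, (A * B); split; [apply: dhomogM|rewrite rmorphM].
have HC (d : F) : H d%:P%:P.
  exists 0%N, d%:MP; split; last by rewrite /dehomogenize mevC.
  by rewrite -[d%:MP]mulr1 mul_mpolyC; apply/rpredZ/dhomog1.
have H0 : H 0 by rewrite -!polyC0; apply: HC.
have Hx : H 'X%:P by exists 1%N, 'X_a; rewrite dehomogenizeX /chart_vars chart_point_a; split;
  first exact: varX_homog.
have Hy : H 'X by exists 1%N, 'X_b; rewrite dehomogenizeX /chart_vars chart_point_b; split;
  first exact: varX_homog.
have Hc (p : {poly F}) : H p%:P.
  elim/poly_ind: p => [|p d IH]; first by rewrite polyC0.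
  by rewrite polyCD polyCM; apply: HD => //; apply: HM.
by elim/poly_ind: g => [|p d IH] //; apply: HD => //; apply: HM.
Qed.

End Chart.

(** * The curve at its generic point and in its charts *)

Section Curve.

Variables (F : fieldType) (n : nat) (hn : (3 <= n)%N).
Variables (G : {mpoly F[3]}) (hG : G \is (n - 2)%N.-homog).
Local Notation f := (curve_poly n G).

(** Apart from G the equation is invariant under the cyclic shift of the variables. Starting the
    expansion at any index l lets one argument serve all three coordinate points. *)
Lemma mev_curve (T : comNzRingType) (io : {rmorphism F -> T}) u (l : 'I_3) :
  let l1 := ordS l in let l2 := ordS l1 in
  mev io u f = u l * u l1 ^+ n + u l1 * u l2 ^+ n
             + u l2 * u l ^+ n + u l * u l1 * u l2 * mev io u G.
Proof.
rewrite /curve_poly !rmorphD !rmorphM !rmorphXn /= !mevX.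
by case: (I3_cases l) => ->; rewrite !ordSE //; ring.
Qed.

Lemma curve_homog : f \is n.+1.-homog.
Proof.
have h i j : ('X_i * 'X_j ^+ n : {mpoly F[3]}) \is n.+1.-homog.
  exact: dhomogM (varX_homog F i) (varXn_homog F j n).
apply: rpredD; first by apply: rpredD; [apply: rpredD|]; exact: h.
have <- : (1 + 1 + 1 + (n - 2) = n.+1)%N by lia.
exact: dhomogM (dhomogM (dhomogM (varX_homog F 0) (varX_homog F 1)) (varX_homog F 2)) hG.
Qed.

Variable K : function_field f.
Local Notation k := (ff_const K).

Definition gen_coord (i : 'I_3) : K := ff_gen K 0 i.
Local Notation X := gen_coord.
Local Notation fev := (mev k X).

Lemma form_at_genE A : form_at_gen K A = fev A.
Proof. by rewrite /form_at_gen meval_map. Qed.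

Lemma fev_vanish d A : A \is d.-homog -> fev A = 0 -> exists B, A = f * B.
Proof. by move=> hA; rewrite -form_at_genE => /(ff_vanish K hA). Qed.

Lemma fev_curve : fev f = 0.
Proof.
rewrite -form_at_genE; apply/(ff_vanish K curve_homog).
by exists 1; rewrite mulr1.
Qed.

Lemma fev_mulf B : fev (f * B) = 0.
Proof. by rewrite rmorphM /= fev_curve mul0r. Qed.

Lemma mev_delta_curve (T : comNzRingType) (io : {rmorphism F -> T}) (i : 'I_3) :
  mev io (fun j => (j == i)%:R) f = 0.
Proof.
have n0 : (n == 0)%N = false by apply/negbTE; lia.
by rewrite (mev_curve _ _ i) eqxx (negbTE (ordS_neq i)) (negbTE (ordSS_neq i)) !expr0n n0 /=
  !(mulr0, mul0r, addr0).
Qed.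

(** The curve passes through the i-th coordinate point, where the form X_i takes the value 1, so f
    cannot divide X_i. *)
Lemma gen_coord_neq0 i : X i != 0.
Proof.
apply/eqP => Xi; have [||B e] := @fev_vanish 1 'X_i; first exact: varX_homog.
  by rewrite mevX.
have := congr1 (mev idfun (fun j => (j == i)%:R)) e.
by rewrite mevX eqxx rmorphM /= mev_delta_curve mul0r => /eqP; rewrite oner_eq0.
Qed.

Lemma curve_neq0 : f != 0.
Proof.
(* At the point (0 : 1 : 1) only the term Y Z^n survives, with value 1. *)
apply/eqP => f0; have := mev_curve idfun (fun i => (i != 0)%:R) 0.
rewrite f0 rmorph0 !eqxx /= !mul0r expr0n; have -> : (n == 0)%N = false by apply/negbTE; lia.
rewrite mulr0 addr0 !addr0 add0r.
by rewrite expr1n mulr1 => /eqP; rewrite eq_sym oner_eq0.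
Qed.

(** Since f has degree n + 1, it divides no nonzero form of smaller degree. Relations of degree at
    most n in the function field are therefore polynomial identities. *)
Lemma fev_small d A : A \is d.-homog -> (d <= n)%N -> fev A = 0 -> A = 0.
Proof.
move=> hA dn /(fev_vanish hA) [B eA]; apply/eqP/negPn/negP => A0.
have B0 : B != 0 by apply: contraNneq A0 => B0; rewrite eA B0 mulr0.
have sz e (C : {mpoly F[3]}) : C != 0 -> C \is e.-homog -> msize C = e.+1.
  move=> C0 hC; have := dhomog_uniq C0 hC (dhomog_msize hC) => /= ->.
  by rewrite prednK // lt0n msize_poly_eq0.
have := sz _ _ A0 hA; rewrite {1}eA msizeM ?curve_neq0 // (sz _ _ curve_neq0 curve_homog).
have [e ->] : exists e, msize B = e.+1.
  by exists (msize B).-1; rewrite prednK // lt0n msize_poly_eq0.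
lia.
Qed.

Lemma dhomog_cofactor d A B : A \is (n.+1 + d).-homog -> A = f * B ->
  exists B', B' \is d.-homog /\ A = f * B'.
Proof.
move=> hA eA; exists (pihomog mdeg d B); split; first exact: pihomogP.
by rewrite -(pihomogM d B curve_homog) -eA pihomog_dE.
Qed.

(** * Places and geometric points *)

Variables (L : closedFieldType) (iL : {rmorphism F -> L}).
Hypothesis curve_smooth : forall P : 'I_3 -> L, (exists i, P i != 0) ->
  mev iL P f = 0 -> exists s, mev iL P f^`M(s) != 0.
Hypothesis separable_root : forall x : L, exists t : {poly F},
  ev1 iL x t = 0 /\ t^`() = -1.

Section CurveChart.

Variables a b c : 'I_3.
Hypotheses (ab : a != b) (bc : b != c) (ac : a != c).
Local Notation x := (X a / X c).
Local Notation y := (X b / X c).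
Local Notation deh := (@dehomogenize F a b).
Local Notation phi := (deh f).

Lemma fev_chart d A : A \is d.-homog -> fev A = X c ^+ d * ev2 k x y (deh A).
Proof. by move=> hA; apply: mev_chart => //; apply: gen_coord_neq0. Qed.

Lemma chart_phi0 : ev2 k x y phi = 0.
Proof.
have /eqP := fev_chart curve_homog; rewrite fev_curve eq_sym mulf_eq0 expf_eq0.
by rewrite (negbTE (gen_coord_neq0 c)) andbF => /eqP.
Qed.

Lemma chart_phi_ker (g : {poly {poly F}}) : ev2 k x y g = 0 ->
  exists h : {poly {poly F}}, g = phi * h.
Proof.
have [d [A [hA <-]]] := homogenize_exists ab bc ac g => g0.
have [|B ->] := fev_vanish hA; first by rewrite (fev_chart hA) g0 mulr0.
by exists (deh B); rewrite rmorphM.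
Qed.

Lemma chart_phi_size : (1 < size phi)%N.
Proof.
rewrite ltnNge; apply/negP => /size1_polyC e.
have n0 : (n == 0)%N = false by apply/negbTE; lia.
(* On the line X = 0 of the chart, [phi] becomes Y or Y^n according to the cyclic orientation of (a,
   b, c); its values at 0 and 1 differ, so it is not constant in Y. *)
have h (y' : F) : ev2 idfun 0 y' phi = (if c == ordS b then y' else y' ^+ n).
  rewrite ev2_dehomogenize (mev_curve _ _ b) /=; have [cb|cb] := eqVneq c (ordS b).
    have ea : a = ordS (ordS b).
      by move: ab bc ac; rewrite cb; case: (I3_cases a) => ->; case: (I3_cases b) => ->;
        rewrite !ordSE.
    rewrite -ea -cb chart_point_a chart_point_b // chart_point_c //.
    by rewrite expr1n expr0n n0 !mulr0 !mul0r mulr1 !addr0.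
  have [ec ea] : c = ordS (ordS b) /\ a = ordS b.
    move: ab bc ac cb; case: (I3_cases a) => ->; case: (I3_cases b) => -> //;
    by case: (I3_cases c) => ->; rewrite !ordSE.
  rewrite -ec -ea chart_point_a chart_point_b // chart_point_c //.
  by rewrite expr1n expr0n n0 !mulr0 !mul0r mul1r !addr0 !add0r.
have := h 0; have := h 1; rewrite e !ev2C => -> /eqP.
by rewrite expr0n n0 expr1n !if_same oner_eq0.
Qed.

Lemma chart_frac (z : K) : exists g h : {poly {poly F}},
  ev2 k x y h != 0 /\ z = ev2 k x y g / ev2 k x y h.
Proof.
have [d [A [B [hA hB B0 ->]]]] := ff_fraction z.
rewrite -!/(form_at_gen K _) !form_at_genE in B0 *.
rewrite (fev_chart hB) in B0 *; rewrite (fev_chart hA); exists (deh A), (deh B).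
by move: B0; rewrite mulf_eq0 negb_or => /andP[h1 h2]; split=> //; field; apply/andP.
Qed.

(** By the chain rule the derivative of the dehomogenized f in Y is the dehomogenized partial
    derivative of f in the variable b. *)
Lemma chart_phi_simple (P : 'I_3 -> L) : P c != 0 -> mev iL P f^`M(b) != 0 ->
  ((reduce iL (P a / P c) phi)^`()).[P b / P c] != 0.
Proof.
move=> Pc; have hfb : f^`M(b) \is n.-homog := mderiv_homog b curve_homog.
rewrite (mev_chart ab bc ac iL Pc hfb) mulf_eq0 negb_or => /andP[_].
rewrite ev2_dehomogenize; set x0 := P a / P c; set y0 := P b / P c.
pose u : 'I_3 -> {poly L} := chart_point a b (x0%:P : {poly L}) 'X.
have -> : reduce iL x0 phi = @mev F {poly L} (polyC_of iL) u f.
  apply: (@mev_comp F _ {poly L} (@polyC2 F) (reduce iL x0) (polyC_of iL)) => [d|i] /=.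
    by rewrite /polyC2 /polyC_of reduceC ev1C.
  rewrite /chart_vars /u /chart_point; case: ifP => _; first by rewrite reduceC ev1X.
  by case: ifP => _; rewrite ?reduceX ?rmorph1.
have -> := @mpoly_chain_rule F {poly L} (polyC_of iL) {poly L}^o (@deriv L) u f; first last.
- by move=> d; rewrite derivC.
- by move=> p q; rewrite derivM addrC; congr (_ + _); rewrite mulrC.
- by move=> p q; rewrite derivD.
rewrite (big_I3_distinct _ ab bc ac) /u chart_point_a chart_point_b // chart_point_c //.
rewrite derivC derivX -polyC1 derivC !scaler0 add0r addr0 [_ *: _]mulr1 -/u.
rewrite -[_.[y0]]/(horner_eval y0 _).
rewrite (@mev_comp F {poly L} L (polyC_of iL) (horner_eval y0) iL u (chart_point a b x0 y0)) //.
- by move=> d; rewrite /= /horner_eval hornerC.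
- move=> i; rewrite /= /horner_eval /u /chart_point.
  by case: ifP => _; [rewrite hornerC|case: ifP => _; rewrite ?hornerX ?hornerC].
Qed.

End CurveChart.

End Curve.

(** * Centres of places *)

Section Points.

Variables (F : fieldType) (n : nat) (hn : (3 <= n)%N).
Variables (G : {mpoly F[3]}) (hG : G \is (n - 2)%N.-homog).
Local Notation f := (curve_poly n G).
Variable K : function_field f.
Local Notation k := (ff_const K).
Local Notation X := (gen_coord K).
Local Notation fev := (mev k X).
Variables (L : closedFieldType) (iL : {rmorphism F -> L}).
Hypothesis curve_smooth : forall P : 'I_3 -> L, (exists i, P i != 0) ->
  mev iL P f = 0 -> exists s, mev iL P f^`M(s) != 0.
Hypothesis separable_root : forall x : L, exists t : {poly F},
  ev1 iL x t = 0 /\ t^`() = -1.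

Implicit Types (v : place K) (A B : {mpoly F[3]}).

Let X0 i : X i != 0. Proof. exact: (gen_coord_neq0 hn hG). Qed.

(** The coordinates of the generic point are fixed only up to a common factor, which shifts their
    values at v. The order at v of a form A of degree d is the value of [fev A] minus d * [mu v],
    which does not depend on that factor. *)
Definition mu (v : place K) : int := Num.min (v (X 0)) (Num.min (v (X 1)) (v (X 2))).

Lemma mu_le v i : mu v <= v (X i).
Proof. by case: (I3_cases i) => ->; rewrite /mu !ge_min lexx ?orbT. Qed.

Lemma mu_ex v : exists c, v (X c) = mu v.
Proof.
rewrite /mu; case: leP => _; first by exists 0.
by case: leP => _; [exists 1|exists 2].
Qed.

Lemma val_form v d (A : {mpoly F[3]}) : A \is d.-homog -> val_ge v (fev A) (d%:Z * mu v).
Proof.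
move=> hA; rewrite mev_sum big_seq; apply: val_ge_sum => m /(dhomog_mdeg hA) <-.
apply: val_geZ; rewrite mdegE (big_morph _ PoszD (erefl _)) mulr_suml.
elim/big_rec2: _ => [|i y z _ h]; first exact: val_ge1.
apply: val_geM => //; apply: val_geX; right; exact: mu_le.
Qed.

Definition form (d : nat) (z : K) : Prop := exists A, A \is d.-homog /\ z = fev A.

Lemma form_fev d (A : {mpoly F[3]}) : A \is d.-homog -> form d (fev A).
Proof. by move=> hA; exists A. Qed.

Lemma form_gen i : form 1 (X i).
Proof. by exists 'X_i; rewrite mevX; split=> //; apply: varX_homog. Qed.

Lemma formM d e z w : form d z -> form e w -> form (d + e) (z * w).
Proof.
by move=> [A [hA ->]] [B [hB ->]]; exists (A * B); rewrite rmorphM; split=> //; apply: dhomogM.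
Qed.

Lemma formD d z w : form d z -> form d w -> form d (z + w).
Proof.
by move=> [A [hA ->]] [B [hB ->]]; exists (A + B); rewrite rmorphD; split=> //; apply: rpredD.
Qed.

Lemma formZ d a z : form d z -> form d (k a * z).
Proof. by move=> [A [hA ->]]; exists (a *: A); rewrite mevZ; split=> //; apply: rpredZ. Qed.

Lemma form0 d : form d 0.
Proof. by exists 0; rewrite rmorph0; split=> //; apply: rpred0. Qed.

Lemma form1 : form 0 1.
Proof. by exists 1; rewrite rmorph1; split=> //; apply: dhomog1. Qed.

Lemma formX d z m : form d z -> form (m * d) (z ^+ m).
Proof.
move=> hz; elim: m => [|m IH]; first exact: form1.
by rewrite exprS mulSn; apply: formM.
Qed.

Lemma formXn i m : form m (X i ^+ m).
Proof. by rewrite -[m in form m]muln1; apply/formX/form_gen. Qed.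

Lemma val_ge_form v d z : form d z -> val_ge v z (d%:Z * mu v).
Proof. by move=> [A [hA ->]]; apply: val_form. Qed.

(** The counterpart of [place_at] for a point over the algebraic closure: forms not vanishing at P
    have order 0 at v. Conjugate points have the same places. *)
Definition centered (v : place K) (P : 'I_3 -> L) : Prop :=
  forall d A, A \is d.-homog -> mev iL P A != 0 -> v (fev A) = d%:Z * mu v.

Lemma centered_coord v P c : centered v P -> P c != 0 -> v (X c) = mu v.
Proof.
by move=> h Pc; have := h 1%N 'X_c (varX_homog F c); rewrite !mevX mul1r; apply.
Qed.

Lemma fev_neq0 d P A : A \is d.-homog -> mev iL P f = 0 -> mev iL P A != 0 -> fev A != 0.
Proof.
move=> hA Pf; apply: contra_neq => /(fev_vanish hA) [B ->].
by rewrite rmorphM /= Pf mul0r.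
Qed.

(** In the chart of a coordinate X_c of least value at v, both affine coordinates are integral, so
    [chart_place_center] applies. *)
Lemma place_center v : exists P : 'I_3 -> L,
  [/\ exists i, P i != 0, mev iL P f = 0 & centered v P].
Proof.
have [c vc] := mu_ex v; pose a := ordS c; pose b := ordS a.
have ab : a != b by rewrite eq_sym ordS_neq.
have bc : b != c by rewrite ordSS_neq.
have ac : a != c by rewrite ordS_neq.
have hx i : val_ge v (X i / X c) 0.
  by rewrite val_geMr ?invr_eq0 // placeV opprK add0r vc; right; apply: mu_le.
have [x0 [y0 [Pf Pu]]] := chart_place_center iL (chart_phi0 hn hG K ab bc ac)
  (chart_phi_ker hn hG ab bc ac) (chart_phi_size hn hG ab bc ac)
  (chart_frac hn hG ab bc ac) (hx a) (hx b).
exists (chart_point a b x0 y0); split.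
- by exists c; rewrite chart_point_c // oner_neq0.
- by rewrite -ev2_dehomogenize.
move=> d A hA; rewrite -ev2_dehomogenize => Ah.
have := fev_neq0 hA (P := chart_point a b x0 y0); rewrite -!ev2_dehomogenize => /(_ Pf Ah).
rewrite (fev_chart hn hG K ab bc ac hA) mulf_eq0 negb_or => /andP[h1 h2].
by rewrite placeM // placeX Pu // addr0 vc.
Qed.

(** Euler's relation at P: if the partial derivatives other than f_c vanished, then P_c f_c(P) = (n
    + 1) f(P) = 0 would make f_c vanish too. So some f_b with b different from c is nonzero. *)
Lemma smooth_chart P : (exists i, P i != 0) -> mev iL P f = 0 ->
  exists a b c : 'I_3, [/\ a != b, b != c, a != c, P c != 0 & mev iL P f^`M(b) != 0].
Proof.
move=> P0 Pf; have [c Pc] := P0; have [s Ps] := curve_smooth P0 Pf.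
suff [b bc Pb] : exists2 b, b != c & mev iL P f^`M(b) != 0.
  suff [a ab ac] : exists2 a : 'I_3, a != b & a != c by exists a, b, c.
  move: bc; case: (I3_cases b) => ->; case: (I3_cases c) => -> // _;
  by [exists 0|exists 1|exists 2].
have [sc|sc] := eqVneq s c; last by exists s.
have e := congr1 (mev iL P) (mpoly_euler (curve_homog hn hG)).
rewrite (big_I3_distinct _ (a := c) (b := ordS c) (c := ordS (ordS c))) in e; last first.
- by rewrite eq_sym ordSS_neq.
- by rewrite eq_sym ordS_neq.
- by rewrite eq_sym ordS_neq.
rewrite mevZ Pf mulr0 !rmorphD !rmorphM /= !mevX in e.
have [e1|] := eqVneq (mev iL P f^`M(ordS c)) 0; last by exists (ordS c); rewrite ?ordS_neq.
have [e2|] := eqVneq (mev iL P f^`M(ordS (ordS c))) 0; last by exists (ordS (ordS c));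
  rewrite ?ordSS_neq.
move/eqP: e; rewrite e1 e2 !mulr0 !addr0 mulf_eq0 (negbTE Pc) /= => /eqP.
by rewrite -sc => e; rewrite e eqxx in Ps.
Qed.

Section LocalStructure.

Variables (P : 'I_3 -> L) (a b c : 'I_3).
Hypotheses (ab : a != b) (bc : b != c) (ac : a != c).
Hypotheses (Pf : mev iL P f = 0) (Pc : P c != 0) (Pb : mev iL P f^`M(b) != 0).
Local Notation x := (X a / X c).
Local Notation y := (X b / X c).
Local Notation x0 := (P a / P c).
Local Notation y0 := (P b / P c).
Local Notation deh := (@dehomogenize F a b).

Let phi0 := chart_phi0 hn hG K ab bc ac.
Let ker := chart_phi_ker hn hG ab bc ac (K := K).
Let size := chart_phi_size hn hG ab bc ac.
Let frac := chart_frac hn hG ab bc ac (K := K).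
Let simple := chart_phi_simple hn hG ab bc ac Pc Pb.

Let phiP : ev2 iL x0 y0 (deh f) = 0.
Proof.
move/eqP: Pf; rewrite (mev_chart ab bc ac iL Pc (curve_homog hn hG)) mulf_eq0 expf_eq0.
by rewrite (negbTE Pc) andbF => /eqP.
Qed.

Let mev_deh d A : A \is d.-homog -> (mev iL P A == 0) = (ev2 iL x0 y0 (deh A) == 0).
Proof.
move=> hA; rewrite (mev_chart ab bc ac iL Pc hA) mulf_eq0 expf_eq0.
by rewrite (negbTE Pc) andbF.
Qed.

Let fev_deh d A : A \is d.-homog -> fev A = X c ^+ d * ev2 k x y (deh A).
Proof. exact: (fev_chart hn hG K ab bc ac). Qed.

Lemma chart_point_has_place : exists v : place K, centered v P.
Proof.
have [t [t0 t1]] := separable_root x0.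
have [v hv] := chart_place_exists phi0 ker size frac phiP simple t0 t1.
exists v => d A hA; have ge g := chart_place_ge0 hv g.
have mu_c : mu v = v (X c).
  have h i : val_ge v (X i / X c) 0 -> v (X c) <= v (X i).
    by rewrite val_geMr ?invr_eq0 // placeV opprK add0r val_ge_neq0.
  have le i : v (X c) <= v (X i).
    have [->|->|->] := I3_distinct ab bc ac i => //.
      by apply: h; have := ge 'X%:P; rewrite ev2C ev1X.
    by apply: h; have := ge 'X; rewrite ev2X.
  by apply/eqP; rewrite eq_le mu_le /= /mu !le_min !le.
rewrite (mev_deh hA) => Ah; have := fev_neq0 hA Pf; rewrite (mev_deh hA) => /(_ Ah).
rewrite (fev_deh hA) mulf_eq0 negb_or => /andP[h1 h2].
by rewrite placeM // placeX hv // addr0 mu_c.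
Qed.

Variable v : place K.
Hypothesis vP : centered v P.

Let v_unit g : ev2 iL x0 y0 g != 0 -> v (ev2 k x y g) = 0.
Proof.
have [d [A [hA <-]]] := homogenize_exists ab bc ac g => Ah.
have Ah' : mev iL P A != 0 by rewrite (mev_deh hA).
have := vP hA Ah'; have := fev_neq0 hA Pf Ah'.
rewrite (fev_deh hA) mulf_eq0 negb_or => /andP[h1 h2].
rewrite placeM // placeX (centered_coord vP Pc) => /eqP.
by rewrite -subr_eq0 addrAC subrr add0r => /eqP.
Qed.

Lemma chart_dominates d A : A \is d.-homog -> mev iL P A = 0 ->
  val_ge v (fev A) (d%:Z * mu v + 1).
Proof.
move=> hA /eqP; rewrite (mev_deh hA) => /eqP A0.
have [t [t0 t1]] := separable_root x0.
rewrite (fev_deh hA); apply: val_geM.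
  by rewrite -(centered_coord vP Pc) -placeX; apply: val_ge_refl.
exact: (chart_place_dominates phi0 ker size frac phiP simple t0 t1 v_unit A0).
Qed.

Lemma chart_integral z : val_ge v z 0 -> exists d A B,
  [/\ A \is d.-homog, B \is d.-homog, mev iL P B != 0 & z = fev A / fev B].
Proof.
have [t [t0 t1]] := separable_root x0.
move/(chart_place_integral phi0 ker size frac phiP simple t0 t1 v_unit).
move=> [g [h [h0 ez]]].
have [d [A [hA eA]]] := homogenize_exists ab bc ac g.
have [e [B [hB eB]]] := homogenize_exists ab bc ac h.
have hBe : B * 'X_c ^+ d \is (d + e).-homog.
  by rewrite mulrC; apply: dhomogM => //; apply: varXn_homog.
have PB : mev iL P (B * 'X_c ^+ d) != 0.
  by rewrite rmorphM rmorphXn /= mevX mulf_neq0 ?expf_neq0 // (mev_deh hB) eB.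
exists (d + e)%N, (A * 'X_c ^+ e), (B * 'X_c ^+ d); split=> //.
  by apply: dhomogM => //; apply: varXn_homog.
have := fev_neq0 hBe Pf PB.
rewrite !rmorphM !rmorphXn /= !mevX (fev_deh hA) (fev_deh hB) eA eB ez.
rewrite !mulf_eq0 !negb_or -andbA => /and3P[h1 h2 h3].
have h4 : X c ^+ d != 0 by rewrite expf_neq0.
by field; rewrite h1 h2 h4.
Qed.

Lemma chart_uniformizer t : ev1 iL x0 t = 0 -> t^`() = -1 -> v (ev1 k x t) = 1.
Proof.
by move=> t0 t1; apply: (chart_place_uniformizer phi0 ker size frac phiP simple t0 t1 v_unit).
Qed.

End LocalStructure.

Section AtPoint.

Variable P : 'I_3 -> L.
Hypotheses (P0 : exists i, P i != 0) (Pf : mev iL P f = 0).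

Lemma point_has_place : exists v : place K, centered v P.
Proof.
have [a [b [c [ab bc ac Pc Pb]]]] := smooth_chart P0 Pf.
exact: chart_point_has_place ab bc ac Pf Pc Pb.
Qed.

Lemma centered_dominates v d A : centered v P -> A \is d.-homog -> mev iL P A = 0 ->
  val_ge v (fev A) (d%:Z * mu v + 1).
Proof.
have [a [b [c [ab bc ac Pc Pb]]]] := smooth_chart P0 Pf => vP hA PA.
exact: (chart_dominates ab bc ac Pf Pc Pb vP hA PA).
Qed.

Lemma centered_integral v z : centered v P -> val_ge v z 0 -> exists d A B,
  [/\ A \is d.-homog, B \is d.-homog, mev iL P B != 0 & z = fev A / fev B].
Proof.
have [a [b [c [ab bc ac Pc Pb]]]] := smooth_chart P0 Pf => vP hz.
exact: (chart_integral ab bc ac Pf Pc Pb vP hz).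
Qed.

End AtPoint.

(** * Forms as the sections that are integral at all places *)

Definition congruent (D A B : {mpoly F[3]}) : Prop := exists C, A - B = D * C.

Lemma congruent_refl D A : congruent D A A.
Proof. by exists 0; rewrite subrr mulr0. Qed.

Lemma congruentD D A B A' B' :
  congruent D A B -> congruent D A' B' -> congruent D (A + A') (B + B').
Proof. by move=> [C e] [C' e']; exists (C + C'); rewrite opprD addrACA e e' mulrDr. Qed.

Lemma congruentM D A B A' B' :
  congruent D A B -> congruent D A' B' -> congruent D (A * A') (B * B').
Proof.
move=> [C e] [C' e']; exists (C * A' + B * C').
rewrite mulrDr [D * (C * A')]mulrA -e [D * (B * C')]mulrCA -e' mulrBl mulrBr.
by rewrite addrA subrK.
Qed.

Lemma congruent_subst D (u w : 'I_3 -> {mpoly F[3]}) A : (forall i, congruent D (u i) (w i)) ->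
  congruent D (@mev F {mpoly F[3]} (@mpolyC 3 F) u A) (@mev F {mpoly F[3]} (@mpolyC 3 F) w A).
Proof.
move=> h; elim/mpoly_ring_ind: A => [d|j|A B hA hB|A B hA hB].
- by rewrite !mevC; apply: congruent_refl.
- by rewrite !mevX.
- by rewrite !rmorphD; apply: congruentD.
- by rewrite !rmorphM; apply: congruentM.
Qed.

Lemma mev_id A : @mev F {mpoly F[3]} (@mpolyC 3 F) (fun j => 'X_j) A = A.
Proof.
elim/mpoly_ring_ind: A => [d|j|A B hA hB|A B hA hB].
- by rewrite mevC.
- by rewrite mevX.
- by rewrite rmorphD /= hA hB.
- by rewrite rmorphM /= hA hB.
Qed.

Definition subst_var (i : 'I_3) (B : {mpoly F[3]}) : {mpoly F[3]} -> {mpoly F[3]} :=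
  @mev F {mpoly F[3]} (@mpolyC 3 F) (fun j => if j == i then B else 'X_j).
HB.instance Definition _ i B := GRing.RMorphism.on (subst_var i B).

Lemma subst_varX i B j : subst_var i B 'X_j = if j == i then B else 'X_j.
Proof. by rewrite /subst_var mevX. Qed.

Lemma subst_var_mod i B A : congruent ('X_i - B) A (subst_var i B A).
Proof.
rewrite -[X in congruent _ X _]mev_id; apply: congruent_subst => j.
by case: eqP => [->|_]; [exists 1; rewrite mulr1|apply: congruent_refl].
Qed.

Lemma mvarX_neq0 (i : 'I_3) : 'X_i != 0 :> {mpoly F[3]}.
Proof.
apply/eqP => e; have := congr1 (mev idfun (fun=> (1 : F))) e.
by rewrite mevX rmorph0 => /eqP; rewrite oner_eq0.
Qed.

(* The irrelevant ideal contains a nonzerodivisor modulo (X_0, f), because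
   f = X_1 X_2^n modulo X_0. *)
Lemma form_saturated d z : (forall i, form d.+1 (X i * z)) -> form d z.
Proof.
move=> h; have [C0 [hC0 e0]] := h 0; have [C1 [hC1 e1]] := h 1; have [C2 [hC2 e2]] := h 2.
have [||T eT] := @fev_vanish _ _ _ K (1 + d.+1) ('X_0 * C1 - 'X_1 * C0).
- by apply: rpredB; apply: dhomogM => //; apply: varX_homog.
- by rewrite rmorphB !rmorphM /= !mevX -e0 -e1; ring.
have [||T' eT'] := @fev_vanish _ _ _ K (1 + d.+1) ('X_0 * C2 - 'X_2 * C0).
- by apply: rpredB; apply: dhomogM => //; apply: varX_homog.
- by rewrite rmorphB !rmorphM /= !mevX -e0 -e2; ring.
have kf : subst_var 0 0 f = 'X_1 * 'X_2 ^+ n.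
  rewrite /subst_var (@mev_curve F n G _ _ _ 0) /= !ordSE /= !mul0r expr0n.
  have -> : (n == 0)%N = false by apply/negbTE; lia.
  by rewrite /= mulr0 !addr0 add0r.
have x1 := mvarX_neq0 1; have x2 := mvarX_neq0 2.
(* The relation X_0 C1 - X_1 C0 = f T is read modulo X_0, where f is X_1 X_2^n. *)
have E1 : subst_var 0 0 C0 = - ('X_2 ^+ n * subst_var 0 0 T).
  apply: (mulfI x1); have := congr1 (subst_var 0 0) eT.
  rewrite rmorphB !rmorphM /= !subst_varX /= kf mul0r sub0r => /(congr1 -%R).
  by rewrite opprK => ->; ring.
have E2 : 'X_2 * subst_var 0 0 T = 'X_1 * subst_var 0 0 T'.
  apply: (mulfI (expf_neq0 n x2)); have := congr1 (subst_var 0 0) eT'.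
  rewrite rmorphB !rmorphM /= !subst_varX /= kf mul0r sub0r E1 => /eqP.
  by rewrite mulrN opprK => /eqP e; rewrite mulrCA e; ring.
have E3 : subst_var 1 0 (subst_var 0 0 T) = 0.
  have /eqP := congr1 (subst_var 1 0) E2; rewrite !rmorphM /= !subst_varX /= mul0r mulf_eq0.
  by rewrite (negbTE x2) => /eqP.
have [V eV] := subst_var_mod 1 0 (subst_var 0 0 T); rewrite E3 !subr0 in eV.
have [U eU] := subst_var_mod 0 0 C0; have [W eW] := subst_var_mod 0 0 f.
rewrite subr0 in eU eW.
(* T is a multiple of X_1 modulo X_0, with cofactor V, so C0 is congruent to - X_1 X_2^n V, that is
   to - f V. Hence X_0 divides C0 modulo f. *)
have eC : C0 = 'X_0 * (U + W * V) + f * - V.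
  have -> : C0 = subst_var 0 0 C0 + 'X_0 * U by rewrite -eU addrC subrK.
  by rewrite mulrDr mulrA -eW E1 eV kf; ring.
exists (pihomog mdeg d (U + W * V)); split; first exact: pihomogP.
apply: (mulfI (X0 0)); rewrite e0 -(mevX k X 0) -rmorphM /=.
rewrite -(pihomogM d _ (varX_homog F 0)).
have -> : fev C0 = fev (pihomog mdeg (1 + d) C0) by rewrite pihomog_dE.
rewrite {1}eC raddfD /= rmorphD /=.
suff -> : fev (pihomog mdeg (1 + d) (f * - V)) = 0 by rewrite addr0.
have [nd|nd] := leqP n d.
  have -> : (1 + d = n.+1 + (d - n))%N by lia.
  by rewrite (pihomogM _ _ (curve_homog hn hG)) (fev_mulf hn hG).
have -> : pihomog mdeg (1 + d) (f * - V) = 0.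
  rewrite [V](pihomog_partitionE (mf := mdeg) (leqnn (msize V))) -sumrN mulr_sumr raddf_sum /=.
  apply: big1 => e _; rewrite -raddfN; apply: (@pihomog_ne0 _ _ _ (n.+1 + e)); first by lia.
  by apply: dhomogM; [apply: curve_homog|apply: pihomogP].
by rewrite rmorph0.
Qed.

(** In each chart z / X_c^d is a polynomial by integral closedness, so X_c^N z is a form for large
    N. Then z times any monomial of degree at least 3 N is a form, and [form_saturated] lowers this
    degree one at a time down to 0. *)
Lemma form_integral d z : (forall v : place K, val_ge v z (d%:Z * mu v)) -> form d z.
Proof.
move=> hz.
have [N hN] : exists N, forall c, form (N + d) (X c ^+ N * z).
  suff h c : exists N, form (N + d) (X c ^+ N * z).
    have [N0 h0] := h 0; have [N1 h1] := h 1; have [N2 h2] := h 2.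
    exists (N0 + N1 + N2)%N => c.
    have up N M : form (N + d) (X c ^+ N * z) -> form (M + N + d) (X c ^+ (M + N) * z).
      by move=> hc; rewrite exprD -mulrA -addnA; apply: formM => //; apply: formXn.
    case: (I3_cases c) up => -> up.
    - have -> : (N0 + N1 + N2 = N1 + N2 + N0)%N by lia.
      exact: up.
    - have -> : (N0 + N1 + N2 = N0 + N2 + N1)%N by lia.
      exact: up.
    - exact: up.
  pose a := ordS c; pose b := ordS a.
  have ab : a != b by rewrite eq_sym ordS_neq.
  have bc : b != c by rewrite ordSS_neq.
  have ac : a != c by rewrite ordS_neq.
  have [g eg] : exists g, z / X c ^+ d = ev2 k (X a / X c) (X b / X c) g.
    apply: (chart_integral_closed (iL := iL) (chart_phi0 hn hG K ab bc ac)
      (chart_phi_ker hn hG ab bc ac) (chart_phi_size hn hG ab bc ac)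
      (chart_frac hn hG ab bc ac)).
    - move=> x0 y0 xy0; pose P := chart_point a b x0 y0.
      have Pf : mev iL P f = 0 by rewrite -ev2_dehomogenize.
      have Pc : P c != 0 by rewrite /P chart_point_c // oner_neq0.
      have P0 : exists i, P i != 0 by exists c.
      have [v vP] := point_has_place P0 Pf; exists v.
      have vx i : val_ge v (X i / X c) 0.
        rewrite val_geMr ?invr_eq0 // placeV opprK add0r (centered_coord vP Pc).
        by right; apply: mu_le.
      split=> // w /(centered_integral P0 Pf vP) [e [A [B [hA hB PB ->]]]].
      exists (dehomogenize a b A), (dehomogenize a b B); rewrite ev2_dehomogenize; split=> //.
      have := fev_neq0 hB Pf PB.
      rewrite (fev_chart hn hG K ab bc ac hA) (fev_chart hn hG K ab bc ac hB).
      by rewrite mulf_eq0 negb_or => /andP[h1 h2]; field; rewrite h1 h2.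
    - move=> v hx hy.
      have vc : v (X c) = mu v.
        have h i : val_ge v (X i / X c) 0 -> v (X c) <= v (X i).
          by rewrite val_geMr ?invr_eq0 // placeV opprK add0r val_ge_neq0.
        have le i : v (X c) <= v (X i).
          by have [->|->|->] := I3_distinct ab bc ac i => //; apply: h.
        by apply/eqP; rewrite eq_le mu_le andbT /mu !le_min !le.
      by rewrite val_geMr ?invr_eq0 ?expf_neq0 // placeV placeX opprK add0r vc.
  have [N [A [hA eA]]] := homogenize_exists ab bc ac g; exists N.
  have -> : X c ^+ N * z = X c ^+ d * fev A.
    have h := expf_neq0 d (X0 c).
    rewrite (fev_chart hn hG K ab bc ac hA) eA -eg; field.
    exact: h.
  by rewrite mulrC; apply: formM; [exists A|apply: formXn].
pose mon p q r := X 0 ^+ p * X 1 ^+ q * X 2 ^+ r.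
have hmon p q r : form (p + q + r) (mon p q r) by do 2?apply: formM; apply: formXn.
pose D m := forall p q r, (m <= p + q + r)%N -> form (p + q + r + d) (mon p q r * z).
suff : D 0%N by move/(_ 0 0 0 isT)%N; rewrite /mon !mul1r.
(* A monomial of degree at least 3 N has an exponent that is at least N. *)
have : D (3 * N)%N.
  move=> p q r le.
  have up c e : (N <= e)%N -> form (e + d) (X c ^+ e * z).
    move=> le'; rewrite -(subnK le') exprD -mulrA -addnA.
    by apply: formM => //; apply: formXn.
  have [h0|h0] := leqP N p.
    have -> : (p + q + r + d = 0 + q + r + (p + d))%N by lia.
    have -> : mon p q r * z = mon 0 q r * (X 0 ^+ p * z) by rewrite /mon; ring.
    by apply: formM => //; apply: up.
  have [h1|h1] := leqP N q.
    have -> : (p + q + r + d = p + 0 + r + (q + d))%N by lia.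
    have -> : mon p q r * z = mon p 0 r * (X 1 ^+ q * z) by rewrite /mon; ring.
    by apply: formM => //; apply: up.
  have -> : (p + q + r + d = p + q + 0 + (r + d))%N by lia.
  have -> : mon p q r * z = mon p q 0 * (X 2 ^+ r * z) by rewrite /mon; ring.
  by apply: formM => //; apply: up; lia.
elim: (3 * N)%N => // m IH hm; apply: IH => p q r le; apply: form_saturated => i.
case: (I3_cases i) => ->.
- have -> : ((p + q + r + d).+1 = p.+1 + q + r + d)%N by lia.
  have -> : X 0 * (mon p q r * z) = mon p.+1 q r * z by rewrite /mon exprS; ring.
  by apply: hm; lia.
- have -> : ((p + q + r + d).+1 = p + q.+1 + r + d)%N by lia.
  have -> : X 1 * (mon p q r * z) = mon p q.+1 r * z by rewrite /mon (exprS _ q); ring.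
  by apply: hm; lia.
- have -> : ((p + q + r + d).+1 = p + q + r.+1 + d)%N by lia.
  have -> : X 2 * (mon p q r * z) = mon p q r.+1 * z by rewrite /mon (exprS _ r); ring.
  by apply: hm; lia.
Qed.

End Points.

(** * Derivations and differentials of the function field *)

Section Differentials.

Variables (F : fieldType) (n : nat) (hn : (3 <= n)%N).
Variables (G : {mpoly F[3]}) (hG : G \is (n - 2)%N.-homog).
Local Notation f := (curve_poly n G).
Variable K : function_field f.
Local Notation k := (ff_const K).
Local Notation X := (gen_coord K).
Local Notation fev := (mev k X).
Variables (L : closedFieldType) (iL : {rmorphism F -> L}).
Hypothesis curve_smooth : forall P : 'I_3 -> L, (exists i, P i != 0) ->
  mev iL P f = 0 -> exists s, mev iL P f^`M(s) != 0.
Hypothesis separable_root : forall x : L, exists t : {poly F},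
  ev1 iL x t = 0 /\ t^`() = -1.

Implicit Types (v : place K) (A B : {mpoly F[3]}).

Let X0 i : X i != 0. Proof. exact: (gen_coord_neq0 hn hG). Qed.

(** Both places are nonnegative on the same ring, the fractions A / B with B(P) nonzero, and this
    ring is the valuation ring of each. They are thus proportional, and normalization makes the
    factor 1. *)
Lemma place_unique (P : 'I_3 -> L) v v' : (exists i, P i != 0) -> mev iL P f = 0 ->
  centered iL v P -> centered iL v' P -> forall z, v z = v' z.
Proof.
move=> P0 Pf hv hv'.
have sub (w w' : place K) : centered iL w P -> centered iL w' P -> forall z, val_ge w z 0 ->
  val_ge w' z 0.
  move=> hw hw' z /(centered_integral hn hG curve_smooth separable_root P0 Pf hw).
  move=> [d [A [B [hA hB PB ->]]]].
  have B0 := fev_neq0 K hB Pf PB.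
  rewrite val_geMr ?invr_eq0 // placeV opprK add0r (hw' _ _ hB PB).
  exact: val_form.
have v0 (w w' : place K) (z : K) : centered iL w P -> centered iL w' P -> z != 0 -> w z = 0 -> w'
  z = 0.
  move=> hw hw' z0 wz; apply/eqP; rewrite eq_le; apply/andP; split.
    have := sub w w' hw hw' z^-1; rewrite !val_ge_neq0 ?invr_eq0 // !placeV wz oppr0 lexx.
    by rewrite oppr_ge0; apply.
  by have := sub w w' hw hw' z; rewrite !val_ge_neq0 // wz lexx; apply.
have [t vt] := place_normalized v; have [s vs] := place_normalized v'.
have t0 : t != 0 by apply: contraPneq vt => ->; rewrite place0.
have s0 : s != 0 by apply: contraPneq vs => ->; rewrite place0.
have vE z : z != 0 -> v' z = v z * v' t.
  move=> z0; have tz : t ^ (- v z) != 0 by rewrite expfz_neq0.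
  have : v (z * t ^ (- v z)) = 0 by rewrite placeM // place_exprz vt mulr1 subrr.
  move/(v0 v v' _ hv hv' (mulf_neq0 z0 tz)); rewrite placeM // place_exprz mulNr.
  by move/eqP; rewrite subr_eq0 => /eqP.
have vt1 : v' t = 1.
  have : val_ge v' t 0 by apply: (sub v v') => //; right; rewrite vt.
  rewrite val_ge_neq0 //; have := vE s s0; rewrite vs; move: (v s) (v' t) => p q e q0.
  have q1 : 0 < q by rewrite lt_neqAle q0 andbT; apply/eqP => h; move/eqP: e; rewrite -h mulr0.
  have p1 : 0 < p by nia.
  by apply: le_anti; apply/andP; split; nia.
move=> z; have [->|z0] := eqVneq z 0; first by rewrite !place0.
by rewrite vE // vt1 mulr1.
Qed.

(** * The derivation of the function field *)

(** A partial derivative has degree n, so by [fev_small] it vanishes at the generic point only if it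
    is the zero polynomial. Smoothness at the single point (1 : 0 : 0) excludes this for one of the
    three. *)
Lemma partial_neq0 : exists s, fev f^`M(s) != 0.
Proof.
pose P (j : 'I_3) : L := (j == 0)%:R.
have [||s Ps] := @curve_smooth P; first by exists 0; rewrite /P eqxx oner_neq0.
  exact: (mev_delta_curve hn).
exists s; apply: contraNneq Ps => /(fev_small hn hG (mderiv_homog s (curve_homog hn hG)) (leqnn
  n)) ->.
by rewrite rmorph0.
Qed.

Lemma partial_euler (i : 'I_3) :
  let i1 := ordS i in let i2 := ordS i1 in
  X i * fev f^`M(i) + X i1 * fev f^`M(i1) + X i2 * fev f^`M(i2) = 0.
Proof.
have := congr1 fev (mpoly_euler (curve_homog hn hG)).
rewrite (big_I3_distinct _ (a := i) (b := ordS i) (c := ordS (ordS i))) ?mevZ.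
- by rewrite (fev_curve hn hG) mulr0 !rmorphD !rmorphM /= !mevX.
- by rewrite eq_sym ordS_neq.
- by rewrite eq_sym ordS_neq.
- by rewrite eq_sym ordSS_neq.
Qed.

Section Derivation.

Variables (s r : 'I_3) (fs fr : K).
Hypotheses (r_s : r = ordS s) (fsE : fs = fev f^`M(s)) (frE : fr = fev f^`M(r)).
Hypothesis fs0 : fs != 0.

(** The Jacobian determinant of (f, A) in the variables s and r at the generic point. As a
    derivation in A it kills the multiples of f ([Jf]), so the quotient rule defines a derivation
    [D] of K that is independent of the chosen fraction ([DE]). *)
Let J A : K := fs * fev A^`M(r) - fr * fev A^`M(s).

Let JD A B : J (A + B) = J A + J B.
Proof. by rewrite /J !mderivD !rmorphD /=; ring. Qed.

Let JM A B : J (A * B) = J A * fev B + fev A * J B.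
Proof. by rewrite /J !mderivM !rmorphD !rmorphM /=; ring. Qed.

Let JC c : J c%:MP = 0.
Proof. by rewrite /J !mderivC !rmorph0 !mulr0 subrr. Qed.

Let JN A : J (- A) = - J A.
Proof. by rewrite /J !mderivN !rmorphN /=; ring. Qed.

Let Jf C : J (f * C) = 0.
Proof. by rewrite JM (fev_curve hn hG) mul0r addr0 /J -fsE -frE [fs * _]mulrC subrr mul0r. Qed.

Let fracP (z : K) : exists AB : nat * ({mpoly F[3]} * {mpoly F[3]}),
  [/\ AB.2.1 \is AB.1.-homog, AB.2.2 \is AB.1.-homog, fev AB.2.2 != 0 &
      z = fev AB.2.1 / fev AB.2.2].
Proof.
have [d [A [B [hA hB B0 ->]]]] := ff_fraction z.
by exists (d, (A, B)); rewrite /= -!form_at_genE; split.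
Qed.

Let D (z : K) : K :=
  let: (_, (A, B)) := projT1 (cid (fracP z)) in
  (fev B * J A - fev A * J B) / fev B ^+ 2.

Let DE d A B : A \is d.-homog -> B \is d.-homog -> fev B != 0 ->
  D (fev A / fev B) = (fev B * J A - fev A * J B) / fev B ^+ 2.
Proof.
move=> hA hB B0; rewrite /D; case: (cid _) => -[d' [A' B']] /= [hA' hB' B'0 e].
have [||C eC] := @fev_vanish _ _ _ K (d + d') (A * B' - B * A').
- by apply: rpredB; apply: dhomogM.
- rewrite rmorphB !rmorphM /=; apply/eqP; rewrite subr_eq0; apply/eqP.
  have -> : fev A = fev A / fev B * fev B by rewrite mulfVK.
  by rewrite e; field.
have := congr1 J eC; rewrite Jf JD JN !JM.
have eA : fev A = fev A' / fev B' * fev B by rewrite -e mulfVK.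
rewrite eA; move: (fev A') (fev B') (fev B) (J A) (J B) (J A') (J B') B'0 B0.
move=> a' b' b ja jb ja' jb' b'0 b0 e'.
have {}e' : ja = (b * ja' + jb * a' - a' / b' * b * jb') / b'.
  apply: (mulIf b'0); rewrite mulfVK //; apply/eqP; rewrite -subr_eq0 -e'; apply/eqP.
  by ring.
by rewrite e'; field; rewrite b0 b'0.
Qed.

Lemma derivation_exists_aux :
  exists2 D : K -> K^o, derivation D & D (X r / X (ordS r)) != 0.
Proof.
exists (D : K -> K^o).
  split=> [z w|z w|c].
  - have [[d [A B]] /= [hA hB B0 ->]] := fracP z.
    have [[e [A' B']] /= [hA' hB' B'0 ->]] := fracP w.
    rewrite (DE hA hB B0) (DE hA' hB' B'0).
    have -> : fev A / fev B + fev A' / fev B' = fev (A * B' + B * A') / fev (B * B').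
      by rewrite !(rmorphD, rmorphM) /=; field; rewrite B0 B'0.
    rewrite (@DE (d + e)).
    + by rewrite JD !JM !(rmorphD, rmorphM) /=; field; rewrite B0 B'0.
    + by apply: rpredD; apply: dhomogM.
    + exact: dhomogM.
    + by rewrite rmorphM mulf_neq0.
  - have [[d [A B]] /= [hA hB B0 ->]] := fracP z.
    have [[e [A' B']] /= [hA' hB' B'0 ->]] := fracP w.
    rewrite (DE hA hB B0) (DE hA' hB' B'0).
    have -> : fev A / fev B * (fev A' / fev B') = fev (A * A') / fev (B * B').
      by rewrite !rmorphM /=; field; rewrite B0 B'0.
    rewrite (@DE (d + e)).
    + by rewrite /GRing.scale /= !JM !(rmorphD, rmorphM) /=; field; rewrite B0 B'0.
    + exact: dhomogM.
    + exact: dhomogM.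
    + by rewrite rmorphM mulf_neq0.
  - have -> : k c = fev (c *: 1) / fev 1 by rewrite mevZ rmorph1 mulr1 divr1.
    rewrite (@DE 0) ?rmorph1 ?oner_neq0 ?dhomog1 //; last exact/rpredZ/dhomog1.
    by rewrite -mul_mpolyC mulr1 JC -mpolyC1 JC !mulr0 subrr mul0r.
pose c := ordS r.
rewrite -(mevX k X r) -(mevX k X c).
rewrite (DE (varX_homog F r) (varX_homog F c)) ?mevX // /J !mderivX !mnm1E.
have rs : r != s by rewrite r_s; apply: ordS_neq.
have cr : c != r by apply: ordS_neq.
have cs : c != s by rewrite /c r_s; apply: ordSS_neq.
rewrite eqxx (negbTE rs) (negbTE cr) (negbTE cs) !scale0r !rmorph0 !mulr0 !subr0.
have -> : (U_(r) - U_(r) = 0)%MM by apply/mnmP => j; rewrite mnmBE subnn mnm0E.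
rewrite scale1r mpolyX0 rmorph1 mulr1.
by rewrite mulr0 subr0 !mulf_neq0 ?invr_eq0 ?expf_neq0.
Qed.


End Derivation.

(** A derivation that does not kill some X_r / X_(r+1) factors through [Om], which shows below that
    the differential [om] is nonzero. *)
Lemma derivation_exists : exists r, exists2 D : K -> K^o,
  derivation D & D (X r / X (ordS r)) != 0.
Proof.
have [s fs0] := partial_neq0; exists (ordS s).
exact: (derivation_exists_aux (erefl _) (erefl _) (erefl _) fs0).
Qed.

Variable Om : differentials K.
Local Notation dd := (diff_d Om).

Lemma ddD z w : dd (z + w) = dd z + dd w.
Proof. by have [h _ _] := diff_derivation Om; apply: h. Qed.

Lemma ddM z w : dd (z * w) = z *: dd w + w *: dd z.
Proof. by have [_ h _] := diff_derivation Om; apply: h. Qed.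

Lemma dd_const a : dd (k a) = 0.
Proof. by have [_ _ h] := diff_derivation Om; apply: h. Qed.

Lemma dd_div a b : b != 0 -> dd (a / b) = b ^- 2 *: (b *: dd a - a *: dd b).
Proof.
move=> b0; apply: (scalerI b0).
have -> : b *: dd (a / b) = dd a - (a / b) *: dd b.
  by have := ddM (a / b) b; rewrite mulfVK // => ->; rewrite addrAC subrr add0r.
rewrite scalerA expr2 invfM mulrA mulfV // mul1r scalerBr !scalerA mulVf // scale1r.
by rewrite [b^-1 * a]mulrC.
Qed.

(** The vectors (X_i) and (dX_i) are both orthogonal to the gradient (f_i), by Euler's relation and
    by df = 0. Their cross product is therefore proportional to the gradient, and [om] is the
    factor. *)
Lemma omega_exists : exists2 om : Om, om != 0 & forall l : 'I_3,
  let l1 := ordS l in let l2 := ordS l1 in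
  X l *: dd (X l1) - X l1 *: dd (X l) = fev f^`M(l2) *: om.
Proof.
have [s fs0] := partial_neq0; pose r := ordS s; pose c := ordS r.
have sr : s != r by rewrite eq_sym ordS_neq.
have rc : r != c by rewrite eq_sym ordS_neq.
have sc : s != c by rewrite eq_sym ordSS_neq.
have eE := partial_euler s; rewrite /= -/r -/c in eE.
have eD : fev f^`M(s) *: dd (X s) + fev f^`M(r) *: dd (X r) + fev f^`M(c) *: dd (X c) = 0.
  rewrite -(big_I3_distinct (fun i => fev f^`M(i) *: dd (X i)) sr rc sc).
  rewrite -(mpoly_chain_rule _ _ ddD ddM dd_const) (fev_curve hn hG).
  by have := dd_const 0; rewrite rmorph0.
have [fs fsE] : exists z, z = fev f^`M(s) by exists (fev f^`M(s)).
have [fr frE] : exists z, z = fev f^`M(r) by exists (fev f^`M(r)).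
have [fc fcE] : exists z, z = fev f^`M(c) by exists (fev f^`M(c)).
rewrite -fsE -frE -fcE in fs0 eE eD.
pose om := fs^-1 *: (X r *: dd (X c) - X c *: dd (X r)).
have eU : fs *: dd (X s) = - (fr *: dd (X r) + fc *: dd (X c)).
  by apply/eqP; rewrite -addr_eq0 addrA eD.
have h1 : X r *: dd (X c) - X c *: dd (X r) = fs *: om.
  by rewrite /om scalerA mulfV // scale1r.
have h2 : X s *: dd (X r) - X r *: dd (X s) = fc *: om.
  apply: (scalerI fs0); rewrite scalerA mulrC -scalerA -h1 !scalerBr.
  rewrite [fs *: (X r *: _)]scalerA mulrC -[(X r * fs) *: _]scalerA eU scalerN opprK scalerDr.
  rewrite !scalerA addrA -scalerDl addrC [fc * X r]mulrC; congr (_ + _).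
  rewrite -scaleNr; congr (_ *: _); apply/eqP; rewrite -subr_eq0 opprK -[X in _ == X]eE.
  by apply/eqP; ring.
have h3 : X c *: dd (X s) - X s *: dd (X c) = fr *: om.
  apply: (scalerI fs0); rewrite scalerA mulrC -scalerA -h1 !scalerBr.
  rewrite [fs *: (X c *: _)]scalerA mulrC -[(X c * fs) *: _]scalerA eU scalerN scalerDr.
  rewrite !scalerA opprD -addrA -opprD -scalerDl addrC [X c * fr]mulrC; congr (_ - _).
  rewrite -scaleNr; congr (_ *: _); apply/eqP; rewrite -subr_eq0 -[X in _ == X]oppr0 -[X in _ == -
    X]eE.
  by apply/eqP; ring.
have wedge (l : 'I_3) : let l1 := ordS l in let l2 := ordS l1 in
    X l *: dd (X l1) - X l1 *: dd (X l) = fev f^`M(l2) *: om.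
  have es : ordS c = s by rewrite /c /r ordS3.
  by have [->|->|->] := I3_distinct sr rc sc l; rewrite /= -/r -/c ?es -/r -?fsE -?frE -?fcE.
exists om => //; apply/eqP => om0.
have [l [D hD]] := derivation_exists.
have [phi hphi] := diff_factor Om hD; rewrite hphi dd_div //.
have := wedge l; rewrite /= om0 scaler0 => /(congr1 -%R); rewrite opprB oppr0 => ->.
by rewrite scaler0 linear0 eqxx.
Qed.

Section Omega.

Variable om : Om.
Hypothesis om0 : om != 0.
Hypothesis om_wedge : forall l : 'I_3,
  let l1 := ordS l in let l2 := ordS l1 in
  X l *: dd (X l1) - X l1 *: dd (X l) = fev f^`M(l2) *: om.

(** For a local parameter t at v one has dt = u [om] with v(u) equal to this value
    ([uniformizer_exists]), so z [om] has order v(z) minus it. This says that [om] has divisor (n -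
    2) H. *)
Definition canonical_val v : int := (n%:Z - 2) * mu v.
Local Notation W := canonical_val.

Lemma scale_om_inj a b : a *: om = b *: om -> a = b.
Proof.
move/eqP; rewrite -subr_eq0 -scalerBl scaler_eq0 (negbTE om0) orbF subr_eq0.
by move/eqP.
Qed.

Lemma dd_coord_ratio a b c : a != b -> b != c -> a != c ->
  exists2 e : K, e = 1 \/ e = -1 & dd (X a / X c) = (e * fev f^`M(b) / X c ^+ 2) *: om.
Proof.
move=> ab bc ac; rewrite dd_div //.
have [eac|eca] : a = ordS c \/ c = ordS a.
  move: ab bc ac; case: (I3_cases a) => ->; case: (I3_cases b) => -> //;
  case: (I3_cases c) => -> // _ _ _; rewrite ?ordSE; by [left|right].
  have eb : b = ordS a.
    move: ab bc ac; rewrite eac; case: (I3_cases c) => ->; case: (I3_cases b) => ->;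
    by rewrite ?ordSE.
  exists 1; first by left.
  by have := om_wedge c; rewrite /= -eac -eb => ->; rewrite scalerA mul1r mulrC.
have eb : b = ordS c.
  move: ab bc ac; rewrite eca; case: (I3_cases a) => ->; case: (I3_cases b) => ->;
  by rewrite ?ordSE.
exists (-1); first by right.
have := om_wedge a; rewrite /= -eca -eb => /(congr1 -%R); rewrite opprB => ->.
by rewrite scalerN scalerA mulN1r mulNr scaleNr mulrC.
Qed.

Definition regular_diff v (z : K) := val_ge v z 0 /\
  exists2 d, dd z = d *: om & val_ge v d (W v).

Lemma regular_diff_const v a : regular_diff v (k a).
Proof.
split; first exact: val_ge_const.
by exists 0; [rewrite dd_const scale0r|left].
Qed.

Lemma regular_diffD v z w : regular_diff v z -> regular_diff v w -> regular_diff v (z + w).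
Proof.
move=> [hz [d ed hd]] [hw [e ee he]]; split; first exact: val_geD.
by exists (d + e); [rewrite ddD ed ee scalerDl|apply: val_geD].
Qed.

Lemma regular_diffM v z w : regular_diff v z -> regular_diff v w -> regular_diff v (z * w).
Proof.
move=> [hz [d ed hd]] [hw [e ee he]]; split; first by rewrite -[0]addr0; apply: val_geM.
exists (z * e + w * d); first by rewrite ddM ed ee !scalerA scalerDl.
by apply: val_geD; rewrite -[W v]add0r; apply: val_geM.
Qed.

Lemma regular_diffV v z : z != 0 -> v z = 0 -> regular_diff v z -> regular_diff v z^-1.
Proof.
move=> z0 vz [_ [d ed hd]]; split; first by right; rewrite placeV vz oppr0.
exists (- (z ^- 2 * d)).
  rewrite -[z^-1]mul1r dd_div // -(rmorph1 k) dd_const scaler0 rmorph1 scale1r sub0r.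
  by rewrite ed scalerN scalerA scaleNr.
rewrite val_geN -[W v]add0r; apply: val_geM => //.
by right; rewrite placeV placeX vz mulr0 oppr0.
Qed.

Lemma centered_exists v : exists P : 'I_3 -> L,
  [/\ exists i, P i != 0, mev iL P f = 0 & centered iL v P].
Proof. exact: place_center. Qed.

(** Differentials of integral functions have no pole. The local ring is obtained from the ratios X_i
    / X_c by ring operations and inversion of units, which preserve [regular_diff], and d(X_i / X_c)
    is a partial derivative over X_c^2 times [om], up to sign. *)
Lemma integral_regular v z : val_ge v z 0 -> regular_diff v z.
Proof.
have [P [P0 Pf vP]] := centered_exists v.
move=> /(centered_integral hn hG curve_smooth separable_root P0 Pf vP).
move=> [d [A [B [hA hB PB ->]]]].
have [c Pc] := P0; have vc := centered_coord vP Pc.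
have hX i : regular_diff v (X i / X c).
  have [->|ic] := eqVneq i c; first by rewrite divff // -(rmorph1 k); apply: regular_diff_const.
  split; first by rewrite val_geMr ?invr_eq0 // placeV opprK add0r vc; right; apply: mu_le.
  have [b ib bc] : exists2 b : 'I_3, i != b & b != c.
    move: ic; case: (I3_cases i) => ->; case: (I3_cases c) => -> // _;
    by [exists 0|exists 1|exists 2].
  have [e he ->] := dd_coord_ratio ib bc ic; exists (e * fev f^`M(b) / X c ^+ 2) => //.
  rewrite val_geMr ?invr_eq0 ?expf_neq0 // placeV placeX vc.
  have -> : W v - - (2%:Z * mu v) = n%:Z * mu v by rewrite /W; ring.
  have hf : val_ge v (fev f^`M(b)) (n%:Z * mu v).
    exact: (val_form v (mderiv_homog b (curve_homog hn hG))).
  by case: he => ->; rewrite ?mul1r // mulN1r val_geN.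
have hA' A' : regular_diff v (mev k (fun i => X i / X c) A').
  elim/mpoly_ring_ind: A' => [a|i|A' B' hA' hB'|A' B' hA' hB'].
  - by rewrite mevC; apply: regular_diff_const.
  - by rewrite mevX.
  - by rewrite rmorphD; apply: regular_diffD.
  - by rewrite rmorphM; apply: regular_diffM.
have sc d' A' : A' \is d'.-homog -> fev A' = X c ^+ d' * mev k (fun i => X i / X c) A'.
  by move=> h; rewrite -mev_homog //; apply: eq_mev => i; rewrite mulrC mulfVK.
have B0 := fev_neq0 K hB Pf PB; have vB := vP _ _ hB PB.
move: B0 vB; rewrite (sc _ _ hA) (sc _ _ hB); set a := mev _ _ A; set b := mev _ _ B.
rewrite mulf_eq0 negb_or => /andP[h1 h2]; rewrite placeM // placeX vc => vb.
have -> : X c ^+ d * a / (X c ^+ d * b) = a * b^-1 by field; rewrite h1 h2.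
apply: regular_diffM; first exact: hA'.
apply: regular_diffV => //; first by lia.
exact: hA'.
Qed.

(** The parameter is the separable polynomial t evaluated at X_a / X_c. Since t' = -1, its
    differential is - d(X_a / X_c), which involves the partial derivative f_b, nonzero at the
    centre. *)
Lemma uniformizer_exists v : exists t u, [/\ v t = 1, dd t = u *: om, u != 0 & v u = W v].
Proof.
have [P [P0 Pf vP]] := centered_exists v.
have [a [b [c [ab bc ac Pc Pb]]]] := smooth_chart hn hG curve_smooth P0 Pf.
have [t [t0 t1]] := separable_root (P a / P c).
have vt := chart_uniformizer hn hG ab bc ac Pf Pc Pb vP t0 t1.
have dt (p : {poly F}) : dd (ev1 k (X a / X c) p) = ev1 k (X a / X c) p^`() *: dd (X a / X c).
  elim/poly_ind: p => [|p d IH]; first by rewrite deriv0 !rmorph0 -(rmorph0 k) dd_const rmorph0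
    scale0r.
  rewrite derivD derivM derivX derivC addr0 mulr1 !rmorphD !rmorphM /= ev1X ev1C.
  by rewrite ddD dd_const addr0 ddM IH scalerA addrC scalerDl [X in X *: _ + _]mulrC.
have [e he edx] := dd_coord_ratio ab bc ac.
have fb0 : fev f^`M(b) != 0 := fev_neq0 K (mderiv_homog b (curve_homog hn hG)) Pf Pb.
have vfb := vP _ _ (mderiv_homog b (curve_homog hn hG)) Pb.
have e0 : e != 0 by case: he => ->; rewrite ?oppr_eq0 oner_neq0.
have ve : v e = 0 by case: he => ->; rewrite ?placeN place1.
have Xc2 : X c ^+ 2 != 0 by rewrite expf_neq0.
exists (ev1 k (X a / X c) t), (- (e * fev f^`M(b) / X c ^+ 2)); split=> //.
- by rewrite dt t1 rmorphN rmorph1 edx scalerA mulN1r.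
- by rewrite oppr_eq0 !mulf_neq0 ?invr_eq0.
- rewrite placeN !placeM ?mulf_neq0 ?invr_eq0 // placeV placeX ve vfb (centered_coord vP Pc).
  by rewrite /W; ring.
Qed.

Lemma in_OmegaP (E : divisor K) (eta : Om) : in_Omega E eta <->
  exists2 z, eta = z *: om & forall v, val_ge v z (W v + E v).
Proof.
split=> [[->|h]|[z -> hz]].
- by exists 0; [rewrite scale0r|left].
- have hv v : exists2 z, eta = z *: om & val_ge v z (W v + E v).
    have [m [t [g [vt -> g0 vg]]] hm] := h v.
    have [_ [d ed hd]] : regular_diff v t by apply: integral_regular; right; rewrite vt.
    exists (g * d); first by rewrite ed scalerA.
    by rewrite addrC; apply: val_geM => //; right; rewrite vg.
  (* The coefficient z is read off at a place, so one place must be exhibited; a coordinate point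
     supplies it. At the other places the coefficient is the same because [om] is nonzero. *)
  have [||v0 _] := @point_has_place _ _ hn _ hG K _ _ curve_smooth separable_root
      (fun j => (j == 0)%:R).
  + by exists 0; rewrite eqxx oner_neq0.
  + exact: (mev_delta_curve hn).
  have [z ez _] := hv v0; exists z => // v.
  by have [w ew hw] := hv v; have -> : z = w by apply: scale_om_inj; rewrite -ez.
have [->|z0] := eqVneq z 0; first by left; rewrite scale0r.
right=> v; have [t [u [vt et u0 vu]]] := uniformizer_exists v.
exists (v (z / u)).
  exists t, (z / u); split=> //; last by rewrite mulf_neq0 ?invr_eq0.
  by rewrite et scalerA mulfVK.
by have := hz v; rewrite val_ge_neq0 // placeM ?invr_eq0 // placeV vu; lia.
Qed.

End Omega.
End Differentials.

(** * Places at rational points and residues *)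

Section RationalPlaces.

Variables (F : fieldType) (n : nat) (hn : (3 <= n)%N).
Variables (G : {mpoly F[3]}) (hG : G \is (n - 2)%N.-homog).
Local Notation f := (curve_poly n G).
Variable K : function_field f.
Local Notation k := (ff_const K).
Local Notation X := (gen_coord K).
Local Notation fev := (mev k X).
Variables (L : closedFieldType) (iL : {rmorphism F -> L}).
Hypothesis curve_smooth : forall P : 'I_3 -> L, (exists i, P i != 0) ->
  mev iL P f = 0 -> exists s, mev iL P f^`M(s) != 0.
Hypothesis separable_root : forall x : L, exists t : {poly F},
  ev1 iL x t = 0 /\ t^`() = -1.

Implicit Types (v : place K) (A B : {mpoly F[3]}) (P : 'rV[F]_3).

Let X0 i : X i != 0. Proof. exact: (gen_coord_neq0 hn hG). Qed.

Definition geometric P (i : 'I_3) : L := iL (P 0 i).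

Lemma mev_geometric P A : mev iL (geometric P) A = iL A.@[P 0].
Proof. by rewrite meval_mev; apply/esym/(@mev_comp F F L idfun iL iL). Qed.

Lemma geometric_neq0 P : P != 0 -> exists i, geometric P i != 0.
Proof.
move=> P0; suff [i Pi] : exists i, P 0 i != 0 by exists i; rewrite fmorph_eq0.
apply: contrapT => h; case/eqP: P0; apply/rowP => i; rewrite mxE.
by apply/eqP/negPn/negP => Pi; apply: h; exists i.
Qed.

Lemma geometric_curve P : on_curve f P -> mev iL (geometric P) f = 0.
Proof. by case=> _ e; rewrite mev_geometric e rmorph0. Qed.

Lemma val_ge_ratio v d A B : fev B != 0 -> v (fev B) = d ->
  forall c, val_ge v (fev A / fev B) c <-> val_ge v (fev A) (d + c).
Proof.
by move=> B0 vB c; rewrite val_geMr ?invr_eq0 // placeV opprK vB addrC.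
Qed.

(** A domination condition on ratios of forms is turned into a condition on each form by comparison
    with powers of a coordinate X_c not vanishing at P. *)
Lemma place_atP v P : on_curve f P -> place_at v P <-> centered iL v (geometric P).
Proof.
move=> hP; have P0 := geometric_neq0 (proj1 hP); have Pf := geometric_curve hP.
split=> [vP d A hA|vP e A B hA hB PB].
  rewrite mev_geometric fmorph_eq0 => PA.
  have [c] := P0; rewrite fmorph_eq0 => Pc.
  have PX d' : ('X_c ^+ d').@[P 0] != 0.
    by rewrite meval_mev rmorphXn /= mevX expf_neq0.
  have fX d' : fev ('X_c ^+ d') = X c ^+ d' by rewrite rmorphXn /= mevX.
  have A0 : fev A != 0 by apply: (fev_neq0 K hA Pf); rewrite mev_geometric fmorph_eq0.
  have Xc0 d' : X c ^+ d' != 0 by rewrite expf_neq0.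
  have vc : v (X c) = mu v.
    apply/eqP; rewrite eq_le mu_le andbT /mu !le_min.
    have h i : v (X c) <= v (X i).
      have [+ _] := vP 1%N 'X_i ('X_c ^+ 1) (varX_homog F i) (varXn_homog F c 1) (PX 1%N).
      rewrite !form_at_genE mevX fX expr1 val_geMr ?invr_eq0 // placeV opprK add0r.
      by rewrite val_ge_neq0.
    by rewrite !h.
  (* A / X_c^d and its inverse are both integral, so A has exactly the value of X_c^d. *)
  have [h1 _] := vP d A ('X_c ^+ d) hA (varXn_homog F c d) (PX d).
  have [h2 _] := vP d ('X_c ^+ d) A (varXn_homog F c d) hA PA.
  move: h1 h2; rewrite !form_at_genE fX !val_geMr ?invr_eq0 // !placeV !opprK !add0r.
  rewrite !val_ge_neq0 // placeX vc => h1 h2.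
  by apply/eqP; rewrite eq_le h1 h2.
rewrite !form_at_genE.
have PB' : mev iL (geometric P) B != 0 by rewrite mev_geometric fmorph_eq0.
have B0 := fev_neq0 K hB Pf PB'; have vB := vP _ _ hB PB'.
rewrite !(val_ge_ratio A B0 vB) addr0; split; first exact: val_form.
move=> PA; apply: (centered_dominates hn hG curve_smooth separable_root P0 Pf vP hA).
by rewrite mev_geometric PA rmorph0.
Qed.

Lemma place_at_exists P : on_curve f P -> exists v, place_at v P.
Proof.
move=> hP; have P0 := geometric_neq0 (proj1 hP); have Pf := geometric_curve hP.
have [v vP] := point_has_place hn hG K curve_smooth separable_root P0 Pf.
by exists v; apply/place_atP.
Qed.

Lemma place_at_unique v v' P : on_curve f P -> place_at v P -> place_at v' P ->
  forall z, v z = v' z.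
Proof.
move=> hP; have P0 := geometric_neq0 (proj1 hP); have Pf := geometric_curve hP.
move=> /(place_atP _ hP) h /(place_atP _ hP) h'.
exact: (place_unique hn hG curve_smooth separable_root P0 Pf h h').
Qed.

Lemma place_at_coord v P c : on_curve f P -> place_at v P -> P 0 c != 0 -> v (X c) = mu v.
Proof.
by move=> hP /(place_atP _ hP) vP Pc; apply: (centered_coord vP); rewrite fmorph_eq0.
Qed.

Lemma place_at_form v P d A : on_curve f P -> place_at v P -> A \is d.-homog ->
  A.@[P 0] != 0 -> v (fev A) = d%:Z * mu v.
Proof.
by move=> hP /(place_atP _ hP) vP hA PA; apply: vP; rewrite // mev_geometric fmorph_eq0.
Qed.

Lemma place_at_form_pos v P d A : on_curve f P -> place_at v P -> A \is d.-homog ->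
  A.@[P 0] = 0 -> val_ge v (fev A) (d%:Z * mu v + 1).
Proof.
move=> hP /(place_atP _ hP) vP hA PA.
apply: (centered_dominates hn hG curve_smooth separable_root _ _ vP hA).
- exact: geometric_neq0 (proj1 hP).
- exact: geometric_curve.
- by rewrite mev_geometric PA rmorph0.
Qed.

Lemma place_at_minor v P i c : on_curve f P -> place_at v P ->
  val_ge v (k (P 0 c) * X i - k (P 0 i) * X c) (mu v + 1).
Proof.
move=> hP vP.
have hA : P 0 c *: 'X_i - P 0 i *: 'X_c \is 1.-homog.
  by apply: rpredB; apply: rpredZ; apply: varX_homog.
have PA : (P 0 c *: 'X_i - P 0 i *: 'X_c).@[P 0] = 0.
  by rewrite raddfB /= !mevalZ !mevalXU mulrC subrr.
by have := place_at_form_pos hP vP hA PA; rewrite raddfB /= !mevZ !mevX mul1r.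
Qed.

Lemma place_at_same v P P' : on_curve f P -> on_curve f P' ->
  place_at v P -> place_at v P' -> same_point P P'.
Proof.
move=> hP hP' vP vP'; have [c] := geometric_neq0 (proj1 hP); rewrite fmorph_eq0 => Pc.
have e i : P 0 c * P' 0 i = P 0 i * P' 0 c.
  apply/eqP; rewrite -subr_eq0; apply/negPn/negP => ne.
  have hA : P 0 c *: 'X_i - P 0 i *: 'X_c \is 1.-homog.
    by apply: rpredB; apply: rpredZ; apply: varX_homog.
  have PA : (P 0 c *: 'X_i - P 0 i *: 'X_c).@[P 0] = 0.
    by rewrite raddfB /= !mevalZ !mevalXU mulrC subrr.
  have h1 := place_at_form_pos hP vP hA PA; have h2 := place_at_form hP' vP' hA.
  rewrite raddfB /= !mevalZ !mevalXU in h2; have {}h2 := h2 ne.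
  case: h1 => [e|]; last by rewrite h2 mul1r; lia.
  have : mev iL (geometric P') (P 0 c *: 'X_i - P 0 i *: 'X_c) != 0.
    by rewrite mev_geometric fmorph_eq0 raddfB /= !mevalZ !mevalXU.
  by move/(fev_neq0 K hA (geometric_curve hP')); rewrite e eqxx.
have P'c : P' 0 c != 0.
  apply/negP => /eqP P'c; case: hP' => /eqP + _; apply; apply/rowP => i; rewrite mxE.
  by apply: (mulfI Pc); rewrite e P'c !mulr0.
exists (P 0 c / P' 0 c); first by rewrite mulf_neq0 ?invr_eq0.
by apply/rowP => i; rewrite mxE mulrAC e mulfK.
Qed.

(** The residue field at a rational point is F: a fraction A / B regular at P has the value A(P) /
    B(P). *)
Lemma rational_value v P z : on_curve f P -> place_at v P -> val_ge v z 0 ->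
  exists c, val_ge v (z - k c) 1.
Proof.
move=> hP vP0; have vP := vP0; move/(place_atP _ hP): vP.
have P0 := geometric_neq0 (proj1 hP); have Pf := geometric_curve hP.
move=> vP /(centered_integral hn hG curve_smooth separable_root P0 Pf vP).
move=> [d [A [B [hA hB PB ->]]]]; have B0 := fev_neq0 K hB Pf PB.
rewrite mev_geometric fmorph_eq0 in PB.
exists (A.@[P 0] / B.@[P 0]).
have -> : fev A / fev B - k (A.@[P 0] / B.@[P 0])
    = fev (A - (A.@[P 0] / B.@[P 0]) *: B) / fev B.
  by rewrite raddfB /= mevZ mulrBl mulfK.
rewrite val_geMr ?invr_eq0 // placeV opprK (place_at_form hP vP0 hB PB) [1 + _]addrC.
apply: (place_at_form_pos hP vP0); first by apply: rpredB => //; apply: rpredZ.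
by rewrite raddfB /= mevalZ mulfVK // subrr.
Qed.

Lemma const_small v c : val_ge v (k c) 1 -> c = 0.
Proof.
move=> h; apply/eqP/negPn/negP => c0; move: h.
by rewrite val_ge_neq0 ?fmorph_eq0 // place_const.
Qed.

(* Otherwise every regular function would be constant modulo the square of the
   maximal ideal of P. *)
Lemma transversal_line v P c : on_curve f P -> place_at v P -> P 0 c != 0 ->
  exists i, v (k (P 0 c) * X i - k (P 0 i) * X c) = mu v + 1 /\
            k (P 0 c) * X i - k (P 0 i) * X c != 0.
Proof.
move=> hP vP Pc; apply: contrapT => no.
have vc := place_at_coord hP vP Pc.
have h2 i : val_ge v (X i / X c - k (P 0 i / P 0 c)) 2.
  have -> : X i / X c - k (P 0 i / P 0 c) =
      (k (P 0 c) * X i - k (P 0 i) * X c) * (X c)^-1 * k (P 0 c)^-1.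
    rewrite !rmorphM !fmorphV; field.
    by rewrite X0 ?fmorph_eq0 Pc.
  rewrite -[2]addr0; apply: val_geM; last exact: val_ge_const.
  rewrite val_geMr ?invr_eq0 // placeV opprK vc.
  have := place_at_minor i c hP vP => -[->|h]; first exact: val_ge0.
  have [->|nz] := eqVneq (k (P 0 c) * X i - k (P 0 i) * X c) 0; first exact: val_ge0.
  right; have [e|ne] := eqVneq (v (k (P 0 c) * X i - k (P 0 i) * X c)) (mu v + 1).
    by case: no; exists i.
  by lia.
pose S z := exists a, val_ge v (z - k a) 2.
have S_int z a : val_ge v (z - k a) 2 -> val_ge v z 0.
  move=> h; rewrite -[z](subrK (k a)); apply: val_geD; last exact: val_ge_const.
  exact: val_ge_le h.
have SA A : S (mev k (fun i => X i / X c) A).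
  elim/mpoly_ring_ind: A => [a|i|A B [a ha] [b hb]|A B [a ha] [b hb]].
  - by exists a; rewrite mevC subrr; left.
  - by exists (P 0 i / P 0 c); rewrite mevX.
  - exists (a + b); rewrite !rmorphD /= opprD addrACA; exact: val_geD.
  - exists (a * b); rewrite !rmorphM /=.
    set z := mev _ _ A in ha *; set w := mev _ _ B in hb *.
    have -> : z * w - k a * k b = (z - k a) * w + k a * (w - k b) by ring.
    apply: val_geD; last exact: val_geZ.
    by rewrite -[2]addr0; apply: val_geM => //; apply: S_int hb.
have small d A : A \is d.-homog -> A.@[P 0] = 0 -> val_ge v (fev A) (d%:Z * mu v + 2).
  move=> hA PA; have [a ha] := SA A.
  have eA : fev A = X c ^+ d * mev k (fun i => X i / X c) A.
    by rewrite -mev_homog //; apply: eq_mev => i; rewrite mulrC mulfVK.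
  have Xd : X c ^+ d != 0 by rewrite expf_neq0.
  have := place_at_form_pos hP vP hA PA; rewrite eA mulrC val_geMr // placeX vc => h.
  have a0 : a = 0.
    apply: (@const_small v); rewrite -[k a](subKr (mev k (fun i => X i / X c) A)).
    apply: val_geB; last exact: val_ge_le ha.
    by apply: val_ge_le h; lia.
  rewrite val_geMr // placeX vc; move: ha; rewrite a0 rmorph0 subr0.
  by apply: val_ge_le; lia.
have [t vt] := place_normalized v.
have t0 : t != 0 by apply: contraPneq vt => ->; rewrite place0.
have t_int : val_ge v t 0 by right; rewrite vt.
have P0 := geometric_neq0 (proj1 hP); have Pf := geometric_curve hP.
have vP' := vP; move/(place_atP _ hP): vP' => vP'.
have [d [A [B [hA hB PB e]]]] :=
  centered_integral hn hG curve_smooth separable_root P0 Pf vP' t_int.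
have B0 := fev_neq0 K hB Pf PB; have vB := vP' _ _ hB PB.
have A0 : fev A != 0 by apply: contraNneq t0 => A0; rewrite e A0 mul0r.
have := vt; rewrite e placeM ?invr_eq0 // placeV vB => vA.
have [PA|PA] := eqVneq A.@[P 0] 0.
  by have := small _ _ hA PA; rewrite val_ge_neq0 //; lia.
by have := place_at_form hP vP hA PA; lia.
Qed.

Section Residue.

Variables (Om : differentials K) (om : Om).
Hypothesis om0 : om != 0.
Hypothesis om_wedge : forall l : 'I_3,
  let l1 := ordS l in let l2 := ordS l1 in
  X l *: diff_d Om (X l1) - X l1 *: diff_d Om (X l) = fev f^`M(l2) *: om.
Local Notation W := canonical_val.

(** A nonzero coefficient of index l >= 1 would produce a pole of order l + 1 >= 2, and the highest
    one cannot be cancelled. *)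
Lemma principal_part_simple v t (a : seq F) : v t = 1 ->
  val_ge v (\sum_(l < size a) k a`_l * t ^- l.+1) (-1) ->
  \sum_(l < size a) k a`_l * t ^- l.+1 = k a`_0 * t^-1.
Proof.
move=> vt; have t0 : t != 0 by apply: contraPneq vt => ->; rewrite place0.
suff h m : val_ge v (\sum_(l < m.+1) k a`_l * t ^- l.+1) (-1) ->
    \sum_(l < m.+1) k a`_l * t ^- l.+1 = k a`_0 * t^-1.
  case e: (size a) => [|m]; last exact: h.
  by rewrite big_ord0 nth_default ?e // rmorph0 mul0r.
elim: m => [|m IH]; first by rewrite big_ord_recr big_ord0 /= add0r expr1.
rewrite big_ord_recr /=; have [->|am] := eqVneq a`_m.+1 0.
  by rewrite rmorph0 mul0r addr0.
have tm : k a`_m.+1 * t ^- m.+2 != 0 by rewrite mulf_neq0 ?fmorph_eq0 // invr_eq0 expf_neq0.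
have vtm : v (k a`_m.+1 * t ^- m.+2) = - m.+2%:Z.
  by rewrite placeM ?fmorph_eq0 ?invr_eq0 ?expf_neq0 // place_const // placeV placeX vt; lia.
rewrite addrC; set S := \sum_(l < m.+1) _.
have hS : val_ge v S (v (k a`_m.+1 * t ^- m.+2) + 1).
  apply: val_ge_sum => l _; apply: val_geZ; right; rewrite placeV placeX vt vtm.
  by have := ltn_ord l; lia.
have [s0 vs] := place_addl tm hS; rewrite val_ge_neq0 // vs vtm; lia.
Qed.

(** With dt = u [om] the factor is [kap] = t / u. Another parameter t' = w t has dt' / t' = dt / t +
    dw / w, and dw / w is regular; at a simple pole the residue is therefore the same for all
    parameters. *)
Lemma residue_atP v P : on_curve f P -> place_at v P ->
  exists kap, [/\ kap != 0, v kap = 1 - W v &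
    forall z c, val_ge v z (W v - 1) ->
      (residue_at P (z *: om) c <-> val_ge v (z * kap - k c) 1)].
Proof.
move=> hP vP.
have [t [u [vt et u0 vu]]] := uniformizer_exists hn hG curve_smooth separable_root om_wedge v.
have t0 : t != 0 by apply: contraPneq vt => ->; rewrite place0.
exists (t / u); split.
- by rewrite mulf_neq0 ?invr_eq0.
- by rewrite placeM ?invr_eq0 // placeV vt vu.
move=> z c hz; split; last first.
  move=> h; exists v, t, (z / u), [:: c]; split=> //.
    by rewrite et scalerA mulfVK.
  rewrite big_ord_recl big_ord0 addr0 /= expr1.
  have -> : z / u - k c / t = (z * (t / u) - k c) * t^-1 by field; rewrite u0 t0.
  by rewrite val_geMr ?invr_eq0 // placeV vt; apply: val_ge_le h.
move=> [v' [t' [g [a [vP' vt' ez hg ->]]]]].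
have vv' := place_at_unique hP vP vP'.
have vg x e : val_ge v' x e -> val_ge v x e by case=> [->|h]; [left|right; rewrite vv'].
rewrite -vv' in vt'; move/vg: hg => {vg} hg.
have t'0 : t' != 0 by apply: contraPneq vt' => ->; rewrite place0.
pose w := t' / t.
have w0 : w != 0 by rewrite mulf_neq0 ?invr_eq0.
have vw : v w = 0 by rewrite placeM ?invr_eq0 // placeV vt vt' subrr.
have [|_ [d ed hd]] := @integral_regular _ _ hn _ hG K _ iL curve_smooth separable_root
  Om om om0 om_wedge v w; first by right; rewrite vw.
have et' : diff_d Om t' = (w * u + t * d) *: om.
  have -> : t' = w * t by rewrite mulfVK.
  by rewrite ddM et ed !scalerA scalerDl.
have {ez} : z = g * (w * u + t * d).
  by apply: (scale_om_inj om0); rewrite ez et' scalerA.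
set D := w * u + t * d => ez.
have [D0 vD] : D != 0 /\ v D = W v.
  have wu : w * u != 0 by rewrite mulf_neq0.
  have vwu : v (w * u) = W v by rewrite placeM // vw vu add0r.
  have htd : val_ge v (t * d) (v (w * u) + 1).
    by rewrite vwu addrC; apply: val_geM => //; right; rewrite vt.
  by have [h1 h2] := place_addl wu htd; rewrite -vwu.
have hg1 : val_ge v g (-1).
  by have := hz; rewrite ez val_geMr // vD; apply: val_ge_le; lia.
have hs : val_ge v (\sum_(l < size a) k a`_l * t' ^- l.+1) (-1).
  rewrite -[X in val_ge v X](subKr g); apply: val_geB => //.
  exact: val_ge_le hg.
rewrite (principal_part_simple vt' hs) in hg.
have h1 : val_ge v (g * t' - k a`_0) 1.
  have -> : g * t' - k a`_0 = (g - k a`_0 / t') * t' by field.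
  by rewrite val_geMr // vt'.
(* The last term carries the contribution of dw. It has positive value, since g t' is integral and d
   [om] = dw is regular. *)
have -> : z * (t / u) - k a`_0 = (g * t' - k a`_0) + (g * t' * (t * d)) / (w * u).
  by rewrite ez /D /w; field; rewrite t'0 u0 t0.
have wu0 : w * u != 0 by rewrite mulf_neq0.
apply: val_geD => //; rewrite (val_geMr v _ _ (invr_neq0 wu0)) placeV placeM // vw vu.
have -> : 1 - - (0 + W v) = 0 + (1 + W v) by lia.
apply: val_geM.
  apply: (@val_ge_le _ _ _ v _ (-1 + 1)) => //.
  by apply: val_geM => //; right; rewrite vt'.
by apply: val_geM => //; right; rewrite vt.
Qed.

End Residue.

End RationalPlaces.

(** * Dimensions of subspaces of the function field *)

Lemma vspace_of_pred (F : fieldType) (V : vectType F) (P : V -> Prop) : P 0 ->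
  (forall a x y, P x -> P y -> P (a *: x + y)) ->
  exists U : {vspace V}, forall x, x \in U <-> P x.
Proof.
move=> P0 PD.
pose S d := `[< exists U : {vspace V}, (forall x, x \in U -> P x) /\ \dim U = d >].
have exS : exists d, S d.
  exists 0%N; apply/asboolP; exists 0%VS; split; last exact: dimv0.
  by move=> x; rewrite memv0 => /eqP ->.
have bS d : S d -> (d <= \dim {:V})%N.
  by move=> /asboolP [U [_ <-]]; apply/dimvS/subvf.
(* Among the subspaces contained in [P], one of largest dimension is all of [P]: otherwise a further
   vector would enlarge it. *)
have [d /asboolP [U [hU dU]] maxd] := ex_maxnP exS bS.
exists U => x; split; first exact: hU.
move=> Px; apply/negPn/negP => xU.
have : S (\dim (U + <[x]>)%VS).
  apply/asboolP; exists (U + <[x]>)%VS; split=> // y /memv_addP [u uU [w /vlineP [a ->] ->]].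
  by rewrite addrC; apply: PD => //; apply: hU.
move/maxd; rewrite -dU leqNgt => /negP; apply.
rewrite ltn_neqAle dimvS ?addvSl // andbT; apply/negP => /eqP e.
case/negP: xU; have /eqP -> : U == (U + <[x]>)%VS by rewrite eqEdim addvSl e leqnn.
by rewrite memvE addvSr.
Qed.

Section Dimension.

Variables (F K : fieldType) (k : {rmorphism F -> K}).
Implicit Types (U : K -> Prop).

Definition free_family (J : finType) (u : J -> K) : Prop :=
  forall c : J -> F, \sum_i k (c i) * u i = 0 -> forall i, c i = 0.

(** Subspaces of K are predicates, because K has infinite dimension over F. Lower and upper bounds
    for the dimension are kept apart, since each argument yields only one of them. *)
Definition dimge U (r : nat) : Prop :=
  exists u : 'I_r -> K, (forall i, U (u i)) /\ free_family u.

Definition dimle U (r : nat) : Prop := forall s, dimge U s -> (s <= r)%N.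

Definition subspace U : Prop :=
  U 0 /\ forall a b x y, U x -> U y -> U (k a * x + k b * y).

Lemma subspace_sum U (J : finType) (c : J -> F) (u : J -> K) : subspace U ->
  (forall i, U (u i)) -> U (\sum_i k (c i) * u i).
Proof.
move=> [U0 UD] Uu; apply: big_ind => // [x y Ux Uy|i _].
  by have := UD 1 1 _ _ Ux Uy; rewrite rmorph1 !mul1r.
by have := UD (c i) 0 _ _ (Uu i) U0; rewrite mulr0 addr0.
Qed.

Lemma free_family_reindex (J J' : finType) (h : J' -> J) (u : J -> K) :
  injective h -> free_family u -> free_family (u \o h).
Proof.
move=> hi fu c; pose c' j := if [pick i | h i == j] is Some i then c i else 0.
have ch i : c' (h i) = c i.
  rewrite /c'; case: pickP => [i' /eqP /hi -> //|/(_ i)].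
  by rewrite eqxx.
move=> e i; rewrite -ch; apply: fu; rewrite -[RHS]e.
rewrite (bigID (mem (h @: setT))) /= [X in _ + X]big1 ?addr0 => [|j nj].
  rewrite big_imset => [|i1 i2 _ _ /hi //].
  by apply: eq_big => [i'|i' _]; rewrite ?inE ?ch.
rewrite /c'; case: pickP => [i' /eqP ej|_]; last by rewrite rmorph0 mul0r.
by case/negP: nj; rewrite -ej imset_f.
Qed.

Lemma dimge_fin U (J : finType) (u : J -> K) :
  (forall i, U (u i)) -> free_family u -> dimge U #|J|.
Proof.
move=> Uu fu; exists (u \o enum_val); split=> [i|]; first exact: Uu.
exact: free_family_reindex enum_val_inj fu.
Qed.

Lemma dimge_leq U r s : (s <= r)%N -> dimge U r -> dimge U s.
Proof.
move=> sr [u [Uu fu]]; exists (u \o widen_ord sr); split=> [i|]; first exact: Uu.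
by apply: free_family_reindex fu => i j /(congr1 val) /= e; apply: val_inj.
Qed.

Lemma dimge_sub U U' r : (forall x, U x -> U' x) -> dimge U r -> dimge U' r.
Proof. by move=> h [u [Uu fu]]; exists u; split=> // i; apply: h. Qed.

Lemma dimle_sub U U' r : (forall x, U x -> U' x) -> dimle U' r -> dimle U r.
Proof. by move=> h h' s /(dimge_sub h) /h'. Qed.

Lemma dimge_mul U r x : x != 0 -> dimge U r -> dimge (fun z => exists2 w, U w & z = x * w) r.
Proof.
move=> x0 [u [Uu fu]]; exists (fun i => x * u i); split=> [i|c e]; first by exists (u i).
apply: fu; apply: (mulfI x0); rewrite mulr0 -[RHS]e mulr_sumr.
by apply: eq_bigr => i _; rewrite mulrCA.
Qed.

Lemma dimge_ext U U' x r : subspace U -> (forall z, U z -> U' z) -> U' x -> ~ U x ->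
  dimge U r -> dimge U' r.+1.
Proof.
move=> sU UU' U'x nUx [u [Uu fu]].
exists (fun i => if unlift ord_max i is Some j then u j else x); split=> [i|c e].
  by case: unlift => // j; apply/UU'/Uu.
move: e; rewrite big_ord_recr /= unlift_none => e.
have {}e : \sum_i k (c (lift ord_max i)) * u i + k (c ord_max) * x = 0.
  rewrite -[RHS]e; congr (_ + _); apply: eq_bigr => i _.
  have -> : widen_ord (leqnSn r) i = lift ord_max i.
    by apply: val_inj; rewrite [RHS]lift_max.
  by rewrite liftK.
have c0 : c ord_max = 0.
  apply/eqP/negPn/negP => c0; apply: nUx.
  have -> : x = k (- (c ord_max)^-1) * (\sum_i k (c (lift ord_max i)) * u i) + k 0 * 0.
    move/eqP: e; rewrite addr_eq0 => /eqP ->.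
    by rewrite rmorphN mulNr mulrN opprK mulrA -rmorphM mulVf // rmorph1 mul1r mulr0 addr0.
  by case: (sU) => U0 UD; apply: UD => //; apply: subspace_sum.
move: e; rewrite c0 rmorph0 mul0r addr0 => /fu h i.
by case: (unliftP ord_max i) => [j ->|->].
Qed.

(** The hypothesis on pairs says that U' meets U in codimension at most 1. One basis vector outside
    U' is used to correct all the others. *)
Lemma dimge_codim1 U U' r : subspace U' ->
  (forall x y, U x -> U y -> exists a b, (a != 0) || (b != 0) /\ U' (k a * x + k b * y)) ->
  dimge U r.+1 -> dimge U' r.
Proof.
move=> sU' rel [u [Uu fu]].
have [all|/existsNP [i0 ni0]] := pselect (forall i, U' (u i)).
  by apply: (@dimge_leq _ r.+1) => //; exists u.
have [U'0 U'D] := sU'.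
have /choice [b hb] : forall j : 'I_r, exists b, U' (u (lift i0 j) + k b * u i0).
  move=> j; have [a [b [ab h]]] := rel _ _ (Uu (lift i0 j)) (Uu i0).
  have a0 : a != 0.
    apply/eqP => a0; rewrite a0 eqxx /= in ab; apply: ni0.
    have := U'D b^-1 0 _ _ h U'0; rewrite a0 rmorph0 mul0r add0r mulr0 addr0 mulrA -rmorphM.
    by rewrite mulVf // rmorph1 mul1r.
  exists (b / a); have := U'D a^-1 0 _ _ h U'0; rewrite mulr0 addr0 mulrDr !mulrA -!rmorphM.
  by rewrite mulVf // rmorph1 mul1r [b / a]mulrC.
exists (fun j => u (lift i0 j) + k (b j) * u i0); split=> // c e j.
pose c' i := if unlift i0 i is Some j then c j else \sum_j c j * b j.
have : \sum_i k (c' i) * u i = 0.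
  rewrite (bigD1_ord i0) //= /c' unlift_none rmorph_sum mulr_suml -big_split -[RHS]e /=.
  by apply: eq_bigr => j' _; rewrite liftK rmorphM /=; ring.
by move/fu/(_ (lift i0 j)); rewrite /c' liftK.
Qed.

Lemma dimle_codim1 U U' r : subspace U' ->
  (forall x y, U x -> U y -> exists a b, (a != 0) || (b != 0) /\ U' (k a * x + k b * y)) ->
  dimle U' r -> dimle U r.+1.
Proof. by move=> sU' rel h [//|s] /(dimge_codim1 sU' rel) /h. Qed.

Lemma dim_intersection U U1 U2 r1 r2 r : subspace U1 -> subspace U2 ->
  (forall z, U1 z -> U z) -> (forall z, U2 z -> U z) ->
  dimge U1 r1 -> dimge U2 r2 -> dimle U r -> (r < r1 + r2)%N ->
  exists z, [/\ z != 0, U1 z & U2 z].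
Proof.
move=> s1 s2 U1U U2U [u1 [Uu1 f1]] [u2 [Uu2 f2]] hr lt; apply: contrapT => no.
suff : dimge U (r1 + r2) by move/hr; rewrite leqNgt lt.
exists (fun i => match split i with inl j => u1 j | inr j => u2 j end); split=> [i|c].
  by case: (split i) => j; [apply: U1U|apply: U2U].
rewrite big_split_ord /=.
under eq_bigr => i _ do rewrite (unsplitK (inl i)).
under [X in _ + X]eq_bigr => i _ do rewrite (unsplitK (inr i)).
set z := \sum_(i < r1) _ => e.
have U1z : U1 z by apply: subspace_sum.
have ez : z = k (-1) * (\sum_(i < r2) k (c (rshift r1 i)) * u2 i) + k 0 * 0.
  by rewrite mulr0 addr0 rmorphN rmorph1 mulN1r; apply/eqP; rewrite -addr_eq0 e.
have U2z : U2 z by rewrite ez; apply: (proj2 s2); [apply: subspace_sum|case: s2].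
have z0 : z = 0 by apply/eqP/negPn/negP => z0; apply: no; exists z.
have c1 := f1 _ z0.
have c2 : forall i, c (rshift r1 i) = 0 by apply: f2; rewrite -[RHS]e z0 add0r.
by move=> i; rewrite -[i]splitK; case: (split i) => j /=; [apply: c1|apply: c2].
Qed.

Section Image.

Variables (V : vectType F) (e : V -> K) (W : {vspace V}).
Hypothesis eD : forall a x y, e (a *: x + y) = k a * e x + e y.
Hypothesis eW : forall x, x \in W <-> e x = 0.

Let e0 : e 0 = 0. Proof. by apply/eW; apply: mem0v. Qed.

Let e_sum (I : Type) (r : seq I) (c : I -> F) (x : I -> V) :
  e (\sum_(i <- r) c i *: x i) = \sum_(i <- r) k (c i) * e (x i).
Proof.
by elim: r => [|i r IH]; rewrite ?big_nil ?e0 // !big_cons eD IH.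
Qed.

Lemma dimge_image : dimge (fun z => exists x, z = e x) (\dim {:V} - \dim W).
Proof.
have dC : (\dim {:V} - \dim W = \dim W^C)%N by rewrite -[in LHS](dimv_compl W); rewrite ?addKn.
rewrite dC; exists (fun i => e (vbasis W^C)`_i); split=> [i|c e1]; first by eexists.
have /freeP fb := basis_free (vbasisP W^C); apply: fb.
apply/eqP; rewrite -memv0 -(capv_compl W) memv_cap; apply/andP; split.
  by apply/eW; rewrite e_sum.
by apply: memv_suml => i _; apply/rpredZ/vbasis_mem/mem_nth; rewrite size_tuple.
Qed.

Lemma dimle_image : dimle (fun z => exists x, z = e x) (\dim {:V} - \dim W).
Proof.
move=> s [u [/choice [x hx] fu]].
pose Y := [tuple x i | i < s].
have Yi (i : 'I_s) : Y`_i = x i by rewrite -tnth_nth tnth_mktuple.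
have fY : free Y.
  apply/freeP => c ec; apply: fu; rewrite -[RHS]e0 -[in RHS]ec e_sum.
  by apply: eq_bigr => i _; rewrite Yi hx.
have cap : (<<Y>> :&: W = 0)%VS.
  apply/eqP; rewrite -subv0; apply/subvP => y; rewrite memv_cap memv0 => /andP[yY /eW ey].
  rewrite (coord_span yY); apply/eqP; apply: big1 => i _.
  suff -> : coord Y i y = 0 by rewrite scale0r.
  move: i; apply: fu; rewrite -[RHS]ey [in RHS](coord_span yY) e_sum.
  by apply: eq_bigr => i _; rewrite Yi hx.
have := dimvS (subvf (<<Y>> + W)%VS); rewrite dimv_disjoint_sum //.
by move: fY; rewrite /free size_tuple => /eqP ->; lia.
Qed.

End Image.

End Dimension.

(** * Dimensions of spaces of forms on the curve *)

Section CurveDimensions.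

Variables (F : fieldType) (n : nat) (hn : (3 <= n)%N).
Variables (G : {mpoly F[3]}) (hG : G \is (n - 2)%N.-homog).
Local Notation f := (curve_poly n G).
Variable K : function_field f.
Local Notation k := (ff_const K).
Local Notation X := (gen_coord K).
Local Notation fev := (mev k X).

Definition curve_mul d (B : dhomog 3 F d) : dhomog 3 F (n.+1 + d) :=
  DHomog (dhomogM (curve_homog hn hG) (dhomog_is_dhomog B)).

Fact curve_mul_is_linear d : linear (@curve_mul d).
Proof. by move=> a A B; apply: val_inj; rewrite /= mulrDr scalerAr. Qed.
HB.instance Definition _ d :=
  GRing.isLinear.Build F (dhomog 3 F d) (dhomog 3 F (n.+1 + d)) _ (@curve_mul d)
    (@curve_mul_is_linear d).

Lemma form_imageE d (z : K) : form d z <-> exists A : dhomog 3 F d, z = fev (val A).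
Proof.
split=> [[A [hA ->]]|[A ->]]; first by exists (DHomog hA).
by apply: form_fev; apply: dhomog_is_dhomog.
Qed.

Let fev_lin d a (A B : dhomog 3 F d) :
  fev (val (a *: A + B)) = k a * fev (val A) + fev (val B).
Proof. by rewrite linearP /= rmorphD /= mevZ. Qed.

Lemma dim_dhomog d : \dim {: dhomog 3 F d} = 'C(d + 2, 2).
Proof. by rewrite dimvf; rewrite -[LHS]/'C(d + 2, d) -bin_sub ?leq_addr // addKn. Qed.

Lemma bin2_double m : ('C(m.+1, 2) * 2 = m.+1 * m)%N.
Proof. by rewrite -[X in (_ * X)%N]/(2`!) bin_ffact ffactnS ffactn1. Qed.

(** Forms of degree n + 1 + d are counted modulo f times the forms of degree d. With 'C(n, 2) the
    genus, the relation on r is the Riemann-Roch value degree + 1 - genus. *)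
Lemma dim_form_large d r : (r + 'C(n, 2) = n.+1 * (n.+1 + d) + 1)%N ->
  dimge k (form (K := K) (n.+1 + d)) r /\ dimle k (form (K := K) (n.+1 + d)) r.
Proof.
move=> hr; pose W := limg (linfun (@curve_mul d)).
have hW (A : dhomog 3 F (n.+1 + d)) : A \in W <-> fev (val A) = 0.
  split=> [/memv_imgP [B _ ->]|e]; first by rewrite lfunE /= (fev_mulf hn hG).
  have [B eB] := fev_vanish (dhomog_is_dhomog A) e.
  have [B' [hB' eB']] := dhomog_cofactor hn hG (dhomog_is_dhomog A) eB.
  apply/memv_imgP; exists (DHomog hB'); first exact: memvf.
  by apply: val_inj; rewrite lfunE.
have dW : \dim W = 'C(d + 2, 2).
  rewrite -dim_dhomog; apply: limg_dim_eq; apply/eqP; rewrite -subv0.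
  apply/subvP => B; rewrite memv_cap memvf memv_ker lfunE /= memv0 => /eqP /(congr1 val) /= /eqP.
  by rewrite mulf_eq0 (negbTE (curve_neq0 hn hG)).
have er : r = (\dim {: dhomog 3 F (n.+1 + d)} - \dim W)%N.
  rewrite dW dim_dhomog; have := bin2_double (n.+1 + d).+1; have := bin2_double d.+1.
  have := bin2_double n.-1; rewrite prednK ?(ltn_trans _ hn) //.
  rewrite !addn2; move: hr hn; case: n => [|n'] //=; nia.
rewrite er; split.
  by apply: dimge_sub (dimge_image (@fev_lin _) hW) => z /form_imageE.
by apply: dimle_sub (dimle_image (@fev_lin _) hW) => z /form_imageE.
Qed.

Lemma dimge_form_small d : (d <= n)%N -> dimge k (form (K := K) d) 'C(d + 2, 2).
Proof.
move=> dn.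
have hW (A : dhomog 3 F d) : A \in 0%VS <-> fev (val A) = 0.
  rewrite memv0; split=> [/eqP ->|/(fev_small hn hG (dhomog_is_dhomog A) dn) e].
    by rewrite /= rmorph0.
  by apply/eqP/val_inj.
have := dimge_image (@fev_lin _) hW; rewrite dimv0 subn0 dim_dhomog.
by apply: dimge_sub => z /form_imageE.
Qed.

(** In degree d <= n all forms are independent, and 'C(d + 2, 2) exceeds the Riemann-Roch value by
    'C(n - d, 2). *)
Lemma dimge_form d r : (r + 'C(n, 2) <= n.+1 * d + 1)%N -> dimge k (form (K := K) d) r.
Proof.
have := bin2_double n.-1; rewrite prednK ?(ltn_trans _ hn) // => bn.
have [dn|nd] := leqP d n => hr; last first.
  have e : (n.+1 * d + 1 - 'C(n, 2) + 'C(n, 2) = n.+1 * (n.+1 + (d - n.+1)) + 1)%N.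
    by rewrite subnKC // subnK //; move: bn; case: n nd => [|n'] //=; nia.
  have [h _] := dim_form_large e; rewrite subnKC // in h.
  by apply: dimge_leq h; lia.
apply: dimge_leq (dimge_form_small dn); rewrite addn2.
have := bin2_double d.+1.
(* This is the nonnegativity of twice 'C(n - d, 2). *)
have : (n - d <= (n - d) * (n - d))%N by case: (n - d)%N => // t; nia.
have : n = (d + (n - d))%N by lia.
move: bn hr; move: (n - d)%N ('C(n, 2)) ('C(d.+2, 2)) => t c1 c2 bn hr en ht h.
have bn2 : (c1 * 2 + n = n * n)%N by move: bn hn; case: (n) => //= m; nia.
by clear bn; subst n; nia.
Qed.

(** * Orders at the coordinate points *)

Variables (L : closedFieldType) (iL : {rmorphism F -> L}).
Hypothesis curve_smooth : forall P : 'I_3 -> L, (exists i, P i != 0) ->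
  mev iL P f = 0 -> exists s, mev iL P f^`M(s) != 0.
Hypothesis separable_root : forall x : L, exists t : {poly F},
  ev1 iL x t = 0 /\ t^`() = -1.

Implicit Types (v : place K) (A B : {mpoly F[3]}) (P : 'rV[F]_3).

Let X0 i : X i != 0. Proof. exact: (gen_coord_neq0 hn hG). Qed.

Local Notation Pt l := (delta_mx 0 l : 'rV[F]_3).

Lemma coord_point_neq0 (l : 'I_3) : Pt l != 0.
Proof.
by apply/eqP => /rowP /(_ l); rewrite !mxE !eqxx => /eqP; rewrite oner_eq0.
Qed.

Lemma coord_point_on_curve l : on_curve f (Pt l).
Proof.
split; first exact: coord_point_neq0.
rewrite meval_mev -[RHS](mev_delta_curve hn hG (idfun : {rmorphism F -> F}) l).
by apply: eq_mev => i; rewrite mxE eqxx.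
Qed.

Lemma coord_point_inj l l' : same_point (Pt l) (Pt l') -> l = l'.
Proof.
move=> [c c0] /rowP /(_ l); rewrite !mxE !eqxx /=.
by case: eqP => // _ /eqP; rewrite mulr0 oner_eq0.
Qed.

(** The equation f = 0 solved for the third coordinate; at P_l the bracket has the value of
    X_l^n. *)
Lemma curve_gen_eq l : let l1 := ordS l in let l2 := ordS l1 in
  X l2 * (X l ^+ n + (X l1 * X l2 ^+ n.-1 + X l * X l1 * fev G)) = - (X l * X l1 ^+ n).
Proof.
rewrite /=; have := @mev_curve F n G _ k X l; rewrite /= (fev_curve hn hG).
have en (z : K) : z ^+ n = z * z ^+ n.-1 by rewrite -exprS prednK // (ltn_trans _ hn).
rewrite [X (ordS (ordS l)) ^+ n]en => e; apply/eqP; rewrite -addr_eq0 e.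
by apply/eqP; ring.
Qed.

(** By [curve_gen_eq] the order of X_(l+2) is n times that of X_(l+1), and by [transversal_line] one
    of these two orders is 1. *)
Lemma coord_val_at v l : place_at v (Pt l) ->
  [/\ v (X l) = mu v, v (X (ordS l)) = mu v + 1 & v (X (ordS (ordS l))) = mu v + n%:Z].
Proof.
move=> vP; have hP := coord_point_on_curve l.
have Pl : Pt l 0 l != 0 by rewrite mxE !eqxx oner_neq0.
have vl := place_at_coord hn hG curve_smooth separable_root hP vP Pl.
set l1 := ordS l; set l2 := ordS l1.
have vi i : i != l -> mu v + 1 <= v (X i).
  move=> il; have := place_at_minor hn hG curve_smooth separable_root i l hP vP.
  by rewrite !mxE !eqxx (negbTE il) rmorph1 rmorph0 mul1r mul0r subr0 val_ge_neq0.
have v1 := vi l1 (ordS_neq l); have v2 := vi l2 (ordSS_neq l).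
have Xn : X l ^+ n != 0 by rewrite expf_neq0.
have vn : v (X l ^+ n) = n%:Z * mu v by rewrite placeX vl.
have hGv : val_ge v (fev G) ((n - 2)%:Z * mu v) := val_form v hG.
have rest : val_ge v (X l1 * X l2 ^+ n.-1 + X l * X l1 * fev G) (v (X l ^+ n) + 1).
  apply: val_geD; rewrite vn.
    right; rewrite placeM ?expf_neq0 // placeX; nia.
  have -> : n%:Z * mu v + 1 = mu v + (mu v + 1) + (n - 2)%:Z * mu v by nia.
  by do 2!apply: val_geM => //; right; rewrite ?vl.
have [s0 vs] := place_addl Xn rest.
have := congr1 v (curve_gen_eq l); rewrite /= -/l1 -/l2 placeN !placeM ?expf_neq0 //.
rewrite vs vn placeX vl => e.
have e' : v (X l2) - mu v = n%:Z * (v (X l1) - mu v) by nia.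
have [i [vi1 nz]] := transversal_line hn hG curve_smooth separable_root hP vP Pl.
have il : i != l by apply: contraNneq nz => ->; rewrite subrr.
move: vi1; rewrite !mxE !eqxx (negbTE il) rmorph1 rmorph0 mul1r mul0r subr0 => vi1.
have d01 : l != l1 by rewrite eq_sym ordS_neq.
have d12 : l1 != l2 by rewrite eq_sym ordS_neq.
have d02 : l != l2 by rewrite eq_sym ordSS_neq.
have [ei|ei|ei] := I3_distinct d01 d12 d02 i; first by rewrite ei eqxx in il.
  rewrite ei in vi1; rewrite vi1 in e'; split=> //.
  by move: e'; clear; move: (v _) (mu v) => p q; lia.
(* If X_(l+2) had order 1, then 1 would be n times a positive integer. *)
rewrite ei in vi1; rewrite vi1 in e'.
by move: e' hn v1; clear; move: (v _) (mu v) => p q; nia.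
Qed.

(** Where X_j = 0 the equation reduces to X_(j+1) X_(j+2)^n = 0, so a second coordinate vanishes and
    the centre is a coordinate point. *)
Lemma coord_val_not v : (forall l, ~ place_at v (Pt l)) -> forall j, v (X j) = mu v.
Proof.
move=> no j; apply/eqP/negPn/negP => vj.
set l1 := ordS j; set l2 := ordS l1.
have vj1 : mu v + 1 <= v (X j) by have := mu_le v j; lia.
have [P [[c Pc] Pf vP]] := place_center hn hG iL v.
have center_zero i : mu v + 1 <= v (X i) -> P i = 0.
  by move=> h; apply/eqP/negPn/negP => /(centered_coord vP) e; lia.
have Pj := center_zero j vj1.
have two a b c' : a != b -> b != c' -> a != c' -> P a = 0 -> P b = 0 -> False.
  move=> ab bc ac Pa Pb; apply: (no c').
  have Pc' : P c' != 0.
    by apply: contraNneq Pc => Pc'; have [->|->|->] := I3_distinct ab bc ac c; rewrite ?Pa ?Pb ?Pc'.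
  apply/(place_atP hn hG curve_smooth separable_root _ (coord_point_on_curve c')).
  move=> d A hA PA; apply: vP => //.
  have -> : mev iL P A = P c' ^+ d * mev iL (geometric iL (Pt c')) A.
    rewrite -mev_homog //; apply: eq_mev => i; rewrite /geometric mxE eqxx /=.
    have [->|->|->] := I3_distinct ab bc ac i.
    - by rewrite (negbTE ac) rmorph0 mulr0.
    - by rewrite (negbTE bc) rmorph0 mulr0.
    - by rewrite eqxx rmorph1 mulr1.
  by rewrite mulf_neq0 ?expf_neq0.
have d01 : j != l1 by rewrite eq_sym ordS_neq.
have d12 : l1 != l2 by rewrite eq_sym ordS_neq.
have d02 : j != l2 by rewrite eq_sym ordSS_neq.
have := @mev_curve F n G _ iL P j; rewrite /= -/l1 -/l2 Pf Pj.
rewrite expr0n; have -> : (n == 0)%N = false by apply/negbTE; lia.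
rewrite /= !mul0r mulr0 !addr0 add0r => /esym/eqP; rewrite mulf_eq0 expf_eq0.
case/orP => [/eqP h|/andP[_ /eqP h]]; first exact: (two j l1 l2).
by apply: (two j l2 l1) => //; rewrite eq_sym.
Qed.

(** * Bezout's inequality at rational points *)

Section Bezout.

Variables (J : finType) (R : J -> 'rV[F]_3) (vR : J -> place K).
Hypothesis R_curve : forall i, on_curve f (R i).
Hypothesis R_distinct : forall i j, i != j -> ~ same_point (R i) (R j).
Hypothesis vR_at : forall i, place_at (vR i) (R i).

Lemma separating_line i j : i != j -> exists z, [/\ form 1 z, z != 0,
  val_ge (vR i) z (mu (vR i) + 1) & vR j z = mu (vR j)].
Proof.
move=> ij.
have [c Rc] := geometric_neq0 iL (proj1 (R_curve i)); rewrite fmorph_eq0 in Rc.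
have [e ne] : exists e, R i 0 c * R j 0 e - R i 0 e * R j 0 c != 0.
  apply: contrapT => no; apply: (R_distinct ij).
  have h e : R i 0 c * R j 0 e = R i 0 e * R j 0 c.
    by apply/eqP; rewrite -subr_eq0; apply/negPn/negP => ne; apply: no; exists e.
  have Rjc : R j 0 c != 0.
    apply/negP => /eqP Rjc; case: (R_curve j) => /eqP + _; apply; apply/rowP => e; rewrite mxE.
    by apply: (mulfI Rc); rewrite h Rjc !mulr0.
  exists (R i 0 c / R j 0 c); first by rewrite mulf_neq0 ?invr_eq0.
  by apply/rowP => e; rewrite mxE mulrAC h mulfK.
have hA : R i 0 c *: 'X_e - R i 0 e *: 'X_c \is 1.-homog.
  by apply: rpredB; apply: rpredZ; apply: varX_homog.
have PA : (R i 0 c *: 'X_e - R i 0 e *: 'X_c).@[R i 0] = 0.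
  by rewrite raddfB /= !mevalZ !mevalXU mulrC subrr.
have PB : (R i 0 c *: 'X_e - R i 0 e *: 'X_c).@[R j 0] != 0.
  by rewrite raddfB /= !mevalZ !mevalXU.
exists (fev (R i 0 c *: 'X_e - R i 0 e *: 'X_c)); split.
- exact: form_fev.
- apply: (fev_neq0 K hA (geometric_curve iL (R_curve j))).
  by rewrite mev_geometric fmorph_eq0.
- have := place_at_form_pos hn hG curve_smooth separable_root (R_curve i) (@vR_at i) hA PA.
  by rewrite mul1r.
- have := place_at_form hn hG curve_smooth separable_root (R_curve j) (@vR_at j) hA PB.
  by rewrite mul1r.
Qed.

Lemma exact_line j : exists z, [/\ form 1 z, z != 0 & vR j z = mu (vR j) + 1].
Proof.
have [c Rc] := geometric_neq0 iL (proj1 (R_curve j)); rewrite fmorph_eq0 in Rc.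
have [i [e nz]] := transversal_line hn hG curve_smooth separable_root (R_curve j) (@vR_at j) Rc.
eexists; split; [|exact: nz|exact: e].
by rewrite -mulNr -rmorphN; apply: formD; apply: formZ; apply: form_gen.
Qed.

Lemma missing_line j : exists z, [/\ form 1 z, z != 0 & vR j z = mu (vR j)].
Proof.
have [c Rc] := geometric_neq0 iL (proj1 (R_curve j)); rewrite fmorph_eq0 in Rc.
exists (X c); split=> //; first exact: form_gen.
exact: (place_at_coord hn hG curve_smooth separable_root (R_curve j) (@vR_at j) Rc).
Qed.

Definition order_ge s (a : J -> nat) (z : K) : Prop :=
  form s z /\ forall i, val_ge (vR i) z (s%:Z * mu (vR i) + (a i)%:Z).

Lemma order_ge_subspace s a : subspace k (order_ge s a).
Proof.
split; first by split; [apply: form0|move=> i; left].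
move=> b c z w [hz hz'] [hw hw']; split; first by apply: formD; apply: formZ.
by move=> i; apply: val_geD; apply: val_geZ.
Qed.

Lemma form_prod (I : finType) (z : I -> K) (a : I -> nat) : (forall i, form 1 (z i)) ->
  form (\sum_i a i)%N (\prod_i z i ^+ a i).
Proof.
move=> hz; elim/big_ind2: _ => [|d x e y h1 h2|i _]; first exact: form1.
  exact: formM.
by have := formX (a i) (hz i); rewrite muln1.
Qed.

(** A product of lines: for i different from j a line through R_i missing R_j, for j a line
    transversal to the curve at R_j, each with exponent a_i, and a power of a line missing R_j to
    reach degree s. *)
Lemma exact_order_form s a j : (\sum_i a i <= s)%N ->
  exists z, order_ge s a z /\ ~ val_ge (vR j) z (s%:Z * mu (vR j) + (a j)%:Z + 1).
Proof.
move=> le.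
have /choice [z hz] : forall i, exists z, [/\ form 1 z, z != 0,
    val_ge (vR i) z (mu (vR i) + 1) & vR j z = mu (vR j) + (i == j)%:Z].
  move=> i; have [->|ij] := eqVneq i j.
    by have [z [h1 h2 h3]] := exact_line j; exists z; split=> //; right; rewrite h3.
  by have [z [h1 h2 h3 h4]] := separating_line ij; exists z; rewrite addr0.
have [y [y1 y0 yj]] := missing_line j.
pose w := \prod_i z i ^+ a i.
have zn0 i : z i != 0 by have [] := hz i.
have w0 : w != 0 by apply/prodf_neq0 => i _; rewrite expf_neq0.
have vw v : v w = \sum_i (a i)%:Z * v (z i).
  rewrite place_prod => [|i]; last by rewrite expf_neq0.
  by apply: eq_bigr => i _; rewrite placeX.
have fw : form (\sum_i a i)%N w by apply: form_prod => i; have [] := hz i.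
set d := (\sum_i a i)%N in le fw; pose t := (s - d)%N.
have vt v : v (w * y ^+ t) = v w + t%:Z * v y by rewrite placeM ?expf_neq0 // placeX.
have sumz v c : \sum_i (a i)%:Z * c = d%:Z * c :> int.
  by rewrite -mulr_suml /d (big_morph _ PoszD (erefl _)).
exists (w * y ^+ t); split; last first.
  rewrite val_ge_neq0 ?mulf_neq0 ?expf_neq0 // vt vw yj.
  under eq_bigr => i _ do have [_ _ _ ->] := hz i.
  under eq_bigr => i _ do rewrite mulrDr.
  rewrite big_split /= (sumz (vR j)) (bigD1 j) //= eqxx mulr1 big1 ?addr0 => [|i ij]; last first.
    by rewrite (negbTE ij) mulr0.
  by rewrite -[in X in X * _](subnKC le) PoszD -/t; lia.
split.
  by rewrite -(subnKC le); apply: formM => //; have := formX t y1; rewrite muln1.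
move=> i; right; rewrite vt vw (bigD1 i) //=.
have [_ _ hi _] := hz i; rewrite val_ge_neq0 // in hi.
have vy : mu (vR i) <= vR i y by have := val_ge_form (vR i) y1; rewrite mul1r val_ge_neq0.
have rest : \sum_(i' | i' != i) (a i')%:Z * mu (vR i) <= \sum_(i' | i' != i) (a i')%:Z * vR i (z
  i').
  apply: ler_sum => i' _; apply: ler_wpM2l => //.
  by have [h _ _ _] := hz i'; have := val_ge_form (vR i) h; rewrite mul1r val_ge_neq0.
have ed := sumz (vR i) (mu (vR i)); rewrite (bigD1 i) //= in ed.
have est : s%:Z * mu (vR i) = d%:Z * mu (vR i) + t%:Z * mu (vR i).
  by rewrite -mulrDl -PoszD subnKC.
have h1 : (a i)%:Z * (mu (vR i) + 1) <= (a i)%:Z * vR i (z i) by apply: ler_wpM2l.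
have h2 : t%:Z * mu (vR i) <= t%:Z * vR i y by apply: ler_wpM2l.
rewrite mulrDr mulr1 in h1; rewrite est -ed.
move: h1 h2 rest; set c1 := (a i)%:Z * _; set c2 := (a i)%:Z * _; set c3 := t%:Z * _.
set c4 := t%:Z * _; set c5 := \sum_(i' | _) _; set c6 := \sum_(i' | _) _.
by clearbody c1 c2 c3 c4 c5 c6; clear; lia.
Qed.

(** In degree s at least the sum of the a_i the vanishing conditions are independent: lowering a
    single a_j by 1 strictly enlarges the space, by [exact_order_form]. *)
Lemma dimge_order_ge s a q : (\sum_i a i <= s)%N ->
  dimge k (order_ge s a) q -> dimge k (form (K := K) s) (q + \sum_i a i).
Proof.
have [N] := ubnP (\sum_i a i); elim: N a q => // N IH a q lt le hq.
have [/eqP e0|ne0] := boolP (\sum_i a i == 0)%N.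
  by rewrite e0 addn0; apply: dimge_sub hq => z [].
have [j aj] : exists j, (0 < a j)%N.
  apply: contrapT => no; case/eqP: ne0; apply: big1 => i _.
  by apply/eqP; rewrite -leqn0 leqNgt; apply/negP => h; apply: no; exists i.
pose a' i := (a i - (i == j))%N.
have sa : (\sum_i a i = (\sum_i a' i).+1)%N.
  rewrite (bigD1 j) //= [in RHS](bigD1 j) //= /a' eqxx -addSn; congr (_ + _)%N; first by lia.
  by apply: eq_bigr => i ij; rewrite (negbTE ij) subn0.
rewrite sa -addSnnS; apply: IH; [by rewrite sa in lt|by lia|].
have [|z [hz nz]] := @exact_order_form s a' j; first by lia.
apply: (dimge_ext (order_ge_subspace s a) _ hz _ hq).
  move=> w [hw hw']; split=> // i; apply: val_ge_le (hw' i).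
  by rewrite lerD2l lez_nat leq_subr.
move=> [_ /(_ j) h]; apply: nz.
apply: val_ge_le h; rewrite /a' eqxx; lia.
Qed.

(** With d the sum of the a_i, multiplication by z embeds the forms of degree n + 1 + d into those
    of degree n + 1 + u + d with orders at least a_i. The latter satisfy d independent conditions,
    while the two full spaces of forms differ in dimension by (n + 1) u. *)
Lemma bezout_rational u z a : form u z -> z != 0 ->
  (forall i, val_ge (vR i) z (u%:Z * mu (vR i) + (a i)%:Z)) ->
  (\sum_i a i <= n.+1 * u)%N.
Proof.
move=> hz z0 ha; set d := (\sum_i a i)%N.
have bn : ('C(n, 2) * 2 = n * n.-1)%N.
  by have := bin2_double n.-1; rewrite prednK ?(ltn_trans _ hn).
have hr e : (n.+1 * (n.+1 + e) + 1 - 'C(n, 2) + 'C(n, 2) = n.+1 * (n.+1 + e) + 1)%N.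
  by rewrite subnK //; move: bn; case: (n) => [|n'] //=; nia.
have [h1 _] := dim_form_large (hr d); have [_ h2] := dim_form_large (hr (u + d)%N).
have h3 : dimge k (order_ge (n.+1 + (u + d)) a) (n.+1 * (n.+1 + d) + 1 - 'C(n, 2)).
  apply: dimge_sub (dimge_mul z0 h1) => w [y hy ->]; split.
    have -> : (n.+1 + (u + d) = u + (n.+1 + d))%N by lia.
    exact: formM.
  move=> i; have -> : (n.+1 + (u + d))%:Z * mu (vR i) + (a i)%:Z
      = u%:Z * mu (vR i) + (a i)%:Z + (n.+1 + d)%:Z * mu (vR i) by rewrite !PoszD; ring.
  by apply: val_geM => //; apply: val_ge_form.
have := h2 _ (dimge_order_ge _ h3); rewrite -/d => /(_ _).
have := hr d; have := hr (u + d)%N; nia.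
Qed.

End Bezout.

End CurveDimensions.

(** * Functions with few poles *)

Section FewPoles.

Variables (F : fieldType) (n : nat) (hn : (3 <= n)%N).
Variables (G : {mpoly F[3]}) (hG : G \is (n - 2)%N.-homog).
Local Notation f := (curve_poly n G).
Variable K : function_field f.
Local Notation k := (ff_const K).
Local Notation X := (gen_coord K).
Local Notation fev := (mev k X).
Variables (L : closedFieldType) (iL : {rmorphism F -> L}).
Hypothesis curve_smooth : forall P : 'I_3 -> L, (exists i, P i != 0) ->
  mev iL P f = 0 -> exists s, mev iL P f^`M(s) != 0.
Hypothesis separable_root : forall x : L, exists t : {poly F},
  ev1 iL x t = 0 /\ t^`() = -1.

Implicit Types (v : place K) (A B : {mpoly F[3]}) (P : 'rV[F]_3).

Let X0 i : X i != 0. Proof. exact: (gen_coord_neq0 hn hG). Qed.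

Lemma subst_varZ i B a A : subst_var i B (a *: A) = a *: subst_var i B A.
Proof. by rewrite /subst_var mevZ mul_mpolyC. Qed.

Lemma subst_var_comp i j B C A (w : 'I_3 -> {mpoly F[3]}) :
  (forall t, subst_var i B (subst_var j C 'X_t) = w t) ->
  subst_var i B (subst_var j C A) = @mev F {mpoly F[3]} (@mpolyC 3 F) w A.
Proof.
move=> h; apply: (@mev_comp F {mpoly F[3]} {mpoly F[3]} (@mpolyC 3 F) (subst_var i B) (@mpolyC 3
  F)).
  by move=> c; exact: mevC.
by move=> t; rewrite -h subst_varX.
Qed.

Lemma place_ext v v' : (forall z, v z = v' z) -> v = v'.
Proof.
case: v => [g a b c d e]; case: v' => [g' a' b' c' d' e'] /= h.
have eg : g = g' by apply/funext.
subst g'; congr Place; exact: Prop_irrelevance.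
Qed.

Lemma place_at_eq v v' P : on_curve f P -> place_at v P -> place_at v' P -> v = v'.
Proof.
move=> hP vP v'P; apply: place_ext.
exact: (place_at_unique hn hG curve_smooth separable_root hP vP v'P).
Qed.

(** The minors vanish at the centre of v as well, which makes that centre proportional to P. *)
Lemma place_at_minors v P c : on_curve f P -> P 0 c != 0 ->
  (forall i, val_ge v (k (P 0 c) * X i - k (P 0 i) * X c) (mu v + 1)) -> place_at v P.
Proof.
move=> hP Pc h; have [R [[b Rb] Rf vR]] := place_center hn hG iL v.
have e i : iL (P 0 c) * R i = iL (P 0 i) * R c.
  apply/eqP; rewrite -subr_eq0; apply/negPn/negP => ne.
  have hA : P 0 c *: 'X_i - P 0 i *: 'X_c \is 1.-homog.
    by apply: rpredB; apply: rpredZ; apply: varX_homog.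
  have ne' : mev iL R (P 0 c *: 'X_i - P 0 i *: 'X_c) != 0.
    by rewrite raddfB /= !mevZ !mevX.
  have := h i; have := vR _ _ hA ne'; have := fev_neq0 K hA Rf ne'.
  rewrite raddfB /= !mevZ !mevX => nz; rewrite val_ge_neq0 // => ->; lia.
have Rc : R c != 0.
  apply: contraNneq Rb => Rc; have := e b; rewrite Rc mulr0 => /eqP.
  by rewrite mulf_eq0 fmorph_eq0 (negbTE Pc).
apply/(place_atP hn hG curve_smooth separable_root v hP) => d A hA PA; apply: vR => //.
have -> : mev iL R A = (R c / iL (P 0 c)) ^+ d * mev iL (geometric iL P) A.
  rewrite -mev_homog //; apply: eq_mev => i; rewrite /geometric mulrAC.
  by rewrite [R c * _]mulrC -e mulrAC mulfV ?mul1r // fmorph_eq0.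
by rewrite mulf_neq0 ?expf_neq0 // mulf_neq0 // invr_eq0 fmorph_eq0.
Qed.

Lemma divide_form_homog d e A B C : A \is d.-homog -> B \is (d + e).-homog -> B = A * C ->
  exists2 C', C' \is e.-homog & B = A * C'.
Proof.
move=> hA hB eB; exists (pihomog mdeg e C); first exact: pihomogP.
by rewrite -(pihomogM e C hA) -eB pihomog_dE.
Qed.

(* The product of z with a line through the pole is a form, and two lines suffice. *)
Lemma no_single_pole d P v0 z : on_curve f P -> place_at v0 P -> (d.+2 <= n)%N ->
  (forall v, v <> v0 -> val_ge v z (d%:Z * mu v)) -> val_ge v0 z (d%:Z * mu v0 - 1) ->
  form d z.
Proof.
move=> hP vP dn hz hz0.
have [c] := geometric_neq0 iL (proj1 hP); rewrite fmorph_eq0 => Pc.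
set a := ordS c; set b := ordS a.
have ac : a != c := ordS_neq c.
have bc : b != c := ordSS_neq c.
have ba : b != a := ordS_neq a.
pose l i := 'X_i - (P 0 i / P 0 c) *: 'X_c : {mpoly F[3]}.
have hl i : l i \is 1.-homog by apply: rpredB; [|apply: rpredZ]; apply: varX_homog.
have lX i : fev (l i) = k (P 0 c)^-1 * (k (P 0 c) * X i - k (P 0 i) * X c).
  by rewrite /l raddfB /= mevZ !mevX rmorphM fmorphV /=; field; rewrite fmorph_eq0.
have fz i : form d.+1 (fev (l i) * z).
  apply: (form_integral hn hG curve_smooth separable_root) => v.
  have -> : d.+1%:Z * mu v = 1%:Z * mu v + d%:Z * mu v by lia.
  have [->|ne] := pselect (v = v0); last by apply: val_geM; [apply: val_form|apply: hz].
  have -> : 1%:Z * mu v0 + d%:Z * mu v0 = (mu v0 + 1) + (d%:Z * mu v0 - 1) by lia.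
  apply: val_geM => //; rewrite lX; apply: val_geZ.
  exact: (place_at_minor hn hG curve_smooth separable_root).
have [A [hA eA]] := fz a; have [B [hB eB]] := fz b.
have eAB : A * l b = l a * B.
  apply/eqP; rewrite -subr_eq0; apply/eqP.
  apply: (fev_small hn hG (K := K) (d := d.+2)) => //.
    apply: rpredB; last exact: (dhomogM (hl a) hB).
    by have := dhomogM hA (hl b); rewrite addn1.
  by rewrite raddfB /= !rmorphM /= -eA -eB; apply/eqP; rewrite subr_eq0; apply/eqP; ring.
have [C eC] := subst_var_mod a ((P 0 a / P 0 c) *: 'X_c) A.
rewrite -/(l a) in eC.
have sa : subst_var a ((P 0 a / P 0 c) *: 'X_c) A = 0.
  have := congr1 (subst_var a ((P 0 a / P 0 c) *: 'X_c)) eAB; rewrite !rmorphM /=.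
  have -> : subst_var a ((P 0 a / P 0 c) *: 'X_c) (l a) = 0.
    by rewrite /l rmorphB /= subst_varZ !subst_varX eqxx [c == a]eq_sym (negbTE ac) subrr.
  have -> : subst_var a ((P 0 a / P 0 c) *: 'X_c) (l b) = l b.
    by rewrite /l rmorphB /= subst_varZ !subst_varX [c == a]eq_sym (negbTE ac) (negbTE ba).
  rewrite mul0r => /eqP; rewrite mulf_eq0 => /orP[/eqP //|/eqP lb].
  have := congr1 (fun p : {mpoly F[3]} => p@_U_(b)) lb.
  rewrite /l mcoeffB mcoeffZ !mcoeffXU eqxx [c == b]eq_sym (negbTE bc) mulr0 subr0 mcoeff0.
  by move/eqP; rewrite oner_eq0.
rewrite sa subr0 in eC.
have [C' hC' eC'] := divide_form_homog (hl a) hA eC.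
have la0 : fev (l a) != 0.
  apply/eqP => /(fev_small hn hG (hl a)) la.
  have := congr1 (fun p : {mpoly F[3]} => p@_U_(a)) (la (ltnW (ltnW hn))).
  rewrite /l mcoeffB mcoeffZ !mcoeffXU eqxx [c == a]eq_sym (negbTE ac) mulr0 subr0 mcoeff0.
  by move/eqP; rewrite oner_eq0.
exists C'; split=> //; apply: (mulfI la0).
by rewrite eA eC' rmorphM.
Qed.

Section PolePair.

Variables (Q : 'rV[F]_3) (o i j : 'I_3).
Hypotheses (oi : o != i) (ij : i != j) (oj : o != j).
Hypotheses (hQ : on_curve f Q) (Qi : Q 0 i != 0).
Local Notation line t := ('X_t - (Q 0 t / Q 0 i) *: 'X_i : {mpoly F[3]}).
Local Notation Pt := (delta_mx 0 o : 'rV[F]_3).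

Lemma line_homog t : line t \is 1.-homog.
Proof. by apply: rpredB; [|apply: rpredZ]; apply: varX_homog. Qed.

Lemma line_neq0 t : t != i -> line t != 0.
Proof.
move=> ti; apply/eqP => /(congr1 (fun p : {mpoly F[3]} => p@_U_(t))).
rewrite mcoeffB mcoeffZ !mcoeffXU eqxx [i == t]eq_sym (negbTE ti) mulr0 subr0 mcoeff0.
by move/eqP; rewrite oner_eq0.
Qed.

(* On the line [line j = 0], which joins Q to the coordinate point, the form f
   vanishes at these two points. *)
Lemma curve_line_decomposition : exists g N, [/\ g \is n.-homog, N \is n.-1.-homog &
  f = line j * g + 'X_i * line o * N].
Proof.
have io : i != o by rewrite eq_sym.
have ji : j != i by rewrite eq_sym.
have jo : j != o by rewrite eq_sym.
pose s1 := subst_var j ((Q 0 j / Q 0 i) *: 'X_i).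
pose s2 := subst_var o ((Q 0 o / Q 0 i) *: 'X_i).
have [g eg] : congruent (line j) f (s1 f) by apply: subst_var_mod.
have z1 : subst_var i 0 (s1 f) = 0.
  rewrite /s1 (@subst_var_comp _ _ _ _ _ (fun t => 'X_o * (t == o)%:R)).
    by rewrite (mev_homog _ _ _ (curve_homog hn hG)) (mev_delta_curve hn hG) mulr0.
  move=> t; rewrite subst_varX; have [->|->|->] := I3_distinct oi ij oj t.
  - by rewrite (negbTE oj) subst_varX (negbTE oi) eqxx mulr1.
  - by rewrite (negbTE ij) subst_varX eqxx (negbTE io) mulr0.
  - by rewrite eqxx subst_varZ subst_varX eqxx (negbTE jo) mulr0 scaler0.
have := subst_var_mod i 0 (s1 f); rewrite z1 => -[C]; rewrite !subr0 => eC.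
have z2 : s2 (s1 f) = 0.
  rewrite /s2 /s1 (@subst_var_comp _ _ _ _ _ (fun t => 'X_i * (Q 0 t / Q 0 i)%:MP)).
    rewrite (mev_homog _ _ _ (curve_homog hn hG)).
    rewrite -(@mev_comp F F {mpoly F[3]} idfun (@mpolyC 3 F) (@mpolyC 3 F) (fun t => Q 0 t / Q 0
      i)) //.
    have -> : mev idfun (fun t => Q 0 t / Q 0 i) f = (Q 0 i)^-1 ^+ n.+1 * mev idfun (Q 0) f.
      by rewrite -mev_homog ?(curve_homog hn hG) //; apply: eq_mev => t; rewrite mulrC.
    by rewrite -meval_mev (proj2 hQ) mulr0 rmorph0 mulr0.
  move=> t; rewrite subst_varX; have [->|->|->] := I3_distinct oi ij oj t.
  - by rewrite (negbTE oj) subst_varX eqxx -mul_mpolyC mulrC.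
  - by rewrite (negbTE ij) subst_varX eq_sym (negbTE oi) divff // mulr1.
  - by rewrite eqxx subst_varZ subst_varX eq_sym (negbTE oi) -mul_mpolyC mulrC.
have s2C : s2 C = 0.
  apply: (mulfI (mvarX_neq0 F i)); rewrite mulr0 -[RHS]z2 eC /s2 rmorphM /=.
  by congr (_ * _); rewrite subst_varX (negbTE io).
have := subst_var_mod o ((Q 0 o / Q 0 i) *: 'X_i) C; rewrite -/s2 s2C => -[N]; rewrite subr0 => eN.
have ef : f = line j * g + 'X_i * line o * N.
  by rewrite -eg -[X in _ + X]mulrA -eN -eC subrK.
exists (pihomog mdeg n g), (pihomog mdeg n.-1 N); split; try exact: pihomogP.
have hiM : 'X_i * line o \is 2.-homog := dhomogM (varX_homog F i) (line_homog o).
have e2 : (n.+1 = 2 + n.-1)%N by rewrite addSn add1n prednK // (ltn_trans _ hn).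
rewrite -(pihomogM n g (line_homog j)) -(pihomogM n.-1 N hiM) -e2 -raddfD /= -ef.
by rewrite pihomog_dE // (curve_homog hn hG).
Qed.

(** On the curve h = N / l_j = - g / (X_i l_o). A pole requires that l_j and X_i l_o both vanish,
    which happens only at Q and at P_o. At each of these points one of the denominators has order at
    most 1, by transversality, so the pole is at most simple. *)
Lemma pole_pair vQ v0 : place_at vQ Q -> place_at v0 Pt -> exists h,
  [/\ forall v, v <> vQ -> v <> v0 -> val_ge v h ((n - 2)%N%:Z * mu v),
      val_ge vQ h ((n - 2)%N%:Z * mu vQ - 1), val_ge v0 h ((n - 2)%N%:Z * mu v0 - 1)
    & ~ form (n - 2) h].
Proof.
move=> vQP v0P; have [g [N [hg hN ef]]] := curve_line_decomposition.
have n1 : (1 <= n)%N by apply: leq_trans hn.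
have [l ltE] : exists l : 'I_3 -> K, forall t, fev (line t) = l t by eexists.
have fl t : l t = X t - k (Q 0 t / Q 0 i) * X i by rewrite -ltE raddfB /= mevZ !mevX.
have nz t : t != i -> l t != 0.
  by move=> ti; rewrite -ltE; apply/eqP => /(fev_small hn hG (line_homog t) n1)/eqP;
    rewrite (negbTE (line_neq0 ti)).
have l0 : l j != 0 by apply: nz; rewrite eq_sym.
have M0 : l o != 0 by apply: nz.
have eK : l j * fev g = - (X i * l o * fev N).
  by rewrite -!ltE; apply/eqP; rewrite -addr_eq0 -(mevX k X i) -!rmorphM -rmorphD -ef /=
    (fev_curve hn hG).
pose h := fev N / l j.
have hE : h = - fev g / (X i * l o).
  by apply: (mulfI l0); rewrite [RHS]mulrA mulrN eK opprK /h mulrC mulfVK // mulrAC mulfV ?mul1r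
    // mulf_neq0.
have n2 : (n - 2)%N%:Z = n%:Z - 2 by move: hn; clear; lia.
have n1Z : n.-1%:Z = n%:Z - 1 by move: hn; clear; lia.
have e1 : (1 + (n - 2) = n.-1)%N by move: hn; clear; lia.
have e2 : (1 + 1 + (n - 2) = n)%N by move: hn; clear; lia.
have hA v e : v (l j) <= mu v + e -> val_ge v h ((n - 2)%N%:Z * mu v - e).
  move=> le; rewrite val_geMr ?invr_eq0 // placeV opprK n2.
  apply: val_ge_le (val_form v hN).
  rewrite n1Z; move: le; rewrite !mulrBl; move: (v _) (mu v) (n%:Z * _); clear; lia.
have hB v e : v (X i) + v (l o) <= 2 * mu v + e -> val_ge v h ((n - 2)%N%:Z * mu v - e).
  move=> le; rewrite hE val_geMr ?invr_eq0 ?mulf_neq0 // placeV opprK n2 placeM // val_geN.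
  apply: val_ge_le (val_form v hg).
  by move: le; rewrite mulrBl; move: (v _) (v _) (mu v) (n%:Z * _); clear; lia.
have hl v t : val_ge v (l t) (mu v) by have := val_form v (line_homog t); rewrite mul1r ltE.
exists h; split.
- move=> v vQ' v0'.
  have [le|lj] := lerP (v (l j)) (mu v); first by rewrite -[_ * _]subr0; apply: hA; move: le;
    clear; lia.
  rewrite -[_ * _]subr0; apply: hB.
  have [le|li] := lerP (v (X i)) (mu v); last first.
    case: v0'; apply: (place_at_eq (coord_point_on_curve hn hG o)) => //.
    apply: (@place_at_minors v Pt o (coord_point_on_curve hn hG o)).
      by rewrite mxE !eqxx oner_neq0.
    have Xj : val_ge v (X j) (mu v + 1).
      have -> : X j = l j + k (Q 0 j / Q 0 i) * X i by rewrite fl subrK.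
      by apply: val_geD; [right; move: lj|apply: val_geZ; right; move: li]; clear; lia.
    move=> t; rewrite !mxE !eqxx /= rmorph1 mul1r.
    have [->|->|->] := I3_distinct oi ij oj t.
    + by rewrite eqxx rmorph1 mul1r subrr; left.
    + by rewrite [i == o]eq_sym (negbTE oi) rmorph0 mul0r subr0; right; move: li; clear; lia.
    + by rewrite [j == o]eq_sym (negbTE oj) rmorph0 mul0r subr0.
  have [leo|lo] := lerP (v (l o)) (mu v); first by move: le leo; clear; lia.
  case: vQ'; apply: (place_at_eq hQ) => //.
  apply: (@place_at_minors v Q i hQ Qi) => t.
  have -> : k (Q 0 i) * X t - k (Q 0 t) * X i = k (Q 0 i) * l t.
    by rewrite fl rmorphM fmorphV /=; field; rewrite fmorph_eq0.
  apply: val_geZ; have [->|->|->] := I3_distinct oi ij oj t.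
  + by right; move: lo; clear; lia.
  + by rewrite fl divff // rmorph1 mul1r subrr; left.
  + by right; move: lj; clear; lia.
- have vi := place_at_coord hn hG curve_smooth separable_root hQ vQP Qi.
  have [t [vt nzt]] := transversal_line hn hG curve_smooth separable_root hQ vQP Qi.
  have e : k (Q 0 i) * X t - k (Q 0 t) * X i = k (Q 0 i) * l t.
    by rewrite fl rmorphM fmorphV /=; field; rewrite fmorph_eq0.
  rewrite e in vt nzt.
  have lt0 : l t != 0 by move: nzt; rewrite mulf_eq0 negb_or => /andP[].
  rewrite placeM ?fmorph_eq0 // place_const // add0r in vt.
  have [et|et|et] := I3_distinct oi ij oj t; rewrite et in vt lt0.
  + by apply: hB; move: vt vi; clear; lia.
  + by move: lt0; rewrite fl divff // rmorph1 mul1r subrr eqxx.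
  + by apply: hA; move: vt; clear; lia.
- have hPt := coord_point_on_curve hn hG o.
  have Pto : Pt 0 o != 0 by rewrite mxE !eqxx oner_neq0.
  have vM : v0 (l o) = mu v0.
    rewrite -ltE (place_at_form hn hG curve_smooth separable_root hPt v0P (line_homog o)) ?mul1r //.
    rewrite raddfB /= mevalZ !mevalXU !mxE !eqxx [i == o]eq_sym (negbTE oi) mulr0 subr0.
    exact: oner_neq0.
  have Xge t : t != o -> mu v0 + 1 <= v0 (X t).
    move=> to; have := place_at_minor hn hG curve_smooth separable_root t o hPt v0P.
    by rewrite !mxE !eqxx (negbTE to) rmorph1 rmorph0 mul1r mul0r subr0 val_ge_neq0.
  have [t [vt nzt]] := transversal_line hn hG curve_smooth separable_root hPt v0P Pto.
  have to : t != o by apply: contraNneq nzt => ->; rewrite subrr.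
  move: vt; rewrite !mxE !eqxx (negbTE to) rmorph1 rmorph0 mul1r mul0r subr0 => vt.
  have [le|lt] := lerP (v0 (X i)) (mu v0 + 1); first by apply: hB; move: le vM; clear; lia.
  have {}vt : v0 (X j) = mu v0 + 1.
    have [et|et|et] := I3_distinct oi ij oj t; rewrite et in vt to => //.
    by rewrite eqxx in to.
    by move: vt lt; clear; lia.
  apply: hA; rewrite fl.
  have hr : val_ge v0 (- (k (Q 0 j / Q 0 i) * X i)) (v0 (X j) + 1).
    by rewrite val_geN; apply: val_geZ; right; move: vt lt; clear; lia.
  by have [_ ->] := place_addl (X0 j) hr; rewrite vt.
(* If h were a form H, then N = l_j H and g = - X_i l_o H would hold as polynomials by [fev_small],
   and f would be 0. *)
- move=> [H [hH eH]].
  have eN : N = line j * H.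
    apply/eqP; rewrite -subr_eq0; apply/eqP.
    apply: (fev_small hn hG (K := K) (d := n.-1)); last first.
    + by rewrite raddfB /= rmorphM /= -eH ltE /h mulrC mulfVK // subrr.
    + exact: leq_pred.
    by apply: rpredB => //; have := dhomogM (line_homog j) hH; rewrite e1.
  have eg : g + 'X_i * line o * H = 0.
    apply: (fev_small hn hG (K := K) (d := n)) => //.
      apply: rpredD => //.
      by have := dhomogM (dhomogM (varX_homog F i) (line_homog o)) hH; rewrite e2.
    apply: (mulfI l0); rewrite mulr0 -ltE -rmorphM mulrDr.
    suff -> : line j * ('X_i * line o * H) = 'X_i * line o * N by rewrite -ef /= (fev_curve hn hG).
    by rewrite eN mulrCA.
  case/eqP: (curve_neq0 hn hG); rewrite ef eN [X in _ + X]mulrCA -mulrDr.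
  by rewrite eg mulr0.
Qed.

End PolePair.

End FewPoles.

(** * Divisors supported at rational points *)

Section RationalDivisors.

Variables (F : fieldType) (n : nat) (hn : (3 <= n)%N).
Variables (G : {mpoly F[3]}) (hG : G \is (n - 2)%N.-homog).
Local Notation f := (curve_poly n G).
Variable K : function_field f.
Local Notation k := (ff_const K).
Local Notation X := (gen_coord K).
Local Notation fev := (mev k X).
Variables (L : closedFieldType) (iL : {rmorphism F -> L}).
Hypothesis curve_smooth : forall P : 'I_3 -> L, (exists i, P i != 0) ->
  mev iL P f = 0 -> exists s, mev iL P f^`M(s) != 0.
Hypothesis separable_root : forall x : L, exists t : {poly F},
  ev1 iL x t = 0 /\ t^`() = -1.

Variables (m : nat) (Q : 'I_m -> 'rV[F]_3).
Hypothesis hQ : forall s, on_curve f (Q s).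
Hypothesis hQP : forall s (l : 'I_3), ~ same_point (Q s) (delta_mx 0 l).
Hypothesis hQQ : forall s t, s != t -> ~ same_point (Q s) (Q t).

Local Notation J := ('I_3 + 'I_m)%type.

Definition support_point (i : J) : 'rV[F]_3 :=
  match i with inl l => delta_mx 0 l | inr s => Q s end.
Local Notation R := support_point.

Variable vR : J -> place K.
Hypothesis vR_at : forall i, place_at (vR i) (R i).

Implicit Types (v : place K) (A B : {mpoly F[3]}) (P : 'rV[F]_3).
Implicit Types (e : nat) (a b : J -> int) (c : 'I_3 -> nat) (z w : K).

Let X0 i : X i != 0. Proof. exact: (gen_coord_neq0 hn hG). Qed.

Lemma support_on_curve i : on_curve f (R i).
Proof. by case: i => [l|s]; [apply: coord_point_on_curve|apply: hQ]. Qed.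

Lemma same_point_sym P P' : same_point P P' -> same_point P' P.
Proof.
move=> [c c0 ->]; exists c^-1; first by rewrite invr_eq0.
by rewrite scalerA mulVf // scale1r.
Qed.

Lemma support_distinct i j : i != j -> ~ same_point (R i) (R j).
Proof.
case: i j => [l|s] [l'|s'] ne.
- by move/(@coord_point_inj F) => e; rewrite e eqxx in ne.
- by move/same_point_sym/hQP.
- exact: hQP.
- exact: hQQ.
Qed.

Lemma support_place_inj : injective vR.
Proof.
move=> i j e; apply/eqP/negPn/negP => /support_distinct; apply.
apply: (place_at_same hn hG curve_smooth separable_root (support_on_curve i) (support_on_curve j)).
  exact: vR_at.
rewrite e; exact: vR_at.
Qed.

Lemma support_placeP v i : place_at v (R i) <-> v = vR i.
Proof.
split=> [vi|->]; last exact: vR_at.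
exact: (place_at_eq hn hG curve_smooth separable_root (support_on_curve i) vi (@vR_at i)).
Qed.

(* The Riemann-Roch space of the divisor e H - \sum_i a_i R_i, its elements
   being given as quotients of forms whose degrees differ by e. *)
Definition Lsp e a z : Prop :=
  (forall v, (forall i, v <> vR i) -> val_ge v z (e%:Z * mu v)) /\
  forall i, val_ge (vR i) z (e%:Z * mu (vR i) + a i).

Lemma Lsp_subspace e a : subspace k (Lsp e a).
Proof.
split; first by split; move=> *; left.
move=> x y z w [hz hz'] [hw hw']; split=> [v hv|i]; apply: val_geD; apply: val_geZ; auto.
Qed.

Lemma Lsp_le e a b z : (forall i, b i <= a i) -> Lsp e a z -> Lsp e b z.
Proof. by move=> le [h h']; split=> // i; apply: val_ge_le (h' i); rewrite lerD2l. Qed.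

Lemma Lsp_ext e a b z : a =1 b -> Lsp e a z -> Lsp e b z.
Proof. by move=> ab; apply: Lsp_le => i; rewrite ab. Qed.

Lemma Lsp_form e z : Lsp e (fun=> 0) z <-> form e z.
Proof.
split=> [[h h']|fz]; last by split=> [v _|i]; rewrite ?addr0; apply: val_ge_form.
apply: (form_integral hn hG curve_smooth separable_root) => v.
have [[i ->]|no] := pselect (exists i, v = vR i); first by have := h' i; rewrite addr0.
by apply: h => i e'; apply: no; exists i.
Qed.

Lemma LspM e e' a b z w : Lsp e a z -> Lsp e' b w ->
  Lsp (e + e') (fun i => a i + b i) (z * w).
Proof.
move=> [hz hz'] [hw hw']; split=> [v hv|i]; rewrite PoszD mulrDl.
  by apply: val_geM; auto.
by rewrite addrACA; apply: val_geM.
Qed.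

Definition monomial c : K := \prod_l X l ^+ c l.

(** At P_l the coordinates X_l, X_(l+1), X_(l+2) have orders 0, 1 and n, and no coordinate vanishes
    at a point Q_s. *)
Definition monomial_div c (i : J) : int :=
  if i is inl l then (c (ordS l))%:Z + n%:Z * (c (ordS (ordS l)))%:Z else 0.

Lemma monomial_neq0 c : monomial c != 0.
Proof. by apply/prodf_neq0 => l _; rewrite expf_neq0. Qed.

Lemma monomial_val v c : v (monomial c) = \sum_l (c l)%:Z * v (X l).
Proof.
rewrite /monomial place_prod => [|l]; last by rewrite expf_neq0.
by apply: eq_bigr => l _; rewrite placeX.
Qed.

Lemma sum_natZ (c : 'I_3 -> nat) (x : int) : \sum_l (c l)%:Z * x = (\sum_l c l)%N%:Z * x.
Proof. by rewrite -mulr_suml (big_morph _ PoszD (erefl _)). Qed.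

Lemma monomial_val_off v c : (forall l, v <> vR (inl l)) ->
  v (monomial c) = (\sum_l c l)%N%:Z * mu v.
Proof.
move=> hv; rewrite monomial_val -sum_natZ; apply: eq_bigr => l _.
rewrite (coord_val_not hn hG curve_smooth separable_root) // => l' /(support_placeP _ (inl l')).
exact: hv.
Qed.

Lemma monomial_val_at c i :
  vR i (monomial c) = (\sum_l c l)%N%:Z * mu (vR i) + monomial_div c i.
Proof.
case: i => [l|s]; last first.
  by rewrite addr0; apply: monomial_val_off => l /support_place_inj.
have [h0 h1 h2] := coord_val_at hn hG curve_smooth separable_root (@vR_at (inl l)).
rewrite monomial_val -sum_natZ.
have d01 : l != ordS l by rewrite eq_sym ordS_neq.
have d12 : ordS l != ordS (ordS l) by rewrite eq_sym ordS_neq.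
have d02 : l != ordS (ordS l) by rewrite eq_sym ordSS_neq.
by rewrite !(big_I3_distinct _ d01 d12 d02) h0 h1 h2 /=; ring.
Qed.

Lemma monomial_form c : form (\sum_l c l) (monomial c).
Proof.
by rewrite /monomial; elim/big_ind2: _ => [|d x e y h1 h2|l _];
  [apply: form1|apply: formM|apply: formXn].
Qed.

Lemma Lsp_monomial e a c z :
  Lsp (e + \sum_l c l) (fun i => a i + monomial_div c i) (z * monomial c) <-> Lsp e a z.
Proof.
split=> -[h h']; split=> [v hv|i].
- have := h v hv; rewrite val_geMr ?monomial_neq0 // monomial_val_off => [|l]; last exact: hv.
  by rewrite PoszD mulrDl addrK.
- have := h' i; rewrite val_geMr ?monomial_neq0 // monomial_val_at.
  by rewrite PoszD mulrDl addrACA addrK.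
- rewrite val_geMr ?monomial_neq0 // monomial_val_off => [|l]; last exact: hv.
  by rewrite PoszD mulrDl addrK; apply: h.
- rewrite val_geMr ?monomial_neq0 // monomial_val_at.
  by rewrite PoszD mulrDl addrACA addrK; apply: h'.
Qed.

Lemma val_ge_subspace v x : subspace k (fun z => val_ge v z x).
Proof. by split; [left|move=> r s z w hz hw; apply: val_geD; apply: val_geZ]. Qed.

(** Because the residue field at a rational point is F, each further order of vanishing there costs
    at most one dimension. *)
Lemma val_ge_relation i x z w : val_ge (vR i) z x -> val_ge (vR i) w x ->
  exists r s, (r != 0) || (s != 0) /\ val_ge (vR i) (k r * z + k s * w) (x + 1).
Proof.
move=> hz hw; have [hw1|hw1] := pselect (val_ge (vR i) w (x + 1)).
  by exists 0, 1; rewrite rmorph0 mul0r add0r rmorph1 mul1r oner_neq0 orbT.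
have w0 : w != 0 by apply: contra_notN hw1 => /eqP ->; left.
have vw : vR i w = x by move: hw hw1; rewrite !val_ge_neq0 //; lia.
have [|r hr] := rational_value hn hG curve_smooth separable_root (support_on_curve i)
  (@vR_at i) (z := z / w).
  by rewrite val_geMr ?invr_eq0 // placeV opprK vw add0r.
exists 1, (- r); rewrite oner_neq0; split=> //.
have -> : k 1 * z + k (- r) * w = (z / w - k r) * w.
  by rewrite rmorph1 mul1r rmorphN mulNr mulrBl mulfVK.
by rewrite val_geMr // vw addrAC subrr add0r.
Qed.

Definition vanishing U a (b : J -> nat) z : Prop :=
  U z /\ forall i, val_ge (vR i) z (a i + (b i)%:Z).

Lemma vanishing_subspace U a (b : J -> nat) : subspace k U -> subspace k (vanishing U a b).
Proof.
move=> [U0 UD]; split; first by split=> // i; left.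
move=> r s z w [hz hz'] [hw hw']; split; first exact: UD.
by move=> i; apply: (proj2 (val_ge_subspace _ _)).
Qed.

Lemma vanishing_step U a (b : J -> nat) : subspace k U ->
  (forall z, U z -> forall i, val_ge (vR i) z (a i)) ->
  (forall r, dimge k U (r + \sum_i b i) -> dimge k (vanishing U a b) r) /\
  (forall r, dimle k (vanishing U a b) r -> dimle k U (r + \sum_i b i)).
Proof.
move=> sU Ua; have [N] := ubnP (\sum_i b i); elim: N b => // N IH b lt.
have [/eqP e0|ne0] := boolP (\sum_i b i == 0)%N.
  have b0 i : b i = 0%N by apply/eqP; move/eqP: e0; rewrite sum_nat_eq0 => /forallP /(_ i).
  have h z : U z -> vanishing U a b z by move=> Uz; split=> // i; rewrite b0 addr0; apply: Ua.
  by rewrite e0; split=> r; rewrite addn0; [apply: dimge_sub|apply: dimle_sub].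
have [j bj] : exists j, (0 < b j)%N.
  apply: contrapT => no; case/eqP: ne0; apply: big1 => i _.
  by apply/eqP; rewrite -leqn0 leqNgt; apply/negP => h; apply: no; exists i.
pose b' i := (b i - (i == j))%N.
have sb : (\sum_i b i = (\sum_i b' i).+1)%N.
  rewrite (bigD1 j) //= [in RHS](bigD1 j) //= /b' eqxx -addSn; congr (_ + _)%N; first by lia.
  by apply: eq_bigr => i ij; rewrite (negbTE ij) subn0.
have [|h1 h2] := IH b'; first by rewrite sb in lt.
have rel z w : vanishing U a b' z -> vanishing U a b' w ->
    exists r s, (r != 0) || (s != 0) /\ vanishing U a b (k r * z + k s * w).
  move=> hz hw; have [r [s [rs h]]] := val_ge_relation (proj2 hz j) (proj2 hw j).
  exists r, s; split=> //; have [h3 h4] := proj2 (vanishing_subspace a b' sU) r s z w hz hw.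
  split=> // i; have [->|ij] := eqVneq i j.
    by apply: val_ge_le h; rewrite /b' eqxx; lia.
  by have := h4 i; rewrite /b' (negbTE ij) subn0.
split=> r; rewrite sb -addSnnS.
  by move/h1; apply: dimge_codim1 => //; apply: vanishing_subspace.
move=> h; apply: h2; apply: dimle_codim1 rel h; exact: vanishing_subspace.
Qed.

Lemma Lsp_vanishing e a (b : J -> nat) z :
  vanishing (Lsp e a) (fun i => e%:Z * mu (vR i) + a i) b z <-> Lsp e (fun i => a i + (b i)%:Z) z.
Proof.
split=> [[[h _] h']|h]; first by split=> // i; rewrite addrA.
split; first by apply: Lsp_le h => i; lia.
by move=> i; rewrite -addrA; apply: (proj2 h).
Qed.

Lemma Lsp_cut_ge e a (b : J -> nat) r : dimge k (Lsp e a) (r + \sum_i b i) ->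
  dimge k (Lsp e (fun i => a i + (b i)%:Z)) r.
Proof.
have [h _] := vanishing_step b (Lsp_subspace e a) (fun z (hz : Lsp e a z) => proj2 hz).
by move/h; apply: dimge_sub => z /Lsp_vanishing.
Qed.

Lemma Lsp_cut_le e a (b : J -> nat) r : dimle k (Lsp e (fun i => a i + (b i)%:Z)) r ->
  dimle k (Lsp e a) (r + \sum_i b i).
Proof.
have [_ h] := vanishing_step b (Lsp_subspace e a) (fun z (hz : Lsp e a z) => proj2 hz).
by move=> h'; apply: h; apply: dimle_sub h' => z /Lsp_vanishing.
Qed.

Lemma Lsp_twist a : exists N : nat, forall l, 0 <= a (inl l) + n.+1%:Z * N%:Z.
Proof.
exists (\sum_l absz (a (inl l)))%N => l.
have le : (absz (a (inl l)) <= \sum_l absz (a (inl l)))%N by rewrite (bigD1 l) //= leq_addr.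
by move: le; move: (\sum_l _)%N (a (inl l)) => N x; nia.
Qed.

Lemma sum_J (T : nmodType) (g : J -> T) : \sum_i g i = \sum_l g (inl l) + \sum_s g (inr s).
Proof. by rewrite big_sumType. Qed.

(* [monomial_div (fun=> N)] is the divisor of (X_0 X_1 X_2)^N. *)
Lemma sum_twist N a : \sum_i (a i + monomial_div (fun=> N) i) = \sum_i a i + 3 * (n.+1%:Z * N%:Z).
Proof.
rewrite big_split /=; congr (_ + _); rewrite sum_J /= [X in _ + X]big1 // addr0.
by rewrite !big_ord_recl big_ord0; lia.
Qed.

Lemma sum_const3 N : (\sum_(l < 3) N = 3 * N)%N.
Proof. by rewrite sum_nat_const card_ord. Qed.

Lemma twist_nonneg a N : (forall s, 0 <= a (inr s)) ->
  (forall l, 0 <= a (inl l) + n.+1%:Z * N%:Z) ->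
  exists b : J -> nat, forall i, a i + monomial_div (fun=> N) i = (b i)%:Z.
Proof.
move=> h h'; exists (fun i => absz (a i + monomial_div (fun=> N) i)) => i.
rewrite gez0_abs //; case: i => [l|s] /=; last by rewrite addr0.
by have := h' l; lia.
Qed.

Lemma Lsp_degree e a z : (forall s, 0 <= a (inr s)) -> Lsp e a z -> z != 0 ->
  \sum_i a i <= n.+1%:Z * e%:Z.
Proof.
move=> ha hz z0; have [N hN] := Lsp_twist a; have [b hb] := twist_nonneg ha hN.
have := proj2 (Lsp_monomial e a (fun=> N) z) hz; set w := z * _ => hw.
have w0 : w != 0 by rewrite mulf_neq0 ?monomial_neq0.
have fw : form (e + \sum_(l < 3) N) w.
  by apply/Lsp_form; apply: Lsp_le hw => i; rewrite hb.
have := @bezout_rational _ _ hn _ hG K _ iL curve_smooth separable_root _ R vR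
  support_on_curve support_distinct vR_at _ w b fw w0.
have hw' i : val_ge (vR i) w ((e + \sum_(l < 3) N)%N%:Z * mu (vR i) + (b i)%:Z).
  by rewrite -hb; apply: (proj2 hw).
move/(_ hw').
have := sum_twist N a; rewrite (eq_bigr _ (fun i _ => hb i)).
rewrite -(big_morph _ PoszD (erefl _)) sum_const3; move: (\sum_i b i)%N (\sum_i a i) => x y.
by clear; nia.
Qed.

(** Riemann's inequality with genus 'C(n, 2). Forms of degree e + 3 N are subjected to the shifted
    vanishing conditions, at most one dimension per order, and then divided by (XYZ)^N. *)
Lemma Lsp_riemann e a r : (forall s, 0 <= a (inr s)) ->
  r%:Z + 'C(n, 2)%:Z + \sum_i a i <= n.+1%:Z * e%:Z + 1 -> dimge k (Lsp e a) r.
Proof.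
move=> ha hr; have [N hN] := Lsp_twist a; have [b hb] := twist_nonneg ha hN.
have hf : dimge k (form (K := K) (e + 3 * N)) (r + \sum_i b i).
  apply: dimge_form => //; move: hr.
  have := sum_twist N a; rewrite (eq_bigr _ (fun i _ => hb i)).
  rewrite -(big_morph _ PoszD (erefl _)); move: (\sum_i b i)%N (\sum_i a i) 'C(n, 2) => x y c.
  by clear; nia.
have h : dimge k (Lsp (e + 3 * N) (fun i => 0 + (b i)%:Z)) r.
  by apply: Lsp_cut_ge; apply: dimge_sub hf => z /Lsp_form.
have := dimge_mul (invr_neq0 (monomial_neq0 (fun=> N))) h.
apply: dimge_sub => z [w hw ->]; apply/(Lsp_monomial e a (fun=> N)).
rewrite mulrAC mulVf ?monomial_neq0 // mul1r sum_const3.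
by apply: Lsp_ext hw => i; rewrite add0r hb.
Qed.

End RationalDivisors.

(** * Residues *)

Section Residues.

Variables (F : fieldType) (n : nat) (hn : (3 <= n)%N).
Variables (G : {mpoly F[3]}) (hG : G \is (n - 2)%N.-homog).
Local Notation f := (curve_poly n G).
Variable K : function_field f.
Local Notation k := (ff_const K).
Local Notation X := (gen_coord K).
Local Notation fev := (mev k X).
Variables (L : closedFieldType) (iL : {rmorphism F -> L}).
Hypothesis curve_smooth : forall P : 'I_3 -> L, (exists i, P i != 0) ->
  mev iL P f = 0 -> exists s, mev iL P f^`M(s) != 0.
Hypothesis separable_root : forall x : L, exists t : {poly F},
  ev1 iL x t = 0 /\ t^`() = -1.

Variables (m : nat) (Q : 'I_m -> 'rV[F]_3).
Hypothesis hQ : forall s, on_curve f (Q s).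
Hypothesis hQP : forall s (l : 'I_3), ~ same_point (Q s) (delta_mx 0 l).
Hypothesis hQQ : forall s t, s != t -> ~ same_point (Q s) (Q t).

Local Notation J := ('I_3 + 'I_m)%type.

Variable vR : J -> place K.
Local Notation R := (support_point Q).
Hypothesis vR_at : forall i, place_at (vR i) (R i).
Local Notation Lsp := (Lsp (K := K) vR).

Implicit Types (v : place K) (e : nat) (a : J -> int) (z w : K) (p q : pred J).

Let R_curve := support_on_curve hn hG hQ.
Let vR_inj := support_place_inj hn hG curve_smooth separable_root hQ hQP hQQ vR_at.

Local Notation W i := ((n - 2)%N%:Z * mu (vR i)).

Variable kap : J -> K.
Hypothesis kap_neq0 : forall i, kap i != 0.
Hypothesis kap_val : forall i, vR i (kap i) = 1 - W i.

Definition polar i z : Prop := val_ge (vR i) z (W i - 1).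

(* For [om] the differential of divisor (n - 2) H and a suitable [kap], the
   residue of z om at the rational point i is the value at i of z kap_i. *)
Definition res i z : F :=
  if pselect (exists c, val_ge (vR i) (z * kap i - k c) 1) is left h then projT1 (cid h) else 0.

Lemma val_ge_const_uniq v z r s : val_ge v (z - k r) 1 -> val_ge v (z - k s) 1 -> r = s.
Proof.
move=> hr hs; apply/eqP; rewrite -subr_eq0; apply/eqP; apply: (@const_small _ _ _ _ v).
have -> : k (r - s) = (z - k s) - (z - k r) by rewrite rmorphB /=; ring.
exact: val_geB.
Qed.

Lemma res_eq i z c : val_ge (vR i) (z * kap i - k c) 1 -> res i z = c.
Proof.
move=> h; rewrite /res; case: pselect => [ex|[]]; last by exists c.
by case: (cid ex) => c' /= h'; apply: val_ge_const_uniq h' h.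
Qed.

Lemma resP i z : polar i z -> val_ge (vR i) (z * kap i - k (res i z)) 1.
Proof.
move=> hz; suff [c h] : exists c, val_ge (vR i) (z * kap i - k c) 1 by rewrite (res_eq h).
apply: (rational_value hn hG curve_smooth separable_root (R_curve i) (@vR_at i)).
by rewrite val_geMr // kap_val; apply: val_ge_le hz; lia.
Qed.

Lemma polar_comb i (r s : F) z w : polar i z -> polar i w -> polar i (k r * z + k s * w).
Proof. by move=> hz hw; apply: val_geD; apply: val_geZ. Qed.

Lemma resL i (r s : F) z w : polar i z -> polar i w ->
  res i (k r * z + k s * w) = r * res i z + s * res i w.
Proof.
move=> hz hw; apply: res_eq.
have -> : (k r * z + k s * w) * kap i - k (r * res i z + s * res i w)
    = k r * (z * kap i - k (res i z)) + k s * (w * kap i - k (res i w)).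
  by rewrite rmorphD !rmorphM /=; ring.
by apply: val_geD; apply: val_geZ; apply: resP.
Qed.

Lemma res_regular i z : polar i z -> res i z = 0 <-> val_ge (vR i) z (W i).
Proof.
move=> hz; split=> [r0|h].
  have := resP hz; rewrite r0 rmorph0 subr0 val_geMr // kap_val.
  by apply: val_ge_le; lia.
by apply: res_eq; rewrite rmorph0 subr0 val_geMr // kap_val; apply: val_ge_le h; lia.
Qed.

Lemma res_mul i z w c : polar i z -> val_ge (vR i) (w - k c) 1 -> res i (z * w) = res i z * c.
Proof.
move=> hz hw; apply: res_eq.
have -> : z * w * kap i - k (res i z * c)
    = (z * kap i) * (w - k c) + k c * (z * kap i - k (res i z)) by rewrite rmorphM /=; ring.
apply: val_geD; last exact/val_geZ/resP.
by rewrite -[1]add0r; apply: val_geM => //; rewrite val_geMr // kap_val; apply: val_ge_le hz; lia.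
Qed.

Lemma polar0 i : polar i 0. Proof. by left. Qed.

Lemma res0 i : res i 0 = 0.
Proof. by apply/(res_regular (polar0 i)); left. Qed.

Lemma res_sum i (I : finType) (c : I -> F) (u : I -> K) : (forall t, polar i (u t)) ->
  polar i (\sum_t k (c t) * u t) /\ res i (\sum_t k (c t) * u t) = \sum_t c t * res i (u t).
Proof.
move=> hu; apply: (big_rec2 (fun x y => polar i y /\ res i y = x)).
  by split; [apply: polar0|apply: res0].
move=> t x y _ [hy ey]; have := resL (c t) 1 (hu t) hy; rewrite rmorph1 !mul1r ey => <-.
by split=> //; have := polar_comb (c t) 1 (hu t) hy; rewrite rmorph1 mul1r.
Qed.

Definition poles p : J -> int := fun i => - (p i : nat)%:Z.

Lemma Lsp_polar a z i : -1 <= a i -> Lsp (n - 2) a z -> polar i z.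
Proof. by move=> ai [_ h]; apply: val_ge_le (h i); rewrite lerD2l. Qed.

Lemma poles_ge p i : -1 <= poles p i.
Proof. by rewrite /poles; case: (p i). Qed.

Lemma Lsp_poles_sub p q z : (forall i, p i -> q i) -> Lsp (n - 2) (poles p) z ->
  Lsp (n - 2) (poles q) z.
Proof.
by move=> pq; apply: Lsp_le => i; rewrite /poles; case: (p i) (pq i) => [->|] //; case: (q i).
Qed.

Lemma Lsp_poles_res p q z : Lsp (n - 2) (poles p) z ->
  (forall i, p i -> ~~ q i -> res i z = 0) -> Lsp (n - 2) (poles q) z.
Proof.
move=> hz hr; have [h1 h2] := hz; split=> // i.
have := h2 i; rewrite /poles; case pi: (p i); case qi: (q i) => //=; rewrite ?subr0.
  move=> _; apply/(res_regular (Lsp_polar (poles_ge p i) hz)).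
  by apply: hr; rewrite ?pi ?qi.
by apply: val_ge_le; lia.
Qed.

Lemma one_pole_form i z : Lsp (n - 2) (poles (pred1 i)) z -> form (n - 2) z.
Proof.
move=> [h h']; apply: (no_single_pole hn hG curve_smooth separable_root (R_curve i) (@vR_at i)).
- by move: hn; clear; lia.
- move=> v vi; have [[j ej]|no] := pselect (exists j, v = vR j); last first.
    by apply: h => j ej; apply: no; exists j.
  rewrite ej; have := h' j; rewrite /poles /=; case: eqP => [eji|_]; last by rewrite subr0.
  by case: vi; rewrite ej eji.
- by have := h' i; rewrite /poles /= eqxx.
Qed.

(** The function of [pole_pair] is not a form, so by [one_pole_form] both of its residues are
    nonzero; it is then scaled to have residue 1 at Q_s. *)
Lemma two_poles_exists s : exists h, Lsp (n - 2) (poles (pred2 (inr s) (inl 0))) h /\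
  [/\ res (inr s) h = 1 & res (inl 0) h != 0].
Proof.
(* Q_s differs from P_1, so it has a nonzero coordinate of index i other than 0; j is the remaining
   index. *)
have [i [j [oi ij oj Qi]]] : exists i j : 'I_3, [/\ 0 != i, i != j, 0 != j & Q s 0 i != 0].
  have [h1|h1] := eqVneq (Q s 0 1) 0; last by exists 1, 2.
  have [h2|h2] := eqVneq (Q s 0 2) 0; last by exists 2, 1.
  case: (@hQP s 0); exists (Q s 0 0).
    apply/negP => /eqP h0; case: (hQ s) => /eqP + _; apply; apply/rowP => i; rewrite mxE.
    by case: (I3_cases i) => ->.
  apply/rowP => i; rewrite !mxE; case: (I3_cases i) => ->; rewrite ?h1 ?h2 ?mulr0 //.
  by rewrite !eqxx mulr1.
have [h [h1 h2 h3 h4]] := pole_pair hn hG curve_smooth separable_root oi ij oj (hQ s) Qi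
  (@vR_at (inr s)) (@vR_at (inl 0)).
have hL : Lsp (n - 2) (poles (pred2 (inr s) (inl 0))) h.
  split=> [v hv|i0]; first by apply: h1; apply: hv.
  rewrite /poles /=; case: eqP => [->//|ns]; case: eqP => [->//|n0].
  by rewrite subr0; apply: h1 => /vR_inj.
have hp i0 := Lsp_polar (poles_ge _ i0) hL.
have r1 : res (inr s) h != 0.
  apply/eqP => r0; apply: h4; apply: (@one_pole_form (inl 0)); apply: Lsp_poles_res hL _.
  by move=> i0 /orP[/eqP -> //|/= ->].
have r2 : res (inl 0) h != 0.
  apply/eqP => r0; apply: h4; apply: (@one_pole_form (inr s)); apply: Lsp_poles_res hL _.
  by move=> i0 /orP[/= -> //|/eqP -> //].
exists (k (res (inr s) h)^-1 * h + k 0 * 0); split.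
  by apply: (proj2 (Lsp_subspace _ _ _)) => //; apply: (proj1 (Lsp_subspace _ _ _)).
rewrite !resL //; try exact: polar0.
by rewrite !mul0r !addr0 mulVf //; split=> //; rewrite mulf_neq0 // invr_eq0.
Qed.

Definition is_inr (i : J) : bool := if i is inr _ then true else false.

(* The residue theorem up to the unspecified nonzero weights rho *)
Lemma residue_relation : exists rho : 'I_m -> F, (forall s, rho s != 0) /\
  forall z, Lsp (n - 2) (poles is_inr) z -> \sum_s rho s * res (inr s) z = 0.
Proof.
have [h hh] := choice two_poles_exists.
exists (fun s => res (inl 0) (h s)); split=> [s|z hz]; first by have [_ []] := hh s.
pose q := predU1 (inl 0) is_inr.
have hL s : Lsp (n - 2) (poles q) (h s).
  by apply: Lsp_poles_sub (proj1 (hh s)) => i' /orP[/eqP ->|/eqP ->]; rewrite /q /= ?eqxx.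
have zL : Lsp (n - 2) (poles q) z.
  by apply: Lsp_poles_sub hz => i' hi; rewrite /q /= hi orbT.
pose y := \sum_s k (res (inr s) z) * h s.
have yL : Lsp (n - 2) (poles q) y by apply: subspace_sum => //; apply: Lsp_subspace.
have hp i s : polar i (h s) := Lsp_polar (poles_ge q i) (hL s).
have zp i : polar i z := Lsp_polar (poles_ge q i) zL.
have yp i : polar i y := Lsp_polar (poles_ge q i) yL.
have ry i : res i y = \sum_s res (inr s) z * res i (h s).
  exact: (proj2 (res_sum _ (hp i))).
have : form (n - 2) (k 1 * z + k (-1) * y).
  apply: (@one_pole_form (inl 0)).
  apply: (Lsp_poles_res (p := q)); first exact: (proj2 (Lsp_subspace _ _ _)).
  move=> [l|t]; first by rewrite /q /= orbF => ->.
  move=> _ _; rewrite resL // ry (bigD1 t) //= big1 => [|s st].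
    by have [_ [-> _]] := hh t; rewrite mul1r mulr1 addr0 mulN1r subrr.
  have hs := hh s; have reg : val_ge (vR (inr t)) (h s) (W (inr t)).
    have [_ /(_ (inr t))] := proj1 hs; rewrite /poles /= orbF.
    by rewrite (inj_eq (@inr_inj _ _)) eq_sym (negbTE st) subr0.
  by rewrite (proj2 (res_regular (hp _ _)) reg) mulr0.
(* A form has residue 0 at P_1, and z has no pole there, so the residue of the combination y of the
   h_s vanishes at P_1. That is the relation, with the residues of the h_s at P_1 as weights. *)
move=> fy; have := res_regular (polar_comb 1 (-1) (zp (inl 0)) (yp (inl 0))).
case=> _ /(_ (val_ge_form _ fy)); rewrite resL //.
have -> : res (inl 0) z = 0.
  apply/(res_regular (zp _)); have [_ /(_ (inl 0))] := hz.
  by rewrite /poles /= subr0.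
rewrite mulr0 add0r mulN1r => /eqP; rewrite oppr_eq0 ry => /eqP {2}<-.
by apply: eq_bigr => s _; rewrite mulrC.
Qed.

(** The forms of degree n - 2 contribute 'C(n, 2) dimensions, and each h_s adds one, having a pole
    at Q_s that no earlier function has. *)
Lemma dimge_poles : dimge k (Lsp (n - 2) (poles (predU1 (inl 0) is_inr))) ('C(n, 2) + m).
Proof.
pose p t (i : J) := match i with inl l => l == 0 | inr s => (s < t)%N end.
suff h t : (t <= m)%N -> dimge k (Lsp (n - 2) (poles (p t))) ('C(n, 2) + t).
  apply: dimge_sub (h m (leqnn m)) => z; apply: Lsp_poles_sub => -[l|s] //= /eqP ->.
  by rewrite eqxx.
elim: t => [_|t IH tm].
  rewrite addn0; have n2 : (n - 2 <= n)%N by apply: leq_subr.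
  have := dimge_form_small hn hG K n2; have -> : (n - 2 + 2 = n)%N by move: hn; clear; lia.
  apply: dimge_sub => z /(Lsp_form hn hG curve_smooth separable_root vR).
  by apply: Lsp_le => i; rewrite /poles; case: (p _ _).
rewrite addnS; pose s := Ordinal tm; have [h [hL [r1 _]]] := two_poles_exists s.
apply: (dimge_ext (Lsp_subspace vR _ (poles (p t))) _ _ _ (IH (ltnW tm))).
- by move=> z; apply: Lsp_poles_sub => -[l|s'] //= /ltnW.
- apply: Lsp_poles_sub hL => i /orP[/eqP ->|/eqP ->] //=; exact: ltnSn.
move=> [_ /(_ (inr s))]; rewrite /poles /= ltnn subr0.
move/(res_regular (Lsp_polar (poles_ge _ _) hL)).
by rewrite r1 => /eqP; rewrite oner_eq0.
Qed.

End Residues.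

(** * The code *)

Section Code.

Variables (F : fieldType) (n : nat) (hn : (3 <= n)%N).
Variables (G : {mpoly F[3]}) (hG : G \is (n - 2)%N.-homog).
Local Notation f := (curve_poly n G).
Variable K : function_field f.
Local Notation k := (ff_const K).
Local Notation X := (gen_coord K).
Local Notation fev := (mev k X).
Variables (L : closedFieldType) (iL : {rmorphism F -> L}).
Hypothesis curve_smooth : forall P : 'I_3 -> L, (exists i, P i != 0) ->
  mev iL P f = 0 -> exists s, mev iL P f^`M(s) != 0.
Hypothesis separable_root : forall x : L, exists t : {poly F},
  ev1 iL x t = 0 /\ t^`() = -1.

Variables (m : nat) (Q : 'I_m -> 'rV[F]_3).
Hypothesis hQ : forall s, on_curve f (Q s).
Hypothesis hQP : forall s (l : 'I_3), ~ same_point (Q s) (delta_mx 0 l).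
Hypothesis hQQ : forall s t, s != t -> ~ same_point (Q s) (Q t).

Local Notation J := ('I_3 + 'I_m)%type.

Variable vR : J -> place K.
Local Notation R := (support_point Q).
Hypothesis vR_at : forall i, place_at (vR i) (R i).
Local Notation Lsp := (Lsp (K := K) vR).

Implicit Types (v : place K) (e : nat) (a : J -> int) (z w : K) (p q : pred J).

Local Notation W i := ((n - 2)%N%:Z * mu (vR i)).

Variable kap : J -> K.
Hypothesis kap_neq0 : forall i, kap i != 0.
Hypothesis kap_val : forall i, vR i (kap i) = 1 - W i.


Local Notation res := (res vR kap).
Local Notation monomial := (monomial K).

Variables (D : 'I_3 -> nat).

Definition code_div (i : J) : int := if i is inl l then (D l)%:Z else -1.

Lemma sum_J_inl (a : J -> int) (x : 'I_3 -> int) y : (forall l, a (inl l) = x l) ->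
  (forall s, a (inr s) = y) -> \sum_i a i = \sum_l x l + m%:Z * y.
Proof.
move=> h h'; rewrite sum_J; congr (_ + _); first exact: eq_bigr.
by rewrite (eq_bigr _ (fun s _ => h' s)) sumr_const card_ord -mulr_natl natz.
Qed.

Hypothesis D_large : (n.+1 * (n - 2) < \sum_l D l)%N.
Hypothesis D_small : (\sum_l D l < m)%N.

Variable C : {vspace 'rV[F]_m}.
Hypothesis C_code : forall c : 'rV[F]_m,
  c \in C <-> exists2 z, Lsp (n - 2) code_div z & forall s, c 0 s = res (inr s) z.

Lemma code_polar i z : Lsp (n - 2) code_div z -> polar vR i z.
Proof. by apply: Lsp_polar; case: i. Qed.

(** If all residues vanish, z lies in L((n - 2) H - D), and [D_large] makes the degree of this
    divisor negative. *)
Lemma code_res_inj z : Lsp (n - 2) code_div z -> (forall s, res (inr s) z = 0) -> z = 0.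
Proof.
move=> hz r0; apply/eqP/negPn/negP => z0.
pose a (i : J) : int := if i is inl l then (D l)%:Z else 0.
have ha : Lsp (n - 2) a z.
  split=> [|i]; first by case: hz.
  case: i => [l|s]; first exact: (proj2 hz (inl l)).
  rewrite addr0; apply/(res_regular hn hG curve_smooth separable_root hQ vR_at kap_neq0 kap_val)
    => //.
  exact: code_polar.
have := Lsp_degree hn hG curve_smooth separable_root hQ hQP hQQ vR_at (fun s => lexx 0) ha z0.
rewrite (@sum_J_inl _ (fun l => (D l)%:Z) 0) // mulr0 addr0 -(big_morph _ PoszD (erefl _)).
by move: D_large; clear; move: (\sum_l D l)%N => x; lia.
Qed.

(** In L((n - 2) H + P_1 + sum of the Q_s), of dimension at least 'C(n, 2) + m, the orders D_l are
    imposed at the P_l. One further condition at P_1 removes the auxiliary pole, which is the 1 in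
    the formula. By [code_res_inj] the residues lose nothing. *)
Lemma code_dim_ge : (m + 'C(n, 2) <= \dim C + \sum_l D l + 1)%N.
Proof.
pose b (i : J) := if i is inl l then (D l + (l == 0)%R)%N else 0%N.
have sb : (\sum_i b i = \sum_l D l + 1)%N.
  rewrite sum_J /= [X in _ + X]big1 // addr0 big_split /=; congr addn.
  by rewrite (bigD1 0) //= big1 // => l /negbTE ->.
have [le|lt] := leqP (\sum_i b i) ('C(n, 2) + m); last by lia.
have hV : dimge k (Lsp (n - 2) code_div) ('C(n, 2) + m - \sum_i b i).
  have h : dimge k (Lsp (n - 2) (poles (predU1 (inl 0) (@is_inr m))))
      ('C(n, 2) + m - \sum_i b i + \sum_i b i).
    rewrite subnK //.
    exact: (dimge_poles hn hG curve_smooth separable_root hQ hQP hQQ vR_at kap_neq0 kap_val).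
  apply: dimge_sub (Lsp_cut_ge hn hG curve_smooth separable_root hQ vR_at h) => z.
  apply: Lsp_le => -[l|s] //=; rewrite /poles /= orbF.
  by rewrite (inj_eq (@inl_inj _ _)); case: (l == 0); lia.
have [u [Uu fu]] := hV; set r := (_ - _)%N in u Uu fu.
pose w := [tuple (\row_s res (inr s) (u i)) | i < r].
have wi (i : 'I_r) : w`_i = \row_s res (inr s) (u i) by rewrite -tnth_nth tnth_mktuple.
have fw : free w.
  apply/freeP => c e; apply: fu; apply: code_res_inj.
    by apply: subspace_sum => //; apply: Lsp_subspace.
  move=> s; have hu t : polar vR (inr s) (u t) by apply: code_polar.
  have [_ ->] := res_sum hn hG curve_smooth separable_root hQ vR_at kap_neq0 kap_val c hu.
  have := congr1 (fun x : 'rV[F]_m => x 0 s) e; rewrite summxE mxE => {2}<-.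
  by apply: eq_bigr => i _; rewrite wi !mxE.
have : (r <= \dim C)%N.
  have -> : r = \dim <<w>> by move: fw; rewrite /free size_tuple => /eqP.
  apply: dimvS; apply/span_subvP => x /(nthP 0) [i]; rewrite size_tuple => ir <-.
  rewrite (wi (Ordinal ir)); apply/C_code; exists (u (Ordinal ir)) => // s.
  by rewrite mxE.
by rewrite /r; lia.
Qed.

(* The rational functions with poles bounded by D are orthogonal to the code
   for the weighted product. *)
Lemma code_dim_le : (\dim C + \sum_l D l + 1 <= m + 'C(n, 2))%N.
Proof.
have [rho [rho0 hrho]] := residue_relation hn hG curve_smooth separable_root hQ hQP hQQ vR_at
  kap_neq0 kap_val.
pose a (i : J) : int := if i is inl l then - (D l)%:Z else 0.
have sD : \sum_l - (D l)%:Z = - (\sum_l D l)%N%:Z :> int.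
  by rewrite sumrN (big_morph _ PoszD (erefl _)).
have [le|lt] := leqP ('C(n, 2)) (\sum_l D l + 1); last first.
  have := bin2_double n.-1; rewrite prednK ?(ltn_trans _ hn) // => bn.
  by move: bn lt D_large hn; clear; case: n => [|n'] //=; nia.
set r := (\sum_l D l + 1 - 'C(n, 2))%N.
have [y [Ly fy]] : dimge k (Lsp 0 a) r.
  apply: (Lsp_riemann hn hG curve_smooth separable_root hQ hQP hQQ vR_at) => //.
  rewrite (@sum_J_inl _ (fun l => - (D l)%:Z) 0) // sD mulr0 addr0 mulr0.
  by rewrite /r; move: le; clear; move: 'C(n, 2) (\sum_l D l)%N => x z; lia.
have yreg t s : val_ge (vR (inr s)) (y t) 0.
  by have [_ /(_ (inr s))] := Ly t; rewrite mul0r addr0.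
have /choice [val hval] : forall ts : 'I_r * 'I_m, exists c,
    val_ge (vR (inr ts.2)) (y ts.1 - k c) 1.
  move=> [t s]; apply: (rational_value hn hG curve_smooth separable_root (hQ s) (@vR_at (inr s))).
  exact: yreg.
pose E : 'M[F]_(m, r) := \matrix_(s, t) (rho s * val (t, s)).
pose M : 'M[F]_(\dim C, m) := \matrix_i (vbasis C)`_i.
(* For y in L(D) the product z y has at most simple poles, at the Q_s only; its residue at Q_s is
   that of z times the value of y, and the residue relation applies. *)
have ME : M *m E = 0.
  apply/matrixP => i t; rewrite mxE mxE.
  have : (vbasis C)`_i \in C by apply: vbasis_mem; rewrite mem_nth // size_tuple.
  move=> /C_code [z hz ez].
  have hzy : Lsp (n - 2) (poles (@is_inr m)) (z * y t).
    have := LspM hz (Ly t); rewrite addn0; apply: Lsp_le => -[l|s] //=.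
    by rewrite subrr.
  rewrite -[RHS](hrho _ hzy); apply: eq_bigr => s _; rewrite !mxE ez mulrCA; congr (_ * _).
  apply/esym/(res_mul hn hG curve_smooth separable_root hQ vR_at kap_neq0 kap_val).
    exact: code_polar.
  exact: (hval (t, s)).
have rM : row_free M.
  apply: inj_row_free => v; rewrite mulmx_sum_row => e; apply/rowP => i; rewrite mxE.
  have /freeP fb := basis_free (vbasisP C); apply: fb; rewrite -[RHS]e.
  by apply: eq_bigr => i' _; rewrite rowK.
(* A function in L(D) vanishing at all the Q_s is 0, because [D_small] makes deg D - m negative. *)
have rE : row_free E^T.
  apply: inj_row_free => v e; apply/rowP => t0; rewrite mxE.
  suff : \sum_t k (v 0 t) * y t = 0 by move/fy.
  set z := \sum_t _; apply/eqP/negPn/negP => z0.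
  have Lz : Lsp 0 a z by apply: subspace_sum => //; apply: Lsp_subspace.
  pose a' (i : J) : int := if i is inl l then - (D l)%:Z else 1.
  have La' : Lsp 0 a' z.
    split=> [|[l|s]]; [by case: Lz|exact: (proj2 Lz (inl l))|].
    rewrite mul0r add0r.
    have e0 : \sum_t v 0 t * val (t, s) = 0.
      have := congr1 (fun x : 'rV[F]_m => x 0 s) e; rewrite !mxE => e'.
      apply: (mulfI (rho0 s)); rewrite mulr0 -[RHS]e' mulr_sumr; apply: eq_bigr => t _.
      by rewrite !mxE mulrCA.
    have -> : z = \sum_t k (v 0 t) * (y t - k (val (t, s))).
      under [RHS]eq_bigr => t _ do rewrite mulrBr.
      rewrite sumrB -/z; under [X in _ - X]eq_bigr => t _ do rewrite -rmorphM.
      by rewrite -rmorph_sum e0 rmorph0 subr0.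
    by apply: val_ge_sum => t _; apply: val_geZ; apply: (hval (t, s)).
  have := Lsp_degree hn hG curve_smooth separable_root hQ hQP hQQ vR_at (fun s => ler01) La' z0.
  rewrite (@sum_J_inl _ (fun l => - (D l)%:Z) 1) // sD mulr0 mulr1.
  by move: D_small; clear; move: (\sum_l D l)%N => x; lia.
have := mulmx0_rank_max ME; move/eqP: rM => ->; rewrite -mxrank_tr; move/eqP: rE => ->.
by rewrite /r; move: le; clear; move: (\dim C) 'C(n, 2) (\sum_l D l)%N => c x z; lia.
Qed.

End Code.

(** * The minimum distance *)

Section Distance.

Variables (F : fieldType) (n : nat) (hn : (3 <= n)%N).
Variables (G : {mpoly F[3]}) (hG : G \is (n - 2)%N.-homog).
Local Notation f := (curve_poly n G).
Variable K : function_field f.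
Local Notation k := (ff_const K).
Local Notation X := (gen_coord K).
Local Notation fev := (mev k X).
Variables (L : closedFieldType) (iL : {rmorphism F -> L}).
Hypothesis curve_smooth : forall P : 'I_3 -> L, (exists i, P i != 0) ->
  mev iL P f = 0 -> exists s, mev iL P f^`M(s) != 0.
Hypothesis separable_root : forall x : L, exists t : {poly F},
  ev1 iL x t = 0 /\ t^`() = -1.

Variables (m : nat) (Q : 'I_m -> 'rV[F]_3).
Hypothesis hQ : forall s, on_curve f (Q s).
Hypothesis hQP : forall s (l : 'I_3), ~ same_point (Q s) (delta_mx 0 l).
Hypothesis hQQ : forall s t, s != t -> ~ same_point (Q s) (Q t).

Local Notation J := ('I_3 + 'I_m)%type.

Variable vR : J -> place K.
Local Notation R := (support_point Q).
Hypothesis vR_at : forall i, place_at (vR i) (R i).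
Local Notation Lsp := (Lsp (K := K) vR).

Implicit Types (A : {mpoly F[3]}) (t : 'X_{1..3}) (v : place K) (e : nat) (a : J -> int) (z w : K).

Local Notation W i := ((n - 2)%N%:Z * mu (vR i)).

Variable kap : J -> K.
Hypothesis kap_neq0 : forall i, kap i != 0.
Hypothesis kap_val : forall i, vR i (kap i) = 1 - W i.


Local Notation res := (res vR kap).
Local Notation monomial := (monomial K).



Lemma fev_monomials A : fev A = \sum_(t <- msupp A) k A@_t * monomial t.
Proof. exact: mev_sum. Qed.

Lemma multideg_eq t t' l : mdeg t = mdeg t' -> t (ordS l) = t' (ordS l) ->
  t (ordS (ordS l)) = t' (ordS (ordS l)) -> t = t'.
Proof.
have d01 : l != ordS l by rewrite eq_sym ordS_neq.
have d12 : ordS l != ordS (ordS l) by rewrite eq_sym ordS_neq.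
have d02 : l != ordS (ordS l) by rewrite eq_sym ordSS_neq.
rewrite !mdegE !(big_I3_distinct _ d01 d12 d02) => e e1 e2; apply/mnmP => i.
by have [->|->|->] := I3_distinct d01 d12 d02 i => //; lia.
Qed.

Lemma monomial_val_corner r t l : mdeg t = r ->
  vR (inl l) (monomial t) = r%:Z * mu (vR (inl l)) + (t (ordS l) + n * t (ordS (ordS l)))%N%:Z.
Proof.
move=> <-; rewrite (monomial_val_at hn hG curve_smooth separable_root hQ hQP hQQ vR_at).
by rewrite mdegE /= PoszD PoszM.
Qed.

(* At a coordinate point the monomials of degree r <= n not involving the
   third variable have pairwise distinct orders. *)
Lemma corner_coeff0 r A l t : A \is r.-homog -> (r <= n)%N ->
  val_ge (vR (inl l)) (fev A) (r%:Z * mu (vR (inl l)) + r%:Z) ->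
  t (ordS (ordS l)) = 0%N -> (t (ordS l) < r)%N -> A@_t = 0.
Proof.
move=> hA rn vA; set v := vR (inl l) in vA *.
have [N] := ubnP (t (ordS l)); elim: N t => // N IH t ltN t2 tr.
apply/eqP/negPn/negP => At0; have tA : t \in msupp A by rewrite mcoeff_msupp.
have dt t' : t' \in msupp A -> mdeg t' = r by apply: dhomog_mdeg.
pose x := k A@_t * monomial t.
pose y := \sum_(t' <- msupp A | t' != t) k A@_t' * monomial t'.
have e : fev A = x + y by rewrite fev_monomials (bigD1_seq t) ?msupp_uniq.
have x0 : x != 0 by rewrite mulf_neq0 ?fmorph_eq0 ?(monomial_neq0 hn hG).
have vx : v x = r%:Z * mu v + (t (ordS l))%:Z.
  rewrite placeM ?fmorph_eq0 ?(monomial_neq0 hn hG) // place_const // add0r.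
  by rewrite (monomial_val_corner _ (dt t tA)) t2 muln0 addn0.
have hy : val_ge v y (v x + 1).
  rewrite /y big_seq_cond; apply: val_ge_sum => t' /andP[t'A ne].
  apply: val_geZ; right; rewrite (monomial_val_corner _ (dt t' t'A)) vx -addrA lerD2l -PoszD
    lez_nat.
  case e2 : (t' (ordS (ordS l))) => [|q]; last by move: tr rn; clear; nia.
  rewrite muln0 addn0 addn1 ltnNge; apply/negP => le.
  have [lt|ge] := ltnP (t' (ordS l)) (t (ordS l)).
    move: t'A; rewrite mcoeff_msupp IH ?eqxx //; first exact: leq_trans lt _.
    exact: ltn_trans lt tr.
  case/eqP: ne; apply: (@multideg_eq _ _ l); first by rewrite !dt.
    by apply/eqP; rewrite eqn_leq le ge.
  by rewrite e2 t2.
have [s0 vs] := place_addl x0 hy; move: vA; rewrite e val_ge_neq0 // vs vx.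
by rewrite lerD2l lez_nat leqNgt tr.
Qed.

(** Suppose the variable i is missing from t. At P_(i+1) it is the third variable, and
    [corner_coeff0] applies unless t is the pure power X_(i+2)^r; that monomial has order 0 at
    P_(i+2) and is excluded there. *)
Lemma corner_monomials_interior r A t i : A \is r.-homog -> (0 < r <= n)%N ->
  (forall l, val_ge (vR (inl l)) (fev A) (r%:Z * mu (vR (inl l)) + r%:Z)) ->
  t \in msupp A -> (0 < t i)%N.
Proof.
move=> hA /andP[r0 rn] hv tA; rewrite lt0n; apply/negP => /eqP ti.
have dt := dhomog_mdeg hA tA; move: tA; rewrite mcoeff_msupp => /eqP; apply.
have [lt|ge] := ltnP (t (ordS (ordS i))) r.
  by apply: (corner_coeff0 hA rn (hv (ordS i)) _ lt); rewrite ordS3.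
have d01 : i != ordS i by rewrite eq_sym ordS_neq.
have d12 : ordS i != ordS (ordS i) by rewrite eq_sym ordS_neq.
have d02 : i != ordS (ordS i) by rewrite eq_sym ordSS_neq.
rewrite mdegE (big_I3_distinct _ d01 d12 d02) in dt.
apply: (corner_coeff0 hA rn (hv (ordS (ordS i)))); rewrite ordS3 ?ti //.
by move: dt ge; clear; lia.
Qed.

Lemma monomialD (c c' : 'I_3 -> nat) :
  monomial (fun l => c l + c' l)%N = monomial c * monomial c'.
Proof. by rewrite -big_split /=; apply: eq_bigr => l _; rewrite exprD. Qed.

Lemma corner_order_divisible d z : (d.+3 <= n)%N -> form d.+3 z ->
  (forall l, val_ge (vR (inl l)) z (d.+3%:Z * mu (vR (inl l)) + d.+3%:Z)) ->
  exists2 w, form d w & z = monomial (fun=> 1%N) * w.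
Proof.
move=> dn [A [hA ->]] hv.
have pos t i : t \in msupp A -> (0 < t i)%N by apply: (corner_monomials_interior _ hA) => //.
exists (\sum_(t <- msupp A) k A@_t * monomial (fun i => t i - 1)%N).
  rewrite big_seq; apply: big_ind => [|x y|t tA]; [exact: form0|exact: formD|].
  apply: formZ; have := monomial_form K (fun i => t i - 1)%N.
  suff -> : (\sum_(l < 3) (t l - 1) = d)%N by [].
  have e3 : (\sum_(l < 3) 1 = 3)%N by rewrite sum_const3.
  apply: (@addIn 3); rewrite -[X in (_ + X)%N = _]e3 -big_split /= addn3.
  rewrite -(dhomog_mdeg hA tA) mdegE; apply: eq_bigr => i _.
  by rewrite subnK // pos.
rewrite fev_monomials mulr_sumr big_seq [RHS]big_seq; apply: eq_bigr => t tA.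
rewrite mulrCA -monomialD; congr (_ * _); apply: eq_bigr => i _.
by rewrite subnKC // pos.
Qed.

Section BoundaryForms.

Variables (e : nat) (en : (e <= n)%N).

(** The monomials X_l^(e - b) X_(l+1)^b with b < e: for e > 0 these are the monomials of degree e
    not divisible by XYZ, each listed once since b = e is left to the next l. There are 3e of
    them. *)
Definition boundary_exp (p : 'I_3 * 'I_e) : 'X_{1..3} :=
  (U_(p.1) *+ (e - p.2) + U_(ordS p.1) *+ p.2)%MM.

Lemma boundary_expE p : [/\ boundary_exp p p.1 = (e - p.2)%N,
  boundary_exp p (ordS p.1) = p.2 & boundary_exp p (ordS (ordS p.1)) = 0%N].
Proof.
case: p => l b; rewrite /boundary_exp /= !mnmDE !mulmnE !mnm1E !eqxx.
have h1 : (l == ordS l) = false by apply/negbTE; rewrite eq_sym ordS_neq.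
have h2 : (ordS l == ordS (ordS l)) = false by apply/negbTE; rewrite eq_sym ordS_neq.
have h3 : (l == ordS (ordS l)) = false by apply/negbTE; rewrite eq_sym ordSS_neq.
by rewrite h1 h2 h3 eq_sym h1 !mul0n !mul1n addn0 add0n.
Qed.

Lemma boundary_exp_mdeg p : mdeg (boundary_exp p) = e.
Proof.
rewrite /boundary_exp mdegD !mdegMn !mdeg1 !mul1n subnK //; exact/ltnW/ltn_ord.
Qed.

Lemma boundary_exp_inj : injective boundary_exp.
Proof.
move=> [l b] [l' b'] h.
have [/= h0 h1 h2] := boundary_expE (l, b); have [/= h0' h1' h2'] := boundary_expE (l', b').
rewrite -h in h0' h1' h2'; have lb := ltn_ord b; have lb' := ltn_ord b'.
have d01 : l != ordS l by rewrite eq_sym ordS_neq.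
have d12 : ordS l != ordS (ordS l) by rewrite eq_sym ordS_neq.
have d02 : l != ordS (ordS l) by rewrite eq_sym ordSS_neq.
have [el|el|el] := I3_distinct d01 d12 d02 l'.
- subst l'; congr (_, _); apply: val_inj; by rewrite /= -h1 -h1'.
- by move: h2'; rewrite el ordS3 h0; move: lb; clear; lia.
- by move: h0'; rewrite el h2; move: lb'; clear; lia.
Qed.

Definition boundary_form (c : 'I_3 * 'I_e -> F) : {mpoly F[3]} :=
  \sum_p c p *: 'X_[boundary_exp p].

Lemma boundary_form_homog c : boundary_form c \is e.-homog.
Proof. by apply: rpred_sum => p _; apply/rpredZ; rewrite dhomogX /= boundary_exp_mdeg. Qed.

Lemma boundary_form_coeff c p : (boundary_form c)@_(boundary_exp p) = c p.
Proof.
rewrite raddf_sum (bigD1 p) //= mcoeffZ mcoeffX eqxx mulr1 big1 ?addr0 // => p' ne.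
by rewrite mcoeffZ mcoeffX (inj_eq boundary_exp_inj) (negbTE ne) mulr0.
Qed.

Lemma boundary_form_free c :
  (forall l, val_ge (vR (inl l)) (fev (boundary_form c)) (e%:Z * mu (vR (inl l)) + e%:Z)) ->
  forall p, c p = 0.
Proof.
move=> hv p; rewrite -boundary_form_coeff; have [_ h1 h2] := boundary_expE p.
apply: (corner_coeff0 (boundary_form_homog c) en (hv p.1) h2).
by rewrite h1.
Qed.

Lemma fev_boundary_form c :
  fev (boundary_form c) = \sum_p k (c p) * fev 'X_[boundary_exp p].
Proof. by rewrite raddf_sum /=; apply: eq_bigr => p _; rewrite mevZ. Qed.

End BoundaryForms.

Section Weight.

Variable c0 : 'I_3 -> nat.
Local Notation d := (\sum_l c0 l)%N.
Hypothesis d_small : (d.+3 <= n)%N.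
Local Notation e := (n - 2 - d)%N.

(** The coefficient at P_l of the divisor A of the monomial with exponents [c0]. *)
Definition corner_order l : nat := (c0 (ordS l) + n * c0 (ordS (ordS l)))%N.

Let monomial_div_c0 l : monomial_div n c0 (inl l : J) = (corner_order l)%:Z.
Proof. by rewrite /= PoszD PoszM. Qed.

Definition corner_div (x : 'I_3 -> int) (i : J) : int := if i is inl l then x l else 0.

(* Multiplication by X_0^(c_0 + 1) X_1^(c_1 + 1) X_2^(c_2 + 1) turns u into a form
   of degree d + 3 whose monomials are all divisible by X_0 X_1 X_2. *)
Lemma pure_gap u : Lsp 0 (corner_div (fun l => - (corner_order l + e)%N%:Z)) u ->
  Lsp 0 (corner_div (fun l => - (corner_order l)%:Z)) u.
Proof.
move=> hu; pose c1 l := (c0 l + 1)%N.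
have sc1 : (\sum_l c1 l = d.+3)%N by rewrite big_split /= (sum_const3 1) addn3.
have := proj2 (Lsp_monomial hn hG curve_smooth separable_root hQ hQP hQQ vR_at 0 _ c1 u) hu.
rewrite sc1 add0n => hy.
(* At P_l the monomial adds [corner_order l] + n + 1 to the order, and n + 1 - e = d + 3. *)
have hy' : Lsp d.+3 (corner_div (fun=> d.+3%:Z)) (u * monomial c1).
  apply: Lsp_le hy => -[l|s] //=; rewrite /c1 /corner_order.
  by move: d_small; clear; move: (\sum_l c0 l)%N (c0 _) (c0 _) => q x y; nia.
have fy : form d.+3 (u * monomial c1).
  apply/(Lsp_form hn hG curve_smooth separable_root vR); apply: Lsp_le hy' => -[l|s] //=.
have [w fw ew] := corner_order_divisible d_small fy (fun l => proj2 hy' (inl l)).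
have {ew} : u * monomial c0 = w.
  apply: (mulfI (monomial_neq0 hn hG K (fun=> 1%N))); rewrite -ew monomialD.
  by rewrite mulrCA [X in u * X]mulrC.
move=> ew; apply/(Lsp_monomial hn hG curve_smooth separable_root hQ hQP hQQ vR_at 0 _ c0).
rewrite ew add0n; move/(Lsp_form hn hG curve_smooth separable_root vR): fw.
by apply: Lsp_le => -[l|s] //; rewrite monomial_div_c0 /= addNr.
Qed.

Local Notation D := (fun l => corner_order l + (corner_order l + e))%N.

(** Two subspaces of one space U are compared: z L(E), with E large enough for Riemann's inequality,
    and the products of the monomial [c0] with boundary forms of degree e vanishing suitably at the
    P_l. U allows poles of order n + 1 at the P_l, because multiplication by XYZ then leads to forms
    of degree n + 1, where dimensions are exact. A low weight makes U too small for the two to be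
    disjoint. *)
Lemma code_weight z : z != 0 -> Lsp (n - 2) (code_div D) z ->
  (\sum_l D l + 3 * e <= n.+1 * (n - 2) + #|[set s | res (inr s) z != 0%R]|)%N.
Proof.
move=> z0 hz; set S := [set s | _]; set w := #|S|; rewrite leqNgt; apply/negP => lt.
(* x_l is the excess of the order of z [om] at P_l over D_l. It enlarges the first subspace and
   imposes conditions on the second, so it cancels in the total dimension. *)
have /choice [x hx] : forall l, exists x : nat,
    vR (inl l) z = W (inl l) + (D l + x)%N%:Z.
  move=> l; have := proj2 hz (inl l); rewrite val_ge_neq0 //= => h.
  exists (absz (vR (inl l) z - W (inl l) - (D l)%:Z)%R).
  by move: h; move: (corner_order l + _)%N (W _) (vR _ z) => p q q'; clear; lia.
pose inS s : int := - ((s \in S) : nat)%:Z.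
have zreg s : s \notin S -> val_ge (vR (inr s)) z (W (inr s)).
  rewrite inE negbK => /eqP r0.
  apply/(res_regular hn hG curve_smooth separable_root hQ vR_at kap_neq0 kap_val) => //.
  exact: code_polar hz.
pose a0 (i : J) : int := match i with inl l => (D l + x l)%N%:Z | inr s => inS s end.
have hz0 : Lsp (n - 2) a0 z.
  split=> [|[l|s]]; [by case: hz|by right; rewrite hx|].
  rewrite /= /inS; case: (boolP (s \in S)) => sS; first exact: (proj2 hz (inr s)).
  by rewrite subr0; apply: zreg.
pose aU (i : J) : int := match i with inl l => - n.+1%:Z | inr s => inS s end.
have bn := bin2_double n.-1; rewrite prednK ?(ltn_trans _ hn) // in bn.
have Cn : ('C(n, 2) <= n.+1 * n.+1)%N by move: bn; clear; case: n => [|q] /=; nia.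
(* Each of the w points with nonzero residue allows one simple pole, hence at most one more
   dimension than the forms of degree n + 1. *)
have hU : dimle k (Lsp (n - 2) aU) (n.+1 * n.+1 + 1 - 'C(n, 2) + w).
  have e3 : (n - 2 + \sum_(l < 3) 1 = n.+1 + 0)%N by rewrite sum_const3; move: hn; clear; lia.
  have er : (n.+1 * n.+1 + 1 - 'C(n, 2) + 'C(n, 2) = n.+1 * (n.+1 + 0) + 1)%N.
    by rewrite addn0 subnK //; move: Cn; clear; lia.
  have [_ hf] := dim_form_large hn hG K er.
  pose aS (i : J) : int := if i is inr s then inS s else 0.
  pose b (i : J) := if i is inr s then (s \in S : nat) else 0%N.
  have sb : (\sum_i b i = w)%N.
    rewrite sum_J /= big1 // add0r /w -sum1_card [RHS]big_mkcond.
    by apply: eq_bigr => s _; case: (s \in S).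
  have hS : dimle k (Lsp (n.+1 + 0) aS) (n.+1 * n.+1 + 1 - 'C(n, 2) + w).
    rewrite -sb; apply: (Lsp_cut_le hn hG curve_smooth separable_root hQ vR_at).
    apply: dimle_sub hf => y hy; apply/(Lsp_form hn hG curve_smooth separable_root vR).
    by apply: Lsp_le hy => -[l|s] //=; rewrite /inS addNr.
  move=> q /(dimge_mul (monomial_neq0 hn hG K (fun=> 1%N))) hq; apply: hS.
  apply: dimge_sub hq => y [y' hy' ->].
  have := proj2 (Lsp_monomial hn hG curve_smooth separable_root hQ hQP hQQ vR_at _ _ (fun=> 1%N)
    y') hy'.
  rewrite e3 mulrC; apply: Lsp_le => -[l|s] /=; last by rewrite addr0.
  by clear; lia.
pose aV (i : J) : int := corner_div (fun l => - (D l + x l + n.+1)%N%:Z) i.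
pose U1 y := exists2 u, Lsp 0 aV u & y = z * u.
have U1s : subspace k U1.
  have [s0 sD] := Lsp_subspace vR 0 aV; split; first by exists 0; rewrite ?mulr0.
  move=> p q _ _ [u hu ->] [u' hu' ->]; exists (k p * u + k q * u'); first exact: sD.
  by rewrite mulrDr !(mulrCA z).
have U1U y : U1 y -> Lsp (n - 2) aU y.
  move=> [u hu ->]; have := LspM hz0 hu; rewrite addn0; apply: Lsp_le => -[l|s] /=.
    by rewrite !PoszD; clear; lia.
  by rewrite addr0.
have sV : \sum_i aV i = - (\sum_l D l + \sum_l x l + 3 * n.+1)%N%:Z.
  rewrite sum_J /= [X in _ + X]big1 // addr0 sumrN; congr (- _).
  by rewrite -(big_morph _ PoszD (erefl _)) !big_split /= !sum_const3.
have hU1 : dimge k U1 (\sum_l D l + \sum_l x l + 3 * n.+1 + 1 - 'C(n, 2)).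
  apply: dimge_mul z0 _.
  apply: (Lsp_riemann hn hG curve_smooth separable_root hQ hQP hQQ vR_at) => //.
  rewrite sV mulr0 add0r; move: lt bn hn; clear.
  move: (\sum_l D l)%N (\sum_l x l)%N => p q; case: n => [|n'] //=; nia.
have lt' : (n.+1 * n.+1 + 1 + w < \sum_l D l + 3 * e + 3 * n.+1 + 1)%N.
  by move: lt hn; clear; move: (\sum_l D l)%N (3 * e)%N => p q; case: n => [|[|n']] //=; nia.
(* If the total excess is at least 3e, the first subspace alone is already too large for U. *)
have [x_large|x_small] := leqP (3 * e) (\sum_l x l).
  have := hU _ (dimge_sub U1U hU1); move: lt' x_large Cn; clear.
  by move: (\sum_l D l)%N (\sum_l x l)%N (3 * e)%N => p q r; lia.
pose U2 y := exists c, y = monomial c0 * fev (@boundary_form e c).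
have en : (e <= n)%N by rewrite -subnDA leq_subr.
have U2s : subspace k U2.
  split; first by exists (fun=> 0); rewrite fev_boundary_form big1 ?mulr0 // => p _;
    rewrite rmorph0 mul0r.
  move=> p q _ _ [c ->] [c' ->]; exists (fun i => p * c i + q * c' i).
  rewrite !fev_boundary_form !mulr_sumr -big_split /=; apply: eq_bigr => i _.
  by rewrite rmorphD !rmorphM /=; ring.
have hU2 : dimge k U2 (3 * e).
  have := @dimge_fin F K k U2 ('I_3 * 'I_e)%type
    (fun p => monomial c0 * fev 'X_[boundary_exp p]).
  rewrite card_prod !card_ord; apply=> [p|c ec].
    exists (fun q => (q == p)%:R); rewrite fev_boundary_form (bigD1 p) //= eqxx rmorph1 mul1r.
    by rewrite [X in fev _ + X]big1 ?addr0 // => q /negbTE ->; rewrite rmorph0 mul0r.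
  apply: (boundary_form_free en) => l; left; rewrite fev_boundary_form.
  apply: (mulfI (monomial_neq0 hn hG K c0)); rewrite mulr0 -[RHS]ec mulr_sumr.
  by apply: eq_bigr => p _; rewrite mulrCA.
pose a2 (i : J) : int := W i + corner_div (fun l => (corner_order l)%:Z) i.
pose b2 (i : J) := if i is inl l then x l else 0%N.
have ed : (e + d = n - 2)%N by move: d_small; clear; lia.
have Wde v : (n - 2)%N%:Z * mu v = d%:Z * mu v + e%:Z * mu v.
  by rewrite -mulrDl -PoszD addnC ed.
have U2v y : U2 y -> forall i, val_ge (vR i) y (a2 i).
  move=> [c ->] i.
  have h1 := val_form (vR i) (boundary_form_homog c).
  have -> : a2 i = (d%:Z * mu (vR i) + monomial_div n c0 i) + e%:Z * mu (vR i).
    by rewrite /a2 Wde addrAC; congr (_ + _ + _); case: (i) => [l|s].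
  apply: val_geM h1; right.
  by rewrite (monomial_val_at hn hG curve_smooth separable_root hQ hQP hQQ vR_at).
have [h2 _] := vanishing_step hn hG curve_smooth separable_root hQ vR_at b2 U2s U2v.
have sb2 : (\sum_i b2 i = \sum_l x l)%N by rewrite sum_J /= [X in _ + X]big1 // addr0.
have hU2' : dimge k (vanishing vR U2 a2 b2) (3 * e - \sum_l x l).
  by apply: h2; rewrite sb2 subnK // ltnW.
have U2U y : vanishing vR U2 a2 b2 y -> Lsp (n - 2) aU y.
  move=> [[c ->] _]; apply: (@Lsp_le _ _ _ _ _ _ _ (fun i => 0 + monomial_div n c0 i)).
    case=> [l|s] /=; last by rewrite addr0 oppr_le0.
    by rewrite add0r; apply: (@le_trans _ _ 0).
  rewrite mulrC -[X in Lsp X]ed.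
  apply/(Lsp_monomial hn hG curve_smooth separable_root hQ hQP hQQ vR_at).
  apply/(Lsp_form hn hG curve_smooth separable_root vR).
  exact/form_fev/boundary_form_homog.
have [|om [om0 [u hu eom] [[c ec] hc]]] :=
  dim_intersection U1s (vanishing_subspace vR a2 b2 U2s) U1U U2U hU1 hU2' hU.
  move: lt' x_small Cn bn; clear.
  by move: (\sum_l D l)%N (\sum_l x l)%N (3 * e)%N => p q r; lia.
(* The product z u has order at least that of the monomial plus x_l, and dividing by z removes D_l +
   x_l; what remains is minus the coefficient of B. *)
have u_gap : Lsp 0 (corner_div (fun l => - (corner_order l + e)%N%:Z)) u.
  split=> [|[l|s]]; [by case: hu| |exact: (proj2 hu (inr s))].
  have := hc (inl l); rewrite eom mulrC val_geMr // hx /a2 /b2 /= mul0r add0r.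
  by apply: val_ge_le; rewrite !PoszD; move: (W _) => q; clear; lia.
have hu' := pure_gap u_gap.
(* With u in L(A), z u has order at least D_l minus the coefficient of A, that is the order of the
   monomial plus e; so the boundary form vanishes to order e at each P_l. *)
have c_0 : forall p, c p = 0.
  apply: (boundary_form_free en) => l.
  have : val_ge (vR (inl l)) (z * u) (W (inl l) + (corner_order l)%:Z + e%:Z).
    have := proj2 (LspM hz0 hu') (inl l); rewrite addn0.
    by apply: val_ge_le; rewrite /= !PoszD; move: (W _) => q; clear; lia.
  rewrite -eom ec mulrC val_geMr ?(monomial_neq0 hn hG) //.
  rewrite (monomial_val_at hn hG curve_smooth separable_root hQ hQP hQQ vR_at) monomial_div_c0.
  apply: val_ge_le; rewrite Wde.
  by move: (d%:Z * _) (e%:Z * _) => q q'; clear; lia.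
case/eqP: om0; rewrite ec fev_boundary_form [X in _ * X]big1 ?mulr0 // => p _.
by rewrite c_0 rmorph0 mul0r.
Qed.

End Weight.

End Distance.

(** * The Goppa code as a space of residues *)

Section GoppaCode.

Variables (F : fieldType) (n : nat) (hn : (3 <= n)%N).
Variables (G : {mpoly F[3]}) (hG : G \is (n - 2)%N.-homog).
Local Notation f := (curve_poly n G).
Variable K : function_field f.
Local Notation k := (ff_const K).
Local Notation X := (gen_coord K).
Local Notation fev := (mev k X).
Variables (L : closedFieldType) (iL : {rmorphism F -> L}).
Hypothesis curve_smooth : forall P : 'I_3 -> L, (exists i, P i != 0) ->
  mev iL P f = 0 -> exists s, mev iL P f^`M(s) != 0.
Hypothesis separable_root : forall x : L, exists t : {poly F},
  ev1 iL x t = 0 /\ t^`() = -1.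

Variables (m : nat) (Q : 'I_m -> 'rV[F]_3).
Hypothesis hQ : forall s, on_curve f (Q s).
Hypothesis hQP : forall s (l : 'I_3), ~ same_point (Q s) (delta_mx 0 l).
Hypothesis hQQ : forall s t, s != t -> ~ same_point (Q s) (Q t).


Variable Om : differentials K.

(* F_2 = 2 A + e (P_1 + P_2 + P_3), where A is the divisor of X^i Y^j Z^k and
   e = n - 2 - d. *)
Definition gap_coeff (c0 : 'I_3 -> nat) (l : 'I_3) : nat :=
  corner_order n c0 l + (corner_order n c0 l + (n - 2 - \sum_l c0 l)).

(** The map sending z to z [om] identifies L((n - 2) H - F_2 + sum of the Q_s) with the space of
    differentials defining the code, and the residue at Q_s with the value of z [kap] there. The
    bounds of the preceding sections then concern the code itself. *)
Lemma goppa_parameters (c0 : 'I_3 -> nat) :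
  ((\sum_l c0 l).+3 <= n)%N -> (n.+1 * (n - 2) < \sum_l gap_coeff c0 l)%N ->
  (\sum_l gap_coeff c0 l < m)%N ->
  exists C : {vspace 'rV[F]_m},
    [/\ forall c : 'rV[F]_m, c \in C <->
          goppa_code Om Q (sum_points (fun l => (gap_coeff c0 l)%:Z) (delta_mx 0)) c,
        (\dim C + \sum_l gap_coeff c0 l + 1 = m + 'C(n, 2))%N
      & forall c : 'rV[F]_m, c \in C -> c != 0 ->
          (\sum_l gap_coeff c0 l + 3 * (n - 2 - \sum_l c0 l) <=
           n.+1 * (n - 2) + #|[set s | (c 0 s != 0)%R]|)%N].
Proof.
set D := gap_coeff c0 => d_small D_large D_small.
have [om om0 om_wedge] := omega_exists hn hG curve_smooth Om.
have R_curve := support_on_curve hn hG hQ.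
have /choice [vR vR_at] : forall i, exists v : place K, place_at v (support_point Q i).
  by move=> i; apply: (place_at_exists hn hG K curve_smooth separable_root).
have vR_inj := support_place_inj hn hG curve_smooth separable_root hQ hQP hQQ vR_at.
have n2 : (n - 2)%N%:Z = n%:Z - 2 by move: hn; clear; lia.
have /choice [kap hkap] : forall i, exists kap, [/\ kap != 0,
    vR i kap = 1 - (n - 2)%N%:Z * mu (vR i) &
    forall z c, val_ge (vR i) z ((n - 2)%N%:Z * mu (vR i) - 1) ->
      (residue_at (support_point Q i) (z *: om) c <-> val_ge (vR i) (z * kap - k c) 1)].
  by rewrite n2 => i; apply: (residue_atP hn hG curve_smooth separable_root om0 om_wedge).
have kap_neq0 i : kap i != 0 by have [] := hkap i.
have kap_val i : vR i (kap i) = 1 - (n - 2)%N%:Z * mu (vR i) by have [] := hkap i.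
have pd i v : point_div (support_point Q i) v = `[< v = vR i >]%:Z.
  rewrite /point_div; case: asboolP => [h|h]; case: asboolP => // h'.
    by case: h'; apply/(support_placeP hn hG curve_smooth separable_root hQ vR_at).
  by case: h; apply/(support_placeP hn hG curve_smooth separable_root hQ vR_at).
have pd_at i j : point_div (support_point Q i) (vR j) = (i == j)%:Z.
  rewrite pd; congr (Posz (nat_of_bool _)); apply/asboolP/eqP => [/vR_inj -> //|-> //].
have pd_off v i : (forall j, v <> vR j) -> point_div (support_point Q i) v = 0.
  by move=> h; rewrite pd; case: asboolP => // /h.
pose E (v : place K) : int := sum_points (fun l => (D l)%:Z) (delta_mx 0) v - sum_points (fun=> 1)
  Q v.
have E_at i : E (vR i) = code_div D i.
  rewrite /E /sum_points; case: i => [l|s] /=.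
    rewrite (bigD1 l) //= (pd_at (inl l)) eqxx mulr1 big1 => [|l' ne]; last first.
      by rewrite (pd_at (inl l')) (inj_eq (@inl_inj _ _)) (negbTE ne) mulr0.
    by rewrite big1 ?addr0 ?subr0 // => s _; rewrite (pd_at (inr s)) mulr0.
  rewrite big1 => [|l _]; last by rewrite (pd_at (inl l)) mulr0.
  rewrite (bigD1 s) //= (pd_at (inr s)) eqxx mulr1 big1 ?addr0 // => s' ne.
  by rewrite (pd_at (inr s')) (inj_eq (@inr_inj _ _)) (negbTE ne) mulr0.
have E_off v : (forall j, v <> vR j) -> E v = 0.
  move=> h; rewrite /E /sum_points !big1 ?subrr // => [s|l] _.
    by rewrite (pd_off _ (inr s) h) mulr0.
  by rewrite (pd_off _ (inl l) h) mulr0.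
have LspE z : Lsp vR (n - 2) (code_div D) z <-> forall v, val_ge v z (canonical_val v + E v).
  rewrite /canonical_val -n2; split=> [[h h'] v|h]; last first.
    by split=> [v hv|i]; [have := h v; rewrite E_off // addr0|have := h (vR i); rewrite E_at].
  have [[i ->]|no] := pselect (exists i, v = vR i); first by rewrite E_at.
  by rewrite E_off ?addr0; [apply: h => i e|move=> i e]; apply: no; exists i.
pose P (c : 'rV[F]_m) := exists2 z, Lsp vR (n - 2) (code_div D) z &
  forall s, c 0 s = res vR kap (inr s) z.
have P_code c : P c <-> goppa_code Om Q (sum_points (fun l => (D l)%:Z) (delta_mx 0)) c.
  split=> [[z hz hc]|[eta]].
    exists (z *: om).
      apply/(in_OmegaP hn hG curve_smooth separable_root om0 om_wedge).
      by exists z => //; apply/LspE.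
    move=> s; have hp := code_polar (inr s) hz.
    have [_ _ h] := hkap (inr s); apply/(h _ _ hp); rewrite hc.
    exact: (resP hn hG curve_smooth separable_root hQ vR_at kap_neq0 kap_val hp).
  move/(in_OmegaP hn hG curve_smooth separable_root om0 om_wedge) => [z -> /LspE hz] hc.
  exists z => // s; have [_ _ h] := hkap (inr s).
  by apply/esym/res_eq/(h _ _ (code_polar (inr s) hz)); apply: hc.
have [||C hC] := @vspace_of_pred F _ P.
- exists 0; first by case: (Lsp_subspace vR (n - 2) (code_div D)).
  move=> s; rewrite mxE.
  by rewrite (res0 hn hG curve_smooth separable_root hQ vR_at kap_neq0 kap_val).
- move=> a x y [z hz hx] [w hw hy]; exists (k a * z + k 1 * w).
    by case: (Lsp_subspace vR (n - 2) (code_div D)) => _; apply.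
  move=> s; rewrite (resL hn hG curve_smooth separable_root hQ vR_at kap_neq0 kap_val) ?mul1r.
  + by rewrite !mxE hx hy.
  + exact: code_polar hz.
  + exact: code_polar hw.
exists C; split=> [c||c /hC [z hz hc] c_neq0].
- by split=> [/hC /P_code|/P_code /hC].
- apply/eqP; rewrite eqn_leq.
  rewrite (code_dim_le hn hG curve_smooth separable_root hQ hQP hQQ vR_at kap_neq0 kap_val D_large
    D_small hC).
  by rewrite (code_dim_ge hn hG curve_smooth separable_root hQ hQP hQQ vR_at kap_neq0 kap_val
    D_large D_small hC).
- have z0 : z != 0.
    apply: contraNneq c_neq0 => z0; apply/eqP/rowP => s; rewrite hc z0 mxE.
    by rewrite (res0 hn hG curve_smooth separable_root hQ vR_at kap_neq0 kap_val).
  have -> : [set s | c 0 s != 0] = [set s | res vR kap (inr s) z != 0].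
    by apply/setP => s; rewrite !inE hc.
  exact: (code_weight hn hG curve_smooth separable_root hQ hQP hQQ vR_at kap_neq0 kap_val).
Qed.

End GoppaCode.

(** * Minimum distance and the numerical conclusion *)

(** The distance of two words is the weight of their difference. The bound by m covers the default
    value of [min_dist], which it takes on the zero code. *)
Lemma le_min_dist (F : finFieldType) (m : nat) (C : {vspace 'rV[F]_m}) (r : int) :
  r <= m%:Z -> (forall c, c \in C -> c != 0 -> r <= #|[set s | c 0 s != 0]|%:Z) ->
  r <= (min_dist C)%:Z.
Proof.
move=> rm h; rewrite /min_dist; elim/big_ind: _ => // [x y|[c c'] /= /and3P[cC c'C ne]].
  by rewrite /minn; case: ifP.
have := h (c - c') (rpredB cC c'C); rewrite subr_eq0 => /(_ ne); congr (_ <= Posz #|pred_of_set _|).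
by apply/setP => s; rewrite !inE !mxE subr_eq0.
Qed.

Theorem theorem6p2 (F : finFieldType) (n : nat) (hn : (3 <= n)%N)
    (G : {mpoly F[3]}) (hG : G \is (n - 2)%N.-homog)
    (hX : nonsingular (curve_poly n G))
    (K : function_field (curve_poly n G)) (Om : differentials K)
    (i j k m : nat) (Q : 'I_m -> 'rV[F]_3)
    (hQ : forall s, on_curve (curve_poly n G) (Q s))
    (hQP : forall s (l : 'I_3), ~ same_point (Q s) (delta_mx 0 l))
    (hQQ : forall s t, s != t -> ~ same_point (Q s) (Q t)) :
  let d := (i + j + k)%N in
  let N := n%:Z in
  let I := i%:Z in let J := j%:Z in let L := k%:Z in
  let n_ (s : 'I_3) : int :=
    nth 0 [:: L * N + J + 1; I * N + L + 1; J * N + I + 1] s in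
  let p_ (s : 'I_3) : int :=
    nth 0 [:: (L + 1) * N - L - I - 2;
              (I + 1) * N - I - J - 2;
              (J + 1) * N - J - L - 2] s in
  let F2 : divisor K :=
    sum_points (fun s : 'I_3 => n_ s + p_ s - 1) (delta_mx 0) in
  (n%:R - 2) ^+ 2 / (2 * n%:R - 1) < d%:R :> rat ->
  (d <= n - 3)%N ->
  2 * N ^+ 2 - 4 * N - 2 <= m%:Z ->
  exists C : {vspace 'rV[F]_m},
    [/\ forall c : 'rV[F]_m, c \in C <-> goppa_code Om Q F2 c,
        (\dim C)%:R = m%:R + 1 / 2 * n%:R ^+ 2
                      - (2 * d%:R + 7 / 2) * n%:R + d%:R + 5 :> rat
      & (2 * d%:Z + 7) * N - N ^+ 2 - 4 * d%:Z - 10 <= (min_dist C)%:Z].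
Proof.
move=> d N I J L n_ p_ F2 hd dn hm.
have [L' [iL iL_int]] := countable_algebraic_closure F.
have curve_smooth (P : 'I_3 -> L') : (exists i, P i != 0) ->
    mev iL P (curve_poly n G) = 0 -> exists s, mev iL P (curve_poly n G)^`M(s) != 0.
  move=> [l Pl] Pf; have rowE : (\row_l P l) 0 =1 P by move=> l'; rewrite mxE.
  have [|s] := hX _ _ iL_int (\row_l P l).
    split; first by apply: contraNneq Pl => /rowP /(_ l); rewrite !mxE => ->.
    by rewrite meval_map (eq_mev _ _ rowE).
  by rewrite mderiv_map meval_map (eq_mev _ _ rowE); exists s.
(* Every element of the algebraic closure is fixed by a power of Frobenius over the finite field F,
   whence t. *)
have separable_root (x : L') : exists t : {poly F}, ev1 iL x t = 0 /\ t^`() = -1.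
  by have [t [tx t1]] := integral_simple_root (iL_int x); exists t; rewrite ev1E.
pose c0 (l : 'I_3) : nat := nth 0%N [:: i; j; k] l.
have sc0 : (\sum_l c0 l = d)%N by rewrite !big_ord_recl big_ord0 /= addn0 addnA.
have cE l : gap_coeff n c0 l = (2 * (c0 (ordS l) + n * c0 (ordS (ordS l))) + (n - 2 - d))%N.
  by rewrite /gap_coeff /corner_order sc0; lia.
have d3 : (d.+3 <= n)%N by lia.
have sD : (\sum_l gap_coeff n c0 l = 2 * (n.+1 * d) + 3 * (n - 2 - d))%N.
  rewrite (eq_bigr _ (fun l _ => cE l)) big_I3 !ordSE /c0 /=.
  by move: (n - 2 - d)%N => s; rewrite /d; clear; nia.
have hd' : ((n - 2) ^ 2 < d * (2 * n - 1))%N.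
  move: hd; rewrite ltr_pdivrMr; last by rewrite subr_gt0 -natrM ltr1n; lia.
  rewrite -[n%:R - 2]natrB; last by lia.
  rewrite -natrM -(natrB _ (m := (2 * n)%N) (n := 1%N)); last by lia.
  by rewrite -natrX -natrM ltr_nat.
have hm' : (2 * n ^ 2 <= m + 4 * n + 2)%N by move: hm; rewrite /N; clear; nia.
(* deg F_2 = (2n - 1) d + 3 (n - 2) and (n + 1)(n - 2) = (n - 2)^2 + 3 (n - 2), so this is [hd']
   with 3 (n - 2) added on both sides. *)
have D_large : (n.+1 * (n - 2) < \sum_l gap_coeff n c0 l)%N.
  rewrite sD; have en : n = (n - 2).+2 by lia.
  move: (n - 2)%N en hd' d3 => q ->; move: (d) => d'; rewrite -mulnn; clear; nia.
(* For the largest value d = n - 3 the degree is 2n^2 - 4n - 3, one less than the bound assumed for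
   m. *)
have D_small : (\sum_l gap_coeff n c0 l < m)%N.
  rewrite sD; have en : n = (n - d.+3 + d.+3)%N by rewrite subnK.
  move: (n - d.+3)%N en hm' => q ->; rewrite -mulnn; move: (d) => d'; clear; nia.
rewrite -sc0 in d3.
have [C [hC dimC wC]] := goppa_parameters hn hG curve_smooth separable_root hQ hQP hQQ Om
  d3 D_large D_small.
(* At each P_l, n_s + p_s - 1 is twice the order of X^i Y^j Z^k plus n - 2 - d. *)
have eF2 : F2 = sum_points (fun l => (gap_coeff n c0 l)%:Z) (delta_mx 0).
  congr sum_points; apply/funext => l; rewrite cE /c0 /n_ /p_ /I /J /L /N /d.
  by case: (I3_cases l) => ->; rewrite !ordSE /=; move: dn; rewrite /d; move: hn; clear; nia.
clearbody d; rewrite sc0 sD in dimC wC; have bn := bin2_double n.-1; rewrite prednK in bn;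
  last by lia.
exists C; split; first by rewrite eF2.
- have nE : (n = n - 2 - d + 2 + d)%N by lia.
  have nQ : n%:R = (n - 2 - d)%N%:R + 2 + d%:R :> rat by rewrite {1}nE !natrD.
  have bQ : 'C(n, 2)%:R * 2 = n%:R * (n%:R - 1) :> rat.
    by rewrite -natrM bn natrM -subn1 natrB //; lia.
  have := congr1 (fun x => x%:R : rat) dimC; move: nQ bQ;
    move: (n - 2 - d)%N 'C(n, 2) (\dim C) => s b c.
  by rewrite -[n.+1]addn1 !(natrD, natrM); lra.
- apply: le_min_dist => [|c cC c0'].
    (* The claimed bound is at most m, as the default value of [min_dist] requires. *)
    by move: hm dn hn; rewrite /N; move: (d) => d'; clear; nia.
  have := wC c cC c0'; move: (#|_|) => w.
  by rewrite /N; move: (d) dn hn; clear; move=> d'; nia.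
Qed.
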